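(* Let $X$ be a symmetrically self-similar graph with bounded geometry and let $d$ be its transition function. Then the Julia set of $d$ is either a real interval in $\overline{\mathbb{C}}$ (i.e. a connected subset of $\overline{\mathbb{R}}$) or a Cantor set.
   Context: Graphs are connected, locally finite, infinite, undirected, without loops or multiple edges. For $C\subseteq VX$, $\theta C$ is the set of vertices of $VX\setminus C$ adjacent to a vertex of $C$, $\overline C=C\cup\theta C$. For $F\subseteq VX$, $\mathcal{C}_X(F)$ is the set of connected components (as vertex sets) of the subgraph induced on $VX\setminus F$. The reduced graph $X_F$ has vertex set $F$, distinct $x,y$ adjacent iff $x,y\in\theta C$ for some $C\in\mathcal{C}_X(F)$. $X$ is self-similar with respect to $F$ if (F1) no two vertices of $F$ are adjacent in $X$, (F2) distinct $C,D\in\mathcal{C}_X(F)$ satisfy $|\overline C\cap\overline D|\le1$, (F3) there is a graph isomorphism $X\to X_F$. Cells are the elements of $\mathcal{C}_X(F)$; $\hat C$ is the subgraph induced on $\overline C$. Symmetrically self-similar: additionally (S1) all cells finite and any two $\hat C,\hat D$ are isomorphic via an isomorphism mapping $\theta C$ to $\theta D$, and (S3) automorphisms of $\hat C$ preserving $\theta C$ act doubly transitively on $\theta C$. $\theta_X=|\theta C|$. Bounded geometry: vertex degrees bounded, cells finite, boundary sizes of cells bounded. For $B\subseteq\theta C$, $Q_B$ has entries $1/\deg_{\hat C}x$ for $x\sim y$, $x\notin B$, else 0, and $Q^*_B(z)=(I-zQ_B)^{-1}$. The transition function is the rational function $d(z)=(\theta_X-1)(Q^*_{\theta C\setminus\{v\}}(z))_{v,w}$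 for distinct $v,w\in\theta C$ (independent of choices). *)

(* Defs.v *)
From mathcomp Require Import all_boot all_order all_algebra.
From mathcomp Require Import fraction generic_quotient finmap complex.
From mathcomp Require Import all_classical all_reals all_analysis.

Set Implicit Arguments.
Unset Strict Implicit.
Unset Printing Implicit Defensive.

Import Order.TTheory GRing.Theory Num.Theory.
Import numFieldNormedType.Exports.

Local Open Scope classical_set_scope.
Local Open Scope card_scope.
Local Open Scope ring_scope.

Section Graphs.
Context {V : choiceType}.
Implicit Types (adj : rel V) (F C D : set V).

Definition infinite_graph adj : Prop :=
  [/\ irreflexive adj,
      symmetric adj,
      (forall x, finite_set [set y | adj x y]),
      infinite_set [set: V] &
      (forall x y, exists2 p : seq V, path adj x p & last x p = y)].

(* theta C *)
Definition vboundary adj C : set V :=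
  [set y | ~ C y /\ exists2 x, C x & adj x y].

(* \overline C *)
Definition vclosure adj C : set V := C `|` vboundary adj C.

Definition connected_off adj F (x y : V) : Prop :=
  exists p : seq V,
    [/\ path adj x p, last x p = y & all (fun z => z \notin F) (x :: p)].

Definition cells adj F : set (set V) :=
  [set C | exists2 x, ~ F x & C = [set y | connected_off adj F x y]].

(* Adjacency of the reduced graph X_F, whose vertex set is F. *)
Definition reduced_adj adj F (x y : V) : Prop :=
  x <> y /\
  exists C, [/\ cells adj F C, vboundary adj C x & vboundary adj C y].

Definition self_similar adj F : Prop :=
  [/\ (forall x y, F x -> F y -> ~~ adj x y),
      (forall C D, cells adj F C -> cells adj F D -> C <> D ->
         is_subset1 (vclosure adj C `&` vclosure adj D)) &
      (exists f : V -> V, set_bij [set: V] F f /\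
         forall x y, adj x y <-> reduced_adj adj F (f x) (f y))].

(* f restricts to a graph isomorphism from \hat C onto \hat D that maps
   theta C onto theta D; the values of f outside \overline C are irrelevant. *)
Definition cell_iso adj C D (f : V -> V) : Prop :=
  [/\ set_bij (vclosure adj C) (vclosure adj D) f,
      (forall x y, vclosure adj C x -> vclosure adj C y ->
         adj (f x) (f y) = adj x y) &
      f @` vboundary adj C = vboundary adj D].

Definition symmetrically_self_similar adj F : Prop :=
  [/\ self_similar adj F,
      (forall C, cells adj F C -> finite_set C),
      (forall C D, cells adj F C -> cells adj F D ->
         exists f, cell_iso adj C D f) &
      (forall C, cells adj F C -> forall x1 x2 y1 y2,
         vboundary adj C x1 -> vboundary adj C x2 -> x1 <> x2 ->
         vboundary adj C y1 -> vboundary adj C y2 -> y1 <> y2 ->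
         exists f, [/\ cell_iso adj C C f, f x1 = y1 & f x2 = y2])].

Definition bounded_geometry adj F : Prop :=
  [/\ (exists M : nat, forall x, [set y | adj x y] #<= `I_M),
      (forall C, cells adj F C -> finite_set C) &
      (exists M : nat, forall C, cells adj F C ->
         vboundary adj C #<= `I_M)].

End Graphs.

Section Transition.
Context {V : choiceType} (K : fieldType).
Implicit Types (adj : rel V) (B C : set V).

(* The vertex set of \hat C, as a finite type; [fset_set] is only meaningful
   on finite sets, and \overline C is finite when C is a finite cell of a
   locally finite graph. *)
Definition cell_vertices adj C : {fset V} := fset_set (vclosure adj C).

Definition cell_degree adj C (x : V) : nat :=
  #|` [fset y in cell_vertices adj C | adj x y]%fset|.

(* Rows and columns are indexed by \overline C through [enum_rank]. *)
Definition cell_mx adj C B : 'M[{fraction {poly K}}]_#|{: cell_vertices adj C}| :=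
  \matrix_(i, j)
    let x := val (enum_val i) in let y := val (enum_val j) in
    if adj x y && (x \notin B) then (cell_degree adj C x)%:R^-1 else 0.

(* Q^*_B(z) = (I - z Q_B)^{-1}, computed over the field K(z). *)
Definition cell_resolvent adj C B
    (x y : cell_vertices adj C) : {fraction {poly K}} :=
  invmx (1%:M - tofrac 'X *: cell_mx adj C B) (enum_rank x) (enum_rank y).

Definition transition_function adj C
    (v w : cell_vertices adj C) : {fraction {poly K}} :=
  (#|` fset_set (vboundary adj C)|%:R - 1) *
  cell_resolvent (vboundary adj C `\ val v) v w.

End Transition.

(* R[i]^o carries the topology of the modulus on R[i]. *)
Notation sphere R := (one_point_compactification R[i]^o).

Section Julia.
Context {R : realType}.
Local Notation sphere := (sphere R).

(* d is written as p/q in lowest terms; a finite value at infinity is the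
   ratio of the coefficients of degree deg q, which is 0 if deg p < deg q. *)
Definition ratfun_eval (d : {fraction {poly R[i]}}) (z : sphere) : sphere :=
  let r := repr d in
  let g := gcdp (fraction.frac r).1 (fraction.frac r).2 in
  let p := (fraction.frac r).1 %/ g in
  let q := (fraction.frac r).2 %/ g in
  match z with
  | Some a => if q.[a] == 0 then None else Some (p.[a] / q.[a])
  | None => if (size q < size p)%N then None
            else Some (p`_(size q).-1 / lead_coef q)
  end.

Definition cabs (a : R[i]) : R := complex.Re `|a|.

Definition chordal (z w : sphere) : R :=
  match z, w with
  | Some a, Some b =>
      2 * cabs (a - b) /
      (Num.sqrt (1 + cabs a ^+ 2) * Num.sqrt (1 + cabs b ^+ 2))
  | Some a, None | None, Some a => 2 / Num.sqrt (1 + cabs a ^+ 2)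
  | None, None => 0
  end.

(* Normality in the sense of Montel: every sequence of members of the family
   has a subsequence converging uniformly, for the chordal metric, on the
   compact subsets of U. *)
Definition normal_on (U : set sphere) (H : set (sphere -> sphere)) : Prop :=
  forall u : nat -> sphere -> sphere, (forall k, H (u k)) ->
  exists (phi : nat -> nat) (g : sphere -> sphere),
    {homo phi : m n / (m < n)%N} /\
    forall A : set sphere, compact A -> A `<=` U ->
    forall e : R, 0 < e ->
    exists N : nat, forall k, (N <= k)%N -> forall z, A z ->
      chordal (u (phi k) z) (g z) < e.

Definition fatou_set (f : sphere -> sphere) : set sphere :=
  [set z | exists U : set sphere, [/\ open U, U z &
     normal_on U [set h | exists n : nat, h = iter n f]]].

Definition julia_set (f : sphere -> sphere) : set sphere := ~` fatou_set f.

(* The extended real line, as a subset of the sphere. *)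
Definition real_circle : set sphere :=
  [set z | if z is Some a then complex.Im a = 0 else True].

Definition real_interval (A : set sphere) : Prop :=
  [/\ A !=set0, A `<=` real_circle & connected A].

Definition cantor_set (A : set sphere) : Prop :=
  [/\ A !=set0, compact A, perfect_set A & totally_disconnected A].

End Julia.

(* Main.v *)
Require Import Defs.
From mathcomp Require Import all_boot all_order all_algebra.
From mathcomp Require Import fraction generic_quotient finmap complex.
From mathcomp Require Import all_classical all_reals all_analysis.
From mathcomp Require Import ring lra.

(* Let th be the size of the boundary of C and c = 1 / (th - 1). The
   normalised adjacency matrix of \hat C is diagonalisable; its eigenvalues
   kappa lie in [-c, 1], because the isomorphism X -> X_F decomposes \hat C into
   edge-disjoint cliques of size at least th. Double transitivity on the boundary
   gives d = (f1 - f2) / (f1 + c f2), where f1 = sum a_i / (1 - kappa_i z) and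
   f2 = sum b_i / (1 - kappa_i z) are the spectral transforms of the indicator of
   the boundary and of a difference of two boundary vertices. After a Moebius change
   of variable sending [-c, 1] to [-1, 1], d becomes G = (f + h) / (f - h) for two
   Stieltjes transforms f, h of probability measures on [-1, 1] with the same mean.

   Off [-1, 1] the map G strictly increases |nu - 1| + |nu + 1|, so that every orbit
   leaving [-1, 1] tends to infinity; hence the Julia set is the set E of points
   whose orbit stays in [-1, 1], normality failing on E since nearby non-real
   points escape. On each component of {f h < 0} the map G is monotone onto
   [-1, 1] and expands in the coordinate asin, so E is either [-1, 1] or a
   perfect set without interior. *)

Set Implicit Arguments.
Unset Strict Implicit.
Unset Printing Implicit Defensive.

Import Order.TTheory GRing.Theory Num.Theory.
Import numFieldNormedType.Exports.

Local Open Scope classical_set_scope.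
Local Open Scope ring_scope.
Local Open Scope complex_scope.

(** * The Riemann sphere *)

Section Modulus.
Context {R : realType}.
Implicit Types (a b : R[i]).

(** For [nu] off the segment and e a square root of nu^2 - 1, all points e / (nu - k) with -1 <= k
    <= 1 lie in one disc that avoids 0. By convexity so do e f and e h, and the angle under which
    the disc is seen from 0 yields a reverse triangle inequality between |f| + |h| and |f - h|,
    which is the growth of the confocal ellipse. The same c bounds the spectrum and occurs in the
    denominator of d, which is why one change of variable produces the symmetric quotient (f + h) /
    (f - h). On the real line the expansion is strict but has no uniform factor, so an interval of
    trapped points cannot be blown up by iteration; a longest one is taken, and its image would be
    longer unless it meets an endpoint of a branch. Equality of the means enters twice: it keeps the
    first measure from being a point mass at 1, whence strictness, and it lowers the degree of the
    numerator of f - h, whence a second preimage of 1 and the absence of isolated points. Both means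
    vanish before the change of variable because boundary vertices are not adjacent. *)

Lemma normcE_cabs a : `|a| = (cabs a)%:C.
Proof. by rewrite /cabs normc_def. Qed.

Lemma cabsE a : cabs a = Num.sqrt (complex.Re a ^+ 2 + complex.Im a ^+ 2).
Proof. by rewrite /cabs normc_def. Qed.

Lemma cabs_ge0 a : 0 <= cabs a.
Proof. by rewrite cabsE sqrtr_ge0. Qed.

Lemma sqr_cabs a : cabs a ^+ 2 = complex.Re a ^+ 2 + complex.Im a ^+ 2.
Proof. by rewrite cabsE sqr_sqrtr// addr_ge0// sqr_ge0. Qed.

Lemma cabs_eq0 a : (cabs a == 0) = (a == 0).
Proof. by rewrite -[RHS]normr_eq0 normcE_cabs fmorph_eq0. Qed.

Lemma cabs0 : cabs (0 : R[i]) = 0.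
Proof. by apply/eqP; rewrite cabs_eq0. Qed.

Lemma cabs_gt0 a : (0 < cabs a) = (a != 0).
Proof. by rewrite lt_neqAle cabs_ge0 andbT eq_sym cabs_eq0. Qed.

Lemma cabsM a b : cabs (a * b) = cabs a * cabs b.
Proof. by apply: (@complexI R); rewrite rmorphM /= -!normcE_cabs normrM. Qed.

Lemma cabsN a : cabs (- a) = cabs a.
Proof. by rewrite /cabs normrN. Qed.

Lemma cabsB a b : cabs (a - b) = cabs (b - a).
Proof. by rewrite -cabsN opprB. Qed.

Lemma cabsV a : cabs a^-1 = (cabs a)^-1.
Proof. by apply: (@complexI R); rewrite fmorphV /= -!normcE_cabs normfV. Qed.

Lemma cabsD a b : cabs (a + b) <= cabs a + cabs b.
Proof. by rewrite -lecR rmorphD /= -!normcE_cabs ler_normD. Qed.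

Lemma cabs_real (x : R) : cabs x%:C = `|x|.
Proof. by rewrite cabsE /= expr0n addr0 sqrtr_sqr. Qed.

Lemma Re_le_cabs a : complex.Re a <= cabs a.
Proof.
rewrite cabsE (le_trans (ler_norm _))// -sqrtr_sqr ler_wsqrtr// lerDl.
exact: sqr_ge0.
Qed.

Lemma normIm_le_cabs a : `|complex.Im a| <= cabs a.
Proof. by rewrite cabsE -sqrtr_sqr ler_wsqrtr// lerDr sqr_ge0. Qed.

Lemma normRe_le_cabs a : `|complex.Re a| <= cabs a.
Proof. by rewrite cabsE -sqrtr_sqr ler_wsqrtr// lerDl sqr_ge0. Qed.

(** Balls of [R[i]^o] have radii in [R[i]]; a positive one is real, which allows estimates with real
    radii throughout. *)
Lemma nbhs_complexP (a : R[i]^o) (A : set R[i]^o) :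
  nbhs a A <-> exists2 e : R, 0 < e & forall b, cabs (b - a) < e -> A b.
Proof.
split.
  move=> /nbhs_ballP[e /= e0 eA].
  have /complex_realP[r er] := gtr0_real e0.
  exists r; first by rewrite -ltcR -er.
  by move=> b br; apply: eA; rewrite -ball_normE /= distrC normcE_cabs er ltcR.
move=> [e e0 eA]; apply/nbhs_ballP; exists e%:C; first by rewrite /= ltcR.
by move=> b; rewrite -ball_normE /= distrC normcE_cabs ltcR; exact: eA.
Qed.

Lemma complex_cvgP T (F : set_system T) {FF : Filter F} (f : T -> R[i]^o)
    (l : R[i]^o) :
  (forall e : R, 0 < e -> \forall x \near F, cabs (f x - l) < e) -> f @ F --> l.
Proof.
move=> fl A /nbhs_complexP[e e0 eA].
by have := fl _ e0; apply: filterS => x /eA.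
Qed.

Lemma continuous_Re : continuous (fun a : R[i]^o => complex.Re a).
Proof.
move=> a; apply/(@cvgrPdist_lt _ _ _ (nbhs a)) => e e0.
apply/nbhs_complexP; exists e => // b.
by apply: le_lt_trans; rewrite cabsB -raddfB normRe_le_cabs.
Qed.

Lemma continuous_cabs : continuous (fun a : R[i]^o => cabs a).
Proof.
move=> a; apply/(@cvgrPdist_lt _ _ _ (nbhs a)) => e e0.
apply/nbhs_complexP; exists e => // b.
apply: le_lt_trans; rewrite ler_norml; apply/andP; split.
  rewrite lerBrDr addrC lerBlDr addrC.
  by rewrite -[in leLHS](subrK a b) addrC (le_trans (cabsD _ _))// addrC.
rewrite lerBlDr -[in leLHS](subrK b a) cabsB cabsB.
by rewrite (le_trans (cabsD _ _))// cabsB.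
Qed.

Lemma continuous_of_real : continuous (fun x : R => x%:C : R[i]^o).
Proof.
move=> x; apply: complex_cvgP => e e0.
have /cvgrPdist_lt/(_ _ e0) : (id : R -> R) y @[y --> x] --> x by exact: cvg_id.
by apply: filterS => y; rewrite distrC -rmorphB /= cabs_real.
Qed.

Lemma compact_disc (M : R) : compact [set a : R[i]^o | cabs a <= M].
Proof.
pose j (p : R * R) : R[i]^o := p.1 +i* p.2.
have cj : continuous j.
  move=> -[x y]; apply: complex_cvgP => e e0.
  have e2 : 0 < e / 2 by rewrite divr_gt0.
  exists ([set u | `|x - u| < e / 2], [set u | `|y - u| < e / 2]) => /=.
    by split; apply/nbhs_normP; exists (e / 2).
  move=> -[u v] /= [xu yv]; rewrite (@le_lt_trans _ _ (`|x - u| + `|y - v|))//.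
    rewrite -[leRHS]ger0_norm ?addr_ge0// -sqrtr_sqr cabsE ler_wsqrtr//=.
    rewrite [leRHS]sqrrD !real_normK ?num_real//.
    have := mulr_ge0 (normr_ge0 (x - u)) (normr_ge0 (y - v)).
    by move: (_ * _) => w w0; rewrite -mulr_natr; nra.
  by have := ltrD xu yv; rewrite -splitr.
have cimg : compact (j @` (`[- M, M] `*` `[- M, M])%classic).
  apply: continuous_compact; last first.
    by apply: compact_setX; exact: segment_compact.
  by apply: continuous_subspaceT => x; exact: cj.
apply: (subclosed_compact _ cimg).
  have -> : [set a : R[i]^o | cabs a <= M] = (@cabs R) @^-1` [set x | x <= M].
    by [].
  apply: closed_comp; last exact: closed_le.
  by move=> a _; exact: continuous_cabs.
move=> a /= aM; exists (complex.Re a, complex.Im a); last by case: a {aM}.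
by split; rewrite /= in_itv /= -ler_norml (le_trans _ aM)//
  ?normRe_le_cabs ?normIm_le_cabs.
Qed.

Lemma hausdorff_complex : hausdorff_space R[i]^o.
Proof. exact: norm_hausdorff. Qed.

Lemma closed_disc (M : R) : closed [set a : R[i]^o | cabs a <= M].
Proof. by apply: (compact_closed hausdorff_complex); exact: compact_disc. Qed.

End Modulus.

(** * Topology and homogeneous coordinates of the sphere *)

Section Sphere.
Context {R : realType}.
Local Notation sphere := (sphere R).
Implicit Types (a b : R[i]) (x y z : sphere).

Lemma nbhs_infty (A : set sphere) : nbhs (None : sphere) A <->
  A None /\ exists M : R, forall a, M < cabs a -> A (Some a).
Proof.
split.
  move=> [K [cK _] KA]; split; first by apply: KA; right.
  have cabsK : compact ((@cabs R) @` K).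
    apply: continuous_compact cK.
    by apply: continuous_subspaceT => x; exact: continuous_cabs.
  have [M [_ MK]] := compact_bounded cabsK.
  exists (M + 1) => a Ma; apply: KA; left; exists a => // Ka.
  have := MK (M + 1); rewrite ltrDl ltr01 => /(_ isT (cabs a)).
  move=> /(_ (ex_intro2 _ _ a Ka erefl)) /(le_trans (ler_norm _)).
  by rewrite leNgt Ma.
move=> [AN [M MA]]; exists [set a : R[i]^o | cabs a <= M].
  by split; [exact: compact_disc | exact: closed_disc].
move=> x [[a /= /negP]|-> //]; rewrite -ltNge => /MA Aa <- //.
Qed.

Lemma nbhs_finite a (A : set sphere) : nbhs (Some a : sphere) A <->
  exists2 e : R, 0 < e & forall b, cabs (b - a) < e -> A (Some b).
Proof. exact: (nbhs_complexP a (Some @^-1` A)). Qed.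

Lemma hausdorff_sphere : hausdorff_space sphere.
Proof.
have inf_fin a : exists A B : set sphere, [/\ nbhs (Some a : sphere) A,
    nbhs (None : sphere) B & forall x, A x -> B x -> False].
  exists [set x | if x is Some b then cabs (b - a) < 1 else False].
  exists [set x | if x is Some b then cabs a + 1 < cabs b else True].
  split; first by apply/nbhs_finite; exists 1.
    by apply/nbhs_infty; split => //; exists (cabs a + 1).
  case=> // b /= ba1; apply/negP; rewrite -leNgt.
  by rewrite -{1}(subrK a b) (le_trans (cabsD _ _))// addrC lerD2l ltW.
move=> [a|] [b|] // clab.
- congr Some; apply: hausdorff_complex => A B nA nB.
  have [c [Ac Bc]] := clab (Some @` A) (Some @` B)
     (one_point_compactification_some_nbhs _ _ nA)
     (one_point_compactification_some_nbhs _ _ nB).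
  move: Ac Bc => [a' Aa <-] [b' Bb [ab]]; exists a'; split => //.
  by rewrite -ab.
- have [A [B [nA nB AB]]] := inf_fin a.
  by have [x [/AB]] := clab _ _ nA nB.
- have [A [B [nA nB AB]]] := inf_fin b.
  by have [x [Bx /AB]] := clab _ _ nB nA; move=> /(_ Bx).
Qed.

Lemma compact_sphere : compact [set: sphere].
Proof. exact: one_point_compactification_compact. Qed.

Lemma closed_sphere_compact (A : set sphere) : closed A -> compact A.
Proof.
by move=> cA; apply: (subclosed_compact cA compact_sphere).
Qed.

(** The chart at infinity: statements about [None] are reduced to statements about 0 through this
    involution. *)
Definition sphere_inv (x : sphere) : sphere :=
  if x is Some a then if a == 0 then None else Some a^-1 else Some 0.

Lemma sphere_invK : involutive sphere_inv.
Proof.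
move=> [a|]; rewrite /sphere_inv ?eqxx//.
by have [->//|a0] := eqVneq a 0; rewrite invr_eq0 (negbTE a0) invrK.
Qed.

Lemma continuous_sphere_inv : continuous sphere_inv.
Proof.
move=> [a|] A; rewrite /sphere_inv.
  have [->|a0] := eqVneq a 0.
    move=> /nbhs_infty[AN [M MA]]; apply/nbhs_finite.
    exists (Num.max M 1)^-1; first by rewrite invr_gt0 lt_max ltr01 orbT.
    move=> b; rewrite subr0 => bM; rewrite /=.
    have [//|b0] := eqVneq b 0; apply: MA; rewrite cabsV.
    move: bM; rewrite -ltf_pV2 ?invrK ?posrE ?cabs_gt0//.
      by rewrite gt_max => /andP[].
    by rewrite invr_gt0 lt_max ltr01 orbT.
  move=> nA; have : \forall b \near (a : R[i]^o), A (Some b^-1).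
    have : (fun b : R[i]^o => b^-1 : R[i]^o) @ (a : R[i]^o) --> (a^-1 : R[i]^o).
      by apply: (@cvgV _ _ (nbhs (a : R[i]^o)) _ id).
    by move=> /(_ (Some @^-1` A)); apply.
  have : \forall b \near (a : R[i]^o), b != 0.
    apply/nbhs_complexP; exists (cabs a); first by rewrite cabs_gt0.
    by move=> b; apply: contraTneq => ->; rewrite sub0r cabsN ltxx.
  move=> n0 nA'; change (\forall b \near (a : R[i]^o),
     A (if b == 0 then None else Some b^-1)).
  by apply: filterS2 n0 nA' => b /negbTE ->.
move=> /nbhs_finite[e e0 eA]; apply/nbhs_infty; split.
  by apply: eA; rewrite subrr cabs0.
exists e^-1 => a ae; have a0 : a != 0.
  by rewrite -cabs_gt0 (lt_trans _ ae)// invr_gt0.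
rewrite /= (negbTE a0); apply: eA; rewrite subr0 cabsV.
by rewrite -(invrK e) ltf_pV2 ?posrE ?cabs_gt0 ?invr_gt0.
Qed.

(* The point with homogeneous coordinates [a : b]. *)
Definition hcoord a b : sphere := if b == 0 then None else Some (a / b).

Lemma hcoord_eq a b a' b' : (a, b) != (0, 0) -> (a', b') != (0, 0) ->
  a * b' = a' * b -> hcoord a b = hcoord a' b'.
Proof.
rewrite !xpair_eqE !negb_and /hcoord => ab ab' /eqP E.
have [b0|b0] := eqVneq b 0; have [b'0|b'0] := eqVneq b' 0 => //.
- by move: ab E; rewrite b0 eqxx orbF mulr0 mulf_eq0 (negbTE b'0) => /negbTE ->.
- by move: ab' E; rewrite b'0 eqxx orbF mulr0 [0 == _]eq_sym mulf_eq0 (negbTE b0)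
    => /negbTE ->.
by congr Some; apply/eqP; rewrite eqr_div.
Qed.

Lemma hcoordM c a b : c != 0 -> hcoord (c * a) (c * b) = hcoord a b.
Proof.
move=> c0; rewrite /hcoord mulf_eq0 (negbTE c0) /=.
by case: eqP => // /eqP b0; rewrite -mulf_div divff// mul1r.
Qed.

Lemma sphere_inv_hcoord a b : (a, b) != (0, 0) ->
  sphere_inv (hcoord a b) = hcoord b a.
Proof.
rewrite xpair_eqE negb_and /sphere_inv /hcoord.
have [->|b0] := eqVneq b 0; first by rewrite orbF => /negbTE ->; rewrite mul0r.
by rewrite mulf_eq0 invr_eq0 (negbTE b0) orbF invf_div.
Qed.

(** If the limit of the denominators vanishes, that of the numerators does not, and inversion
    exchanges the two coordinates. *)
Lemma cvg_hcoord T (F : set_system T) {FF : Filter F} (P Q : T -> R[i]^o)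
    (p q : R[i]^o) : (p, q) != (0, 0) -> P @ F --> p -> Q @ F --> q ->
  (fun t => hcoord (P t) (Q t)) @ F --> hcoord p q.
Proof.
have finite_case P' Q' (p' q' : R[i]^o) : q' != 0 -> P' @ F --> p' ->
    Q' @ F --> q' -> (fun t => hcoord (P' t) (Q' t)) @ F --> hcoord p' q'.
  move=> q0 cP cQ A; rewrite {1}/hcoord (negbTE q0) => nA.
  have : (fun t => P' t / Q' t : R[i]^o) @ F --> (p' / q' : R[i]^o).
    exact: (@cvgM _ _ F _ P' (fun t => (Q' t)^-1) _ _ cP (@cvgV _ _ F _ Q' _ q0 cQ)).
  move=> /(_ (Some @^-1` A) nA) nPQ.
  have nQ : \forall t \near F, Q' t != 0.
    apply: (cQ [set b | b != 0]); apply/nbhs_complexP; exists (cabs q'); first by rewrite cabs_gt0.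
    by move=> b; apply: contraTneq => ->; rewrite sub0r cabsN ltxx.
  change (\forall t \near F, A (hcoord (P' t) (Q' t))).
  by apply: filterS2 nQ nPQ => t /negbTE Qt; rewrite /hcoord Qt.
move=> pq cP cQ; have [q0|q0] := eqVneq (q : R[i]) 0.
  2: exact: (finite_case P Q p q q0 cP cQ).
have p0 : p != 0 by move: pq; rewrite q0 xpair_eqE eqxx andbT.
have cQP := finite_case Q P q p p0 cQ cP.
rewrite -(sphere_inv_hcoord (a := q)); last by rewrite xpair_eqE negb_and p0 orbT.
have nP : \forall t \near F, P t != 0.
  apply: (cP [set b | b != 0]); apply/nbhs_complexP.
  exists (cabs p); first by rewrite cabs_gt0.
  by move=> b; apply: contraTneq => ->; rewrite sub0r cabsN ltxx.
move=> A nA; have := continuous_sphere_inv nA => /cQP nA'.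
change (\forall t \near F, A (hcoord (P t) (Q t))).
apply: filterS2 nP nA' => t Pt /=; rewrite sphere_inv_hcoord//.
by rewrite xpair_eqE negb_and Pt orbT.
Qed.

End Sphere.

(** * Rational maps of the sphere *)

Section RationalMaps.
Context {R : realType}.
Local Notation sphere := (sphere R).
Implicit Types (p q P Q A B : {poly R[i]}) (a : R[i]).

Definition ratmap p q (z : sphere) : sphere :=
  match z with
  | Some a => hcoord p.[a] q.[a]
  | None => if (size q < size p)%N then None
            else Some (p`_(size q).-1 / lead_coef q)
  end.

Lemma ratfun_evalE (d : {fraction {poly R[i]}}) : exists p q,
  [/\ coprimep p q, q != 0, d = tofrac p / tofrac q
    & ratfun_eval d = ratmap p q].
Proof.
set r := repr d; set n := (fraction.frac r).1; set m := (fraction.frac r).2.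
have m0 : m != 0 by exact: denom_ratioP.
have g0 : gcdp n m != 0 by rewrite gcdp_eq0 negb_and m0 orbT.
exists (n %/ gcdp n m), (m %/ gcdp n m); split.
- by rewrite coprimep_div_gcd// m0 orbT.
- by rewrite dvdp_div_eq0 ?dvdp_gcdr.
- have dE : d * tofrac m = tofrac n.
    rewrite -(reprK d) -/r; unlock FracField.tofrac.
    rewrite -[_ * _]/(FracField.mul _ _) !piE.
    apply/eqmodP; rewrite /= FracField.equivfE /= /FracField.mulf.
    by rewrite !numden_Ratio ?mulf_neq0 ?oner_eq0 //= ?mulr1 ?mul1r // mulrC.
  have tm0 : tofrac (m %/ gcdp n m) != 0 :> {fraction {poly R[i]}}.
    by rewrite tofrac_eq0 dvdp_div_eq0 ?dvdp_gcdr.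
  apply: (mulIf tm0); rewrite divfK//.
  have tg0 : tofrac (gcdp n m) != 0 :> {fraction {poly R[i]}}.
    by rewrite tofrac_eq0.
  apply: (mulIf tg0); rewrite -mulrA -!tofracM !divpK ?dvdp_gcdl ?dvdp_gcdr//.
by apply: funext => -[a|].
Qed.

Lemma continuous_chorner p : continuous (fun a : R[i]^o => p.[a] : R[i]^o).
Proof.
elim/poly_ind: p => [|p c IH] a.
  move=> U /nbhs_singleton U0; apply/nbhs_complexP; exists 1 => // b _.
  by move: U0; rewrite /= !horner0.
under eq_fun do rewrite hornerMXaddC.
apply: (@cvgD _ _ _ (nbhs a) _ (fun b : R[i]^o => p.[b] * b : R[i]^o)
  (fun=> c : R[i]^o)); last first.
  by move=> U /nbhs_singleton U0; apply/nbhs_complexP; exists 1.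
exact: (@cvgM _ _ (nbhs a) _ (fun b : R[i]^o => p.[b]) id _ _ (IH a) (fun _ => id)).
Qed.

Lemma coprimep_hcoord p q a : coprimep p q -> (p.[a], q.[a]) != (0, 0).
Proof.
move=> pq; rewrite xpair_eqE negb_and.
by have [/eqP p0|//] := eqVneq p.[a] 0; rewrite (coprimep_root pq).
Qed.

(** The reciprocal polynomial a^n p(1/a) for a formal degree [n], that is, [p] homogenised and read
    in the chart at infinity. *)
Definition rev_poly n p : {poly R[i]} := \poly_(i < n.+1) p`_(n - i).

Lemma horner_rev_poly n p a : (size p <= n.+1)%N -> a != 0 ->
  (rev_poly n p).[a] = a ^+ n * p.[a^-1].
Proof.
move=> pn a0; rewrite horner_poly (horner_coef_wide _ pn) mulr_sumr.
rewrite (reindex_inj rev_ord_inj) /=; apply: eq_bigr => i _.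
rewrite subSS subKn; last by rewrite -ltnS.
rewrite mulrCA; congr (_ * _).
by rewrite exprVn -exprB ?unitfE// -ltnS.
Qed.

Lemma ratmap_inv p q : q != 0 -> let n := (maxn (size p) (size q)).-1 in
  forall a, ratmap p q (sphere_inv (Some a)) =
    hcoord (rev_poly n p).[a] (rev_poly n q).[a].
Proof.
move=> q0 n a.
have n1 : n.+1 = maxn (size p) (size q).
  by rewrite /n prednK// leq_max [X in _ || X]lt0n size_poly_eq0 q0 orbT.
have pn : (size p <= n.+1)%N by rewrite n1 leq_maxl.
have qn : (size q <= n.+1)%N by rewrite n1 leq_maxr.
rewrite /sphere_inv; have [->|a0] := eqVneq a 0; last first.
  by rewrite !horner_rev_poly//= hcoordM// expf_neq0.
rewrite /= !horner_coef0 !coef_poly/= !subn0 /hcoord.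
have [qp|pq] := ltnP.
  by rewrite nth_default ?eqxx// -ltnS n1 (maxn_idPl _)// ltnW.
have nE : n = (size q).-1 by rewrite /n (maxn_idPr _).
by rewrite nE -/(lead_coef q) lead_coef_eq0 (negbTE q0).
Qed.

Lemma continuous_ratmap p q : coprimep p q -> q != 0 -> continuous (ratmap p q).
Proof.
move=> pq q0 [a|].
  have := cvg_hcoord (coprimep_hcoord a pq)
    (@continuous_chorner p a) (@continuous_chorner q a).
  by move=> ca A /ca.
set n := (maxn (size p) (size q)).-1.
have n1 : n.+1 = maxn (size p) (size q).
  by rewrite /n prednK// leq_max [X in _ || X]lt0n size_poly_eq0 q0 orbT.
(* At 0 the reversed polynomials take the coefficients of degree [n] of [p] and [q], and one of
   these is a leading coefficient. *)
have rev0 : ((rev_poly n p).[0], (rev_poly n q).[0]) != (0, 0).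
  rewrite !horner_coef0 !coef_poly/= !subn0 xpair_eqE negb_and.
  have [pq'|qp] := leqP (size p) (size q).
    have -> : n = (size q).-1 by rewrite /n (maxn_idPr _).
    by rewrite -/(lead_coef q) lead_coef_eq0 q0 orbT.
  have -> : n = (size p).-1 by rewrite /n (maxn_idPl _)// ltnW.
  rewrite -/(lead_coef p) lead_coef_eq0 -size_poly_eq0 -lt0n.
  by rewrite (leq_ltn_trans _ qp).
have c0 : {for (Some 0 : sphere), continuous (ratmap p q \o sphere_inv)}.
  have := cvg_hcoord rev0 (@continuous_chorner (rev_poly n p) 0)
    (@continuous_chorner (rev_poly n q) 0).
  move=> ca A; rewrite [X in nbhs X](ratmap_inv p q0) => /ca nA.
  change (nbhs (0 : R[i]^o)
    [set a | A (ratmap p q (sphere_inv (Some a)))]).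
  apply: (@filterS _ (nbhs (0 : R[i]^o)) _ _ _ _ nA) => a.
  by rewrite /mkset (ratmap_inv p q0).
move=> A nA; have cA := continuous_comp (@continuous_sphere_inv R None) c0.
have /cA : nbhs ((ratmap p q \o sphere_inv) (sphere_inv None)) A.
  by rewrite /comp sphere_invK.
apply: (@filterS _ (nbhs (None : sphere))) => z.
by rewrite /preimage /comp /mkset sphere_invK.
Qed.

Lemma continuous_ratfun_eval (d : {fraction {poly R[i]}}) :
  continuous (ratfun_eval d).
Proof.
by have [p [q [pq q0 _ ->]]] := ratfun_evalE d; exact: continuous_ratmap.
Qed.

Lemma ratfun_eval_hcoord (d : {fraction {poly R[i]}}) P Q a :
  Q != 0 -> d = tofrac P / tofrac Q -> (P.[a], Q.[a]) != (0, 0) ->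
  ratfun_eval d (Some a) = hcoord P.[a] Q.[a].
Proof.
move=> Q0; have [p [q [pq q0 -> ->]]] := ratfun_evalE d => /eqP.
rewrite eqr_div ?tofrac_eq0// -!tofracM tofrac_eq => /eqP E PQ.
apply: hcoord_eq => //; first exact: coprimep_hcoord.
by rewrite -!hornerM E.
Qed.

(* By continuity, a generic description of a map as [A : B] determines it
   everywhere; where A and B have a common simple zero the derivatives give the
   value. *)
Lemma hcoord_generic (f : sphere -> sphere) A B (s : seq R[i]) :
  continuous f -> (A, B) != (0, 0) ->
  (forall a, a \notin s -> (A.[a], B.[a]) != (0, 0) ->
     f (Some a) = hcoord A.[a] B.[a]) ->
  (forall a, (A.[a], B.[a]) != (0, 0) -> f (Some a) = hcoord A.[a] B.[a]) /\
  (forall a, A.[a] = 0 -> B.[a] = 0 -> (A^`().[a], B^`().[a]) != (0, 0) ->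
     f (Some a) = hcoord A^`().[a] B^`().[a]).
Proof.
move=> cf AB0 fE; set g := gcdp A B.
have AB0' : (A != 0) || (B != 0) by rewrite -negb_and -xpair_eqE.
have g0 : g != 0 by rewrite gcdp_eq0 negb_and.
pose A1 := A %/ g; pose B1 := B %/ g.
have AE : A = A1 * g by rewrite divpK ?dvdp_gcdl.
have BE : B = B1 * g by rewrite divpK ?dvdp_gcdr.
have cop : coprimep A1 B1 by rewrite coprimep_div_gcd.
have E : A * B1 = A1 * B by rewrite AE BE; ring.
have fE1 a : f (Some a) = hcoord A1.[a] B1.[a].
  have cl := @continuous_chorner.
  have h1 := cvg_hcoord (coprimep_hcoord a cop) (@cl A1 a) (@cl B1 a).
  have h2 : (fun b : R[i]^o => f (Some b)) @ (a : R[i]^o) --> f (Some a).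
    by move=> U /cf.
  (* Off finitely many points the generic description and the reduced one agree, so both sides have
     the same limit along the punctured neighbourhoods of [a]. *)
  have nz : \forall b \near (a : R[i]^o)^', b \notin s /\ ~~ root g b.
    have [rs grs] : exists rs : seq R[i], forall b, root g b -> b \in rs.
      have [rs grs] := closed_field_poly_normal g.
      exists rs => b; rewrite grs rootZ ?lead_coef_eq0//.
      by rewrite root_prod_XsubC.
    have ns (s' : seq R[i]) : \forall b \near (a : R[i]^o)^', b \notin s'.
      elim: s' => [|c s' IH]; first by apply: (@filterE _ (a : R[i]^o)^').
      have nc : \forall b \near (a : R[i]^o)^', b != c.
        have [->|ac] := eqVneq c a; first exact: nbhs_dnbhs_neq.
        apply: nbhs_dnbhs; apply/nbhs_complexP; exists (cabs (c - a)).
          by rewrite cabs_gt0 subr_eq0.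
        by move=> b; apply: contraTneq => ->; rewrite ltxx.
      apply: (@filterS2 _ (a : R[i]^o)^' _ _ _ _ _ nc IH) => b bc bs; by rewrite inE negb_or bc.
    apply: (@filterS2 _ (a : R[i]^o)^' _ _ _ _ _ (ns s) (ns rs)) => b bs brs; split => //.
    by apply: contra brs; exact: grs.
  have h1' : (fun b : R[i]^o => f (Some b)) @ (a : R[i]^o)^' -->
             hcoord A1.[a] B1.[a].
    move=> U /h1 nU; have {nU} := nbhs_dnbhs nU; apply: (@filterS2 _ (a : R[i]^o)^' _ _ _ _ _ nz).
    move=> b [bs]; rewrite rootE => gb; rewrite /= fE//.
      by rewrite AE BE !hornerM ![_ * g.[b]]mulrC hcoordM.
    rewrite AE BE !hornerM xpair_eqE !mulf_eq0 (negbTE gb) !orbF.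
    by rewrite -xpair_eqE coprimep_hcoord.
  have h2' : (fun b : R[i]^o => f (Some b)) @ (a : R[i]^o)^' --> f (Some a).
    by move=> U /h2 nU; exact: nbhs_dnbhs nU.
  exact: (cvg_unique (@hausdorff_sphere R) h2' h1').
split=> a.
  move=> AB; rewrite fE1; apply: hcoord_eq => //; first exact: coprimep_hcoord.
  by rewrite -!hornerM E.
move=> Aa Ba dAB; rewrite fE1; apply: hcoord_eq => //.
  exact: coprimep_hcoord.
(* Differentiating [A * B1 = A1 * B] at a common zero leaves A' B1 = A1 B', so the derivatives are
   coordinates of the same point. *)
have := congr1 (fun p => p^`().[a]) E.
by rewrite !derivM !hornerD !hornerM Aa Ba !mul0r !mulr0 addr0 add0r.
Qed.

End RationalMaps.

(** * Expanding dynamics on an interval *)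

Section IntervalDynamics.
Context {R : realType}.
Variables (phi g : R -> R) (E1 : set R).

Hypothesis phi_lt : forall x y, -1 <= x -> x < y -> y <= 1 -> phi x < phi y.
Hypothesis phi_cont : {within `[-1, 1], continuous phi}.
Hypothesis E1_itv : forall x, E1 x -> -1 <= x <= 1 /\ -1 <= g x <= 1.

(* phi serves as the coordinate in which g expands distances. *)
Definition branch (a b : R) : Prop :=
  [/\ -1 <= a /\ b <= 1, a < b,
      {within `[a, b], continuous g} /\ (forall x, a <= x <= b -> E1 x),
      (g a = -1 /\ g b = 1) \/ (g a = 1 /\ g b = -1) &
      forall x y, a <= x -> x < y -> y <= b ->
        phi y - phi x < `|phi (g y) - phi (g x)|].

Hypothesis branchP : forall x, E1 x -> exists a b, branch a b /\ a <= x <= b.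

Definition survivors : set R := [set x | forall n, E1 (iter n g x)].

Hypothesis survivors_closed : closed survivors.
Hypothesis g1 : g 1 = 1.
Hypothesis survivors1 : survivors 1.

Let S := survivors.

Let leN11 : -1 <= 1 :> R. Proof. by lra. Qed.

Let neN11 : 1 <> -1 :> R. Proof. by lra. Qed.

Let phi_le x y : -1 <= x -> x <= y -> y <= 1 -> phi x <= phi y.
Proof.
by move=> x1; rewrite le_eqVlt => /orP[/eqP->//|xy y1]; exact/ltW/phi_lt.
Qed.

Lemma survivorsP x : S x -> S (g x).
Proof. by move=> Sx n; rewrite -iterSr; exact: Sx. Qed.

Lemma survivors_pre x : E1 x -> S (g x) -> S x.
Proof. by move=> Ex Sgx [|n]//; rewrite iterSr. Qed.

Let survivors_itv x : S x -> -1 <= x <= 1.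
Proof. by move=> /(_ 0%N) /E1_itv[]. Qed.

Lemma within_subitv (f : R -> R) a b x y : a <= x -> y <= b ->
  {within `[a, b], continuous f} -> {within `[x, y], continuous f}.
Proof.
move=> ax yb; apply: continuous_subspaceW => t /=.
by rewrite !in_itv /= => /andP[xt ty]; rewrite (le_trans ax xt) (le_trans ty yb).
Qed.

Lemma branch_onto a b x y t : branch a b -> a <= x -> x <= y -> y <= b ->
  Num.min (g x) (g y) <= t <= Num.max (g x) (g y) ->
  exists2 s, x <= s <= y & g s = t.
Proof.
move=> [_ _ [cg _] _ _] ax xy yb txy.
have [s] := IVT xy (within_subitv ax yb cg) txy.
by rewrite in_itv /=; exists s.
Qed.

(** Expansion excludes two points with the same image, and a continuous injection of a segment is
    monotone. *)
Lemma branch_mono a b : branch a b ->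
  (g a = -1 /\ {in `[a, b] &, {mono g : x y / x <= y}}) \/
  (g a = 1 /\ {in `[a, b] &, {mono g : x y /~ x <= y}}).
Proof.
move=> [[a1 b1] ab [cg E1ab] gab ex].
have ginj : {in `[a, b] &, injective g}.
  move=> x y; rewrite !in_itv /= => /andP[ax xb] /andP[ay yb] gxy.
  apply/eqP; apply: contraT; rewrite neq_lt => /orP[] xy.
    have := ex x y ax xy yb; rewrite gxy subrr normr0 subr_lt0.
    by rewrite ltNge ltW// phi_lt// ?(le_trans _ ax)// ?(le_trans a1)// (le_trans yb).
  have := ex y x ay xy xb; rewrite gxy subrr normr0 subr_lt0.
  by rewrite ltNge ltW// phi_lt// ?(le_trans a1)// (le_trans xb).
case: gab => -[ga gb].
  left; split => //; apply: segment_continuous_inj_le => //.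
  by rewrite ga gb leN11.
by right; split => //; apply: segment_continuous_inj_ge => //; rewrite ga gb leN11.
Qed.

Let seg (a b : R) := forall x, a <= x <= b -> S x.

Lemma seg_image a b x y : branch a b -> a <= x -> x <= y -> y <= b ->
  seg x y -> seg (Num.min (g x) (g y)) (Num.max (g x) (g y)).
Proof.
move=> br ax xy yb Sxy t txy.
by have [s sxy <-] := branch_onto br ax xy yb txy; apply/survivorsP/Sxy.
Qed.

(** Closedness is what lets a longest surviving segment exist. A non-survivor between the limit
    endpoints has a neighbourhood free of survivors, which nearby segments would have to meet. *)
Lemma closed_segs : closed [set p : R * R | p.1 <= p.2 /\ seg p.1 p.2].
Proof.
move=> [a b] /= clab.
have near_ab e : 0 < e -> exists a' b', [/\ `|a - a'| < e, `|b - b'| < e,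
    a' <= b' & seg a' b'].
  move=> e0; have [|[a' b'] [[ab' sab'] [/= aa bb]]] :=
      clab [set p : R * R | `|a - p.1| < e /\ `|b - p.2| < e].
    exists ([set u | `|a - u| < e], [set u | `|b - u| < e]) => /=.
      by split; apply/nbhs_normP; exists e.
    by move=> [u v].
  by exists a', b'.
split.
  rewrite leNgt; apply/negP => ba.
  have [|a' [b' [aa bb ab' _]]] := near_ab ((a - b) / 2).
    by rewrite divr_gt0// subr_gt0.
  move: aa bb; rewrite !ltr_norml => /andP[_ aa] /andP[bb _]; lra.
move=> x /= /andP[ax xb]; apply: contrapT => Sx.
have : open (~` S) by exact: closed_openC.
rewrite openE => /(_ x Sx) /nbhs_normP[e /= e0 eS].
have [a' [b' [aa bb ab' sab']]] := near_ab e e0.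
move: aa bb; rewrite !ltr_norml => /andP[aa1 aa2] /andP[bb1 bb2].
have [xa|ax'] := ltP x a'.
  apply: (eS a'); last by apply: sab'; rewrite lexx.
  by rewrite /ball_/= ltr_norml; apply/andP; split; lra.
have [bx|xb'] := ltP b' x.
  apply: (eS b'); last by apply: sab'; rewrite lexx ab'.
  by rewrite /ball_/= ltr_norml; apply/andP; split; lra.
by apply: Sx; apply: sab'; rewrite ax' xb'.
Qed.

(** A segment of maximal length in the coordinate [phi] replaces iteration, since the expansion has
    no uniform factor. The closed condition [P] serves to pin one endpoint. *)
Lemma max_seg (P : set (R * R)) a b : closed P -> P (a, b) -> a < b -> seg a b ->
  exists a' b', [/\ P (a', b'), a' < b', seg a' b' &
    forall x y, P (x, y) -> x <= y -> seg x y -> phi y - phi x <= phi b' - phi a'].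
Proof.
move=> cP Pab ab sab.
pose K := [set p : R * R | p.1 <= p.2 /\ seg p.1 p.2] `&` P.
have KI : K `<=` (`[-1, 1] `*` `[-1, 1])%classic.
  move=> [x y] [[/= xy sxy] _]; split; rewrite /= in_itv /=.
    by apply/survivors_itv/sxy; rewrite lexx.
  by apply/survivors_itv/sxy; rewrite lexx xy.
have cK : compact K.
  apply: subclosed_compact KI; first exact: closedI closed_segs cP.
  by apply: compact_setX; exact: segment_compact.
have cphi : {within K, continuous (fun p : R * R => phi p.2 - phi p.1)}.
  apply: (continuous_subspaceW KI).
  apply/subspace_continuousP => -[x y] [/= xI yI].
  have /subspace_continuousP cph := phi_cont.
  apply: (@cvgB _ R^o); move: (cph _ xI) (cph _ yI) => cx cy A.
    move=> /cy [e /= e0 eA]; exists (setT, [set u | ball y e u]) => /=.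
      by split; [exact: filterT | apply/nbhs_ballP; exists e].
    by move=> [u v] /= [_ yv] [_ vI]; exact: eA.
  move=> /cx [e /= e0 eA]; exists ([set u | ball x e u], setT) => /=.
    by split; [apply/nbhs_ballP; exists e | exact: filterT].
  by move=> [u v] /= [xu _] [uI _]; exact: eA.
have K0 : K !=set0 by exists (a, b); split => //; split => //; exact: ltW.
have [[a' b'] /set_mem[[/= ab' sab'] Pab'] mx] := compact_EVT_max K0 cK cphi.
have mx' x y : P (x, y) -> x <= y -> seg x y ->
    phi y - phi x <= phi b' - phi a'.
  by move=> Pxy xy sxy; apply: (mx (x, y)); apply/mem_set; split.
exists a', b'; split => //.
rewrite lt_neqAle ab' andbT; apply/eqP => aE.
have := mx' a b Pab (ltW ab) sab; rewrite aE subrr subr_le0 leNgt phi_lt//.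
  by have /survivors_itv/andP[] : S a by apply: sab; rewrite lexx ltW.
by have /survivors_itv/andP[] : S b by apply: sab; rewrite lexx ltW.
Qed.

Let seg_sub a b x y : a <= x -> y <= b -> seg a b -> seg x y.
Proof.
by move=> ax yb sab t /andP[xt ty]; apply: sab; rewrite (le_trans ax xt) (le_trans ty).
Qed.

(** As 1 is fixed, the image of a segment ending at 1 ends at 1 as well. A longest such segment must
    therefore contain the whole branch at 1, whose image is [-1, 1]; otherwise its image would be
    longer. *)
Lemma seg_right t : t < 1 -> seg t 1 -> seg (-1) 1.
Proof.
move=> t1 st1.
have [|a [b [/= -> a1 sa1 mx]]] := @max_seg [set p | p.2 = 1] t 1 _ erefl t1 st1.
  have -> : [set p : R * R | p.2 = 1] = snd @^-1` [set 1] by [].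
  by apply: closed_comp => [p _|]; [exact: cvg_snd | exact: closed_eq].
have S1 : S 1 by apply: sa1; rewrite lexx ltW.
have [p [q [br /andP[p1 q1]]]] := branchP (S1 0%N).
have [[pm qM] pq _ gpq ex] := br.
have qE : q = 1 by apply/eqP; rewrite eq_le qM q1.
move: br gpq ex q1 pq; rewrite qE g1 => br gpq ex _ pq.
have gp : g p = -1 by case: gpq => -[] // _ /neN11.
have [ap|pa] := leP a p.
  have := seg_image br (lexx _) (ltW pq) (lexx _) (seg_sub ap (lexx _) sa1).
  by rewrite gp g1 (min_idPl _) ?(max_idPr _) ?leN11.
have /andP[Nga ga1] : -1 <= g a <= 1.
  by have /E1_itv[] : E1 a by apply: (sa1 _ _ 0%N); rewrite lexx ltW.
have := seg_image br (ltW pa) (ltW a1) (lexx _) sa1.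
rewrite g1 (min_idPl _)// (max_idPr _)// => /(mx _ _ erefl ga1).
have := ex a 1 (ltW pa) a1 (lexx _).
by rewrite g1 ger0_norm ?subr_ge0 ?phi_le// => /lt_le_trans/[apply]; rewrite ltxx.
Qed.

(** If -1 is fixed, the argument is the same as at 1; if -1 is mapped to 1, the image of the segment
    ends at 1 and [seg_right] applies. *)
Lemma seg_left t : -1 < t -> seg (-1) t -> seg (-1) 1.
Proof.
move=> t1 st1.
have [|a [b [/= -> b1 sb1 mx]]] := @max_seg [set p | p.1 = -1] (-1) t _ erefl t1 st1.
  have -> : [set p : R * R | p.1 = -1] = fst @^-1` [set -1] by [].
  by apply: closed_comp => [p _|]; [exact: cvg_fst | exact: closed_eq].
have S1 : S (-1) by apply: sb1; rewrite lexx ltW.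
have [p [q [br /andP[p1 q1]]]] := branchP (S1 0%N).
have [[pm qM] pq _ gpq ex] := br.
have pE : p = -1 by apply/eqP; rewrite eq_le pm p1.
move: br gpq ex p1 pq; rewrite pE => br gpq ex _ pq.
have [qb|bq] := leP q b.
  have := seg_image br (lexx _) (ltW pq) (lexx _) (seg_sub (lexx _) qb sb1).
  by case: gpq => -[-> ->];
    rewrite ?(min_idPl leN11) ?(max_idPr leN11) ?(min_idPr leN11) ?(max_idPl leN11).
have /andP[Ngb gb1] : -1 <= g b <= 1.
  by have /E1_itv[] : E1 b by apply: (sb1 _ _ 0%N); rewrite lexx ltW.
have := seg_image br (lexx _) (ltW b1) (ltW bq) sb1.
have := ex (-1) b (lexx _) b1 (ltW bq).
case: gpq => -[-> _].
  rewrite (min_idPl Ngb) (max_idPr Ngb) ger0_norm ?subr_ge0 ?phi_le//.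
  by move=> /lt_le_trans lt /(mx _ _ erefl Ngb)/lt; rewrite ltxx.
rewrite (min_idPr gb1) (max_idPl gb1) => lt; apply: seg_right.
rewrite lt_neqAle gb1 andbT; apply/eqP => gbE; move: lt.
rewrite gbE subrr normr0 subr_lt0 ltNge phi_le ?(ltW b1)//.
by have /survivors_itv/andP[] : S b by apply: sb1; rewrite lexx ltW.
Qed.

(** A longest segment cannot lie in one branch, as its image would be longer. Hence it contains an
    endpoint of a branch, whose image is 1 or -1, and the image segment falls under [seg_right] or
    [seg_left]. *)
Lemma survivors_seg a b : a < b -> (forall x, a <= x <= b -> S x) ->
  forall x, -1 <= x <= 1 -> S x.
Proof.
move=> ab sab; change (seg (-1) 1).
have [|a' [b' [_ ab' sab' mx]]] := @max_seg setT a b _ I ab sab.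
  exact: closedT.
have endpoint x y : (g x = 1 \/ g x = -1) \/ (g y = 1 \/ g y = -1) ->
    phi y - phi x < `|phi (g y) - phi (g x)| -> -1 <= x -> x < y -> y <= 1 ->
    -1 <= g x <= 1 -> -1 <= g y <= 1 ->
    seg (Num.min (g x) (g y)) (Num.max (g x) (g y)) -> seg (-1) 1.
  move=> gxy lt x1 xy y1 /andP[gx1 gx2] /andP[gy1 gy2].
  have gne : g x != g y.
    apply/eqP => gE; move: lt; rewrite gE subrr normr0 subr_lt0.
    by rewrite ltNge phi_le// ltW.
  case: gxy => -[] gE; move: gne gx1 gx2 gy1 gy2; rewrite gE => gne gx1 gx2 gy1 gy2.
  - rewrite (min_idPr gy2) (max_idPl gy2); apply: seg_right.
    by rewrite lt_neqAle gy2 eq_sym gne.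
  - rewrite (min_idPl gy1) (max_idPr gy1); apply: seg_left.
    by rewrite lt_neqAle gy1 gne.
  - rewrite (min_idPl gx2) (max_idPr gx2); apply: seg_right.
    by rewrite lt_neqAle gx2 gne.
  - rewrite (min_idPr gx1) (max_idPl gx1); apply: seg_left.
    by rewrite lt_neqAle gx1 eq_sym gne.
have itv x : a' <= x <= b' -> -1 <= x <= 1 /\ -1 <= g x <= 1.
  by move=> xab; apply: E1_itv; exact: (sab' _ xab 0%N).
have a'I := itv a'; rewrite lexx ltW// in a'I.
have b'I := itv b'; rewrite lexx ltW// in b'I.
have [/andP[Na _] ga'] := a'I isT; have [/andP[_ b'1] gb'] := b'I isT.
(* An interior point guarantees that the branch through it meets the segment in more than one
   point. *)
pose c := (a' + b') / 2; have ac : a' < c by rewrite /c; lra.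
have cb : c < b' by rewrite /c; lra.
have Sc : S c by apply: sab'; rewrite !ltW.
have [p [q [br /andP[pc cq]]]] := branchP (Sc 0%N).
have [[p1 q1] pq _ gpq ex] := br.
have gp : g p = 1 \/ g p = -1 by case: gpq => -[-> _]; [right|left].
have gq : g q = 1 \/ g q = -1 by case: gpq => -[_ ->]; [left|right].
have [pa|ap] := leP p a'.
  have [bq|qb] := leP b' q.
    have := seg_image br pa (ltW ab') bq sab'.
    have := ex a' b' pa ab' bq; have [gab|gba] := leP (g a') (g b').
      rewrite ger0_norm; first by move=> /lt_le_trans lt /(mx _ _ I gab)/lt; rewrite ltxx.
      by case/andP: ga' gb' => ? _ /andP[_ ?]; rewrite subr_ge0 phi_le.
    rewrite ler0_norm; first by rewrite opprB => /lt_le_trans lt /(mx _ _ I (ltW gba))/lt; rewrite ltxx.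
    by case/andP: ga' gb' => _ ? /andP[? _]; rewrite subr_le0 phi_le// ltW.
  have aq : a' < q by exact: lt_le_trans cq.
  apply: (endpoint a' q) => //; [by right|exact: ex| | ].
    by apply: (itv q _).2; rewrite !ltW.
  by apply: (seg_image br) => //; [exact: ltW|apply: seg_sub sab' => //; exact: ltW].
pose q' := Num.min q b'.
have pq' : p < q' by rewrite /q' lt_min pq (le_lt_trans pc cb).
have q'q : q' <= q by rewrite /q' ge_min lexx.
have q'b : q' <= b' by rewrite /q' ge_min lexx orbT.
apply: (endpoint p q') => //; [by left|exact: ex|exact: le_trans q'q q1| | |].
- by apply: (itv p _).2; rewrite ltW//= (le_trans (ltW pq')).
- by apply: (itv q' _).2; rewrite q'b andbT (le_trans (ltW ap))// ltW.
by apply: (seg_image br) => //; [exact: ltW|apply: seg_sub sab' => //; exact: ltW].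
Qed.

Let level k : set R := [set x | forall n, (n < k)%N -> E1 (iter n g x)].

(** By induction: the cylinder around [g x] is pulled back through the branch at [x], which covers
    [-1, 1] and is monotone, so the preimage is again an interval. *)
Lemma cylinder k x : -1 <= x <= 1 -> level k x -> exists a b,
  [/\ a <= x <= b, -1 <= a /\ b <= 1, (forall y, a <= y <= b -> level k y) &
      forall y, -1 <= y <= 1 -> exists2 s, a <= s <= b & iter k g s = y].
Proof.
elim: k x => [|k IH] x xI lx.
  by exists (-1), 1; split => // y yI; exists y.
have E1x : E1 x by exact: (lx 0%N).
have [_ gxI] := E1_itv E1x.
have lgx : level k (g x) by move=> n nk; rewrite -iterSr; exact: lx.
have [a' [b' [/andP[agx gxb] [a'1 b'1] lab onto]]] := IH _ gxI lgx.
have [p [q [br /andP[px xq]]]] := branchP E1x.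
have [[p1 q1] pq [cg E1pq] gpq _] := br.
have pin : p \in `[p, q] by rewrite in_itv /= lexx ltW.
have qin : q \in `[p, q] by rewrite in_itv /= lexx ltW.
have xin : x \in `[p, q] by rewrite in_itv /= px.
have pre y : -1 <= y <= 1 -> exists2 s, p <= s <= q & g s = y.
  move=> yI; apply: (branch_onto br (lexx _) (ltW pq) (lexx _)).
  by case: gpq => -[-> ->];
    rewrite ?(min_idPl leN11) ?(max_idPr leN11) ?(min_idPr leN11) ?(max_idPl leN11).
have ab' : a' <= b' by exact: le_trans gxb.
have [u uI gu] : exists2 s, p <= s <= q & g s = a'.
  by apply: pre; rewrite a'1 (le_trans ab').
have [v vI gv] : exists2 s, p <= s <= q & g s = b'.
  by apply: pre; rewrite b'1 (le_trans _ ab').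
have uin : u \in `[p, q] by rewrite in_itv.
have vin : v \in `[p, q] by rewrite in_itv.
(* The preimages [u], [v] of the endpoints bound the new cylinder, in this order on an increasing
   branch and reversed on a decreasing one. *)
suff build a b : a \in `[p, q] -> b \in `[p, q] -> a <= x <= b ->
    (forall y, a <= y <= b -> a' <= g y <= b') ->
    Num.min (g a) (g b) = a' -> Num.max (g a) (g b) = b' ->
  exists a b, [/\ a <= x <= b, -1 <= a /\ b <= 1,
    (forall y, a <= y <= b -> level k.+1 y) &
    forall y, -1 <= y <= 1 -> exists2 s, a <= s <= b & iter k.+1 g s = y].
  have [[gp mono]|[gp mono]] := branch_mono br.
    have m y z : y \in `[p, q] -> z \in `[p, q] -> (g y <= g z) = (y <= z).
      by move=> yin zin; exact: mono.
    apply: (build u v) => //; rewrite ?gu ?gv ?(min_idPl ab') ?(max_idPr ab')//.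
      by rewrite -(m u x)// -(m x v)// gu gv agx.
    move=> y /andP[uy yv]; have yin : y \in `[p, q].
      rewrite in_itv /=; case/andP: uI vI => pu _ /andP[_ vq].
      by rewrite (le_trans pu uy) (le_trans yv vq).
    by rewrite -gu -gv !m// uy.
  have m y z : y \in `[p, q] -> z \in `[p, q] -> (g y <= g z) = (z <= y).
    by move=> yin zin; exact: mono.
  apply: (build v u) => //; rewrite ?gu ?gv ?(min_idPr ab') ?(max_idPl ab')//.
    by rewrite -(m x v)// -(m u x)// gu gv gxb.
  move=> y /andP[vy yu]; have yin : y \in `[p, q].
    rewrite in_itv /=; case/andP: vI uI => pu _ /andP[_ vq].
    by rewrite (le_trans pu vy) (le_trans yu vq).
  by rewrite -gu -gv !m// yu.
rewrite !in_itv /= => /andP[pa aq] /andP[pb bq] /andP[ax xb] gab gmin gmax.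
exists a, b; split; first by rewrite ax.
- by split; [exact: le_trans pa|exact: le_trans q1].
- move=> y yab [|n] nk; first by apply: E1pq; case/andP: yab => ? ?;
    rewrite (le_trans pa)// (le_trans _ bq).
  by rewrite iterSr; apply: lab => //; exact: gab.
move=> y yI; have [s sab gs] := onto _ yI.
have [|t tab gt] := branch_onto (t := s) br pa (le_trans ax xb) bq.
  by rewrite gmin gmax.
by exists t => //; rewrite -[LHS]/(iter k.+1 g t) iterSr gt.
Qed.

(* Every cylinder contains preimages of both 1 and e, hence two survivors. *)
Lemma survivors_perfect e : S e -> e != 1 ->
  (forall a b, a < b -> ~ (forall x, a <= x <= b -> S x)) ->
  forall x, S x -> forall eps, 0 < eps ->
  exists y, [/\ S y, y != x & `|y - x| < eps].
Proof.
move=> Se e1 noseg x Sx eps eps0.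
have hole a b : a < b -> exists2 t, a <= t <= b & ~ S t.
  move=> ab; apply: contrapT => nh; apply: (noseg _ _ ab) => t tab.
  by apply: contrapT => St; apply: nh; exists t.
have [u /andP[u1 u2] Su] : exists2 t, x - eps / 2 <= t <= x & ~ S t.
  by apply: hole; lra.
have [v /andP[v1 v2] Sv] : exists2 t, x <= t <= x + eps / 2 & ~ S t.
  by apply: hole; lra.
have /existsNP[k uk] := Su; have /existsNP[l vl] := Sv.
(* By level [m] both [u] and [v] have left, so the cylinder around [x] lies strictly between them
   and hence within [eps] of [x]. *)
pose m := (maxn k l).+1.
have [a [b [/andP[ax xb] _ lab onto]]] := @cylinder m x (survivors_itv Sx)
  (fun n _ => Sx n).
have ua : u < a.
  rewrite ltNge; apply/negP => au; apply: uk; apply: (lab u); last first.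
    by rewrite ltnS leq_maxl.
  by rewrite au (le_trans u2).
have bv : b < v.
  rewrite ltNge; apply/negP => vb; apply: vl; apply: (lab v); last first.
    by rewrite ltnS leq_maxr.
  by rewrite vb andbT (le_trans ax).
have pre y : S y -> exists s, [/\ S s, a <= s <= b & iter m g s = y].
  move=> Sy; have [s sab gs] := onto y (survivors_itv Sy).
  exists s; split => // n; have [nm|mn] := ltnP n m; first exact: lab.
  by rewrite -(subnK mn) iterD gs; exact: Sy.
have [s [Ss sab gs]] := pre _ Se; have [t [St tab gt]] := pre _ survivors1.
have close y : a <= y <= b -> `|y - x| < eps.
  by move=> /andP[ay yb]; rewrite ltr_norml; apply/andP; split; lra.
have [sx|sx] := eqVneq s x; last by exists s; split => //; exact: close.
exists t; split => //; last exact: close.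
by apply/eqP => tx; move: e1; rewrite -gs sx -tx gt eqxx.
Qed.

End IntervalDynamics.

(** * The confocal ellipse estimate *)

Section Ellipse.
Context {R : realType}.
Implicit Types (a b nu : R[i]).

Definition on_segment nu : Prop :=
  complex.Im nu = 0 /\ -1 <= complex.Re nu <= 1.

(** The major axis of the ellipse with foci -1 and 1 through [nu]; it equals 2 on the segment and
    exceeds 2 elsewhere. *)
Definition ell nu : R := cabs (nu - 1) + cabs (nu + 1).

Lemma ReMc a b : complex.Re (a * b) =
  complex.Re a * complex.Re b - complex.Im a * complex.Im b.
Proof. by case: a => ? ?; case: b. Qed.

Lemma ImMc a b : complex.Im (a * b) =
  complex.Re a * complex.Im b + complex.Im a * complex.Re b.
Proof. by case: a => ? ?; case: b. Qed.

Lemma ReVc a : complex.Re a^-1 = complex.Re a / cabs a ^+ 2.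
Proof. by rewrite sqr_cabs; case: a. Qed.

Lemma ImVc a : complex.Im a^-1 = - (complex.Im a / cabs a ^+ 2).
Proof. by rewrite sqr_cabs; case: a. Qed.

(* nu = (u + 1/u) / 2 with u = x + i y outside the closed unit disc. *)
Lemma joukowski nu : ~ on_segment nu -> exists x y : R,
  [/\ 1 < x ^+ 2 + y ^+ 2,
      complex.Re nu = x * (1 + (x ^+ 2 + y ^+ 2)^-1) / 2 &
      complex.Im nu = y * (1 - (x ^+ 2 + y ^+ 2)^-1) / 2].
Proof.
move=> nseg; pose r := sqrtc (nu ^+ 2 - 1).
have rr : r ^+ 2 = nu ^+ 2 - 1 by exact: sqr_sqrtc.
have prod1 : (nu + r) * (nu - r) = 1 by rewrite mulrC -subr_sqr rr; ring.
have outside u : u * (2 * nu - u) = 1 -> 1 < cabs u -> exists x y : R,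
    [/\ 1 < x ^+ 2 + y ^+ 2,
      complex.Re nu = x * (1 + (x ^+ 2 + y ^+ 2)^-1) / 2 &
      complex.Im nu = y * (1 - (x ^+ 2 + y ^+ 2)^-1) / 2].
  move=> uE u1; exists (complex.Re u), (complex.Im u); rewrite -sqr_cabs.
  have u0 : u != 0 by rewrite -cabs_gt0 (lt_trans _ u1).
  have uV : u^-1 = 2 * nu - u by apply: (mulfI u0); rewrite divff// uE.
  have two : (2 : R[i]) = 2%:C by rewrite rmorph_nat.
  have nuE : u + u^-1 = 2%:C * nu by rewrite uV two; ring.
  split; first by rewrite exprn_egt1.
    have := congr1 (@complex.Re R) nuE; rewrite raddfD /= ReVc ReMc /=.
    by move: ((cabs u ^+ 2)^-1) => t; nra.
  have := congr1 (@complex.Im R) nuE; rewrite raddfD /= ImVc ImMc /=.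
  by move: ((cabs u ^+ 2)^-1) => t; nra.
have [h|h|h] := ltrgtP (cabs (nu + r)) 1.
- apply: (outside (nu - r)); first by rewrite -[RHS]prod1; ring.
  have := congr1 (@cabs R) prod1; rewrite cabsM.
  have -> : cabs (1 : R[i]) = 1 by rewrite (cabs_real 1) normr1.
  have := cabs_ge0 (nu + r); have := cabs_ge0 (nu - r).
  move: (cabs _) (cabs _) h => p q *; nra.
- by apply: (outside (nu + r)) => //; rewrite -[RHS]prod1; ring.
(* If |u| = 1 then 1/u is the conjugate of u, so [nu] is the real part of u and lies on the
   segment. *)
exfalso; apply: nseg.
set u := nu + r in h prod1.
have u0 : u != 0 by rewrite -cabs_gt0 h.
have uV : u^-1 = 2 * nu - u.
  by apply: (mulfI u0); rewrite divff// -[LHS]prod1 /u; ring.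
have two : (2 : R[i]) = 2%:C by rewrite rmorph_nat.
have nuE : u + u^-1 = 2%:C * nu by rewrite uV two; ring.
have := normRe_le_cabs u; rewrite h ler_norml => Reu.
split.
  by have := congr1 (@complex.Im R) nuE; rewrite raddfD /= ImVc ImMc h expr1n /=; lra.
have := congr1 (@complex.Re R) nuE; rewrite raddfD /= ReVc ReMc h expr1n /= => E.
by have -> : complex.Re nu = complex.Re u by lra.
Qed.

(** With u = x + i y one has nu - 1 = (u - 1)^2 / (2 u) and nu + 1 = (u + 1)^2 / (2 u), so that
    [ell nu] = |u| + 1 / |u|. *)
Lemma sqr_ell (x y : R) nu : let rho := x ^+ 2 + y ^+ 2 in 1 < rho ->
  complex.Re nu = x * (1 + rho^-1) / 2 -> complex.Im nu = y * (1 - rho^-1) / 2 ->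
  ell nu ^+ 2 = (rho + 1) ^+ 2 / rho.
Proof.
move=> rho rho1 Re_nu Im_nu; have rho0 : 0 < rho by lra.
pose q := Num.sqrt rho; have q0 : 0 < q by rewrite sqrtr_gt0.
have qq : q ^+ 2 = rho by rewrite sqr_sqrtr// ltW.
have xq : `|x| <= q by rewrite -sqrtr_sqr ler_wsqrtr// lerDl sqr_ge0.
have := xq; rewrite ler_norml => /andP[xq1 xq2].
have m : cabs (nu - 1) = (rho + 1 - 2 * x) / (2 * q).
  apply/eqP; rewrite -(@eqrXn2 _ 2)// ?cabs_ge0//; last first.
    by apply: divr_ge0; nra.
  rewrite sqr_cabs raddfB /= raddfB /= Re_nu Im_nu expr_div_n exprMn qq subr0.
  by apply/eqP; rewrite /rho; field; rewrite -/rho gt_eqF.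
have p : cabs (nu + 1) = (rho + 1 + 2 * x) / (2 * q).
  apply/eqP; rewrite -(@eqrXn2 _ 2)// ?cabs_ge0//; last first.
    by apply: divr_ge0; nra.
  rewrite sqr_cabs raddfD /= raddfD /= Re_nu Im_nu expr_div_n exprMn qq addr0.
  by apply/eqP; rewrite /rho; field; rewrite -/rho gt_eqF.
rewrite /ell m p -mulrDl.
have -> : rho + 1 - 2 * x + (rho + 1 + 2 * x) = 2 * (rho + 1) by ring.
by rewrite -mulf_div divff// mul1r expr_div_n qq.
Qed.

Lemma ell_ge0 nu : 0 <= ell nu.
Proof. by rewrite addr_ge0// cabs_ge0. Qed.

Lemma ell_gt2 nu : ~ on_segment nu -> 2 < ell nu.
Proof.
move=> /joukowski[x [y [rho1 Re_nu Im_nu]]].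
rewrite -(@ltr_pXn2r _ 2) ?nnegrE ?ell_ge0// (sqr_ell rho1 Re_nu Im_nu).
move: (x ^+ 2 + y ^+ 2) rho1 => rho rho1.
by rewrite ltr_pdivlMr; [nra | lra].
Qed.

Lemma cabs_le_ell nu : 2 * cabs nu <= ell nu.
Proof.
have := cabsD (nu - 1) (nu + 1).
have -> : nu - 1 + (nu + 1) = 2%:C * nu by rewrite rmorph_nat; ring.
by rewrite cabsM cabs_real ger0_norm.
Qed.

Lemma ell_le_cabs nu : ell nu <= 2 * cabs nu + 2.
Proof.
have := cabsD nu (-1); have := cabsD nu 1.
have -> : cabs (-1 : R[i]) = 1 by rewrite cabsN (cabs_real 1) normr1.
have -> : cabs (1 : R[i]) = 1 by rewrite (cabs_real 1) normr1.
by rewrite /ell; lra.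
Qed.

Lemma ell_real (x : R) : -1 <= x <= 1 -> ell x%:C = 2.
Proof.
move=> /andP[x1 x2]; rewrite /ell -(rmorph1 (real_complex R)) -rmorphB -rmorphD /=.
by rewrite !cabs_real ler0_norm ?ger0_norm; lra.
Qed.

(** The hypotheses place [a] and [b] in the disc with centre [chi] and squared radius chi^2 - 1,
    seen from 0 under a half angle of cosine 1 / chi; this bounds |a - b| by a fraction of |a| +
    |b|. The slack [ex] in the first hypothesis turns into a definite gain, and 16 comes from |a|,
    |b| <= 2 chi. *)
Lemma ellipse_step a b (chi ex : R) : 0 < chi -> 0 <= ex ->
  cabs a ^+ 2 + 1 + ex <= 2 * chi * complex.Re a ->
  cabs b ^+ 2 + 1 <= 2 * chi * complex.Re b ->
  (cabs a + cabs b) ^+ 2 * (1 + ex / (16 * chi ^+ 2)) <=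
  chi ^+ 2 * ((cabs a + cabs b) ^+ 2 - cabs (a - b) ^+ 2).
Proof.
move=> chi0 ex0 ha hb.
have Rea := Re_le_cabs a; have Reb := Re_le_cabs b.
have A0 : 0 < cabs a.
  rewrite lt_neqAle cabs_ge0 andbT eq_sym; apply/eqP => a0; move: ha Rea.
  by rewrite a0; nra.
have B0 : 0 < cabs b.
  rewrite lt_neqAle cabs_ge0 andbT eq_sym; apply/eqP => b0; move: hb Reb.
  by rewrite b0; nra.
have sA := sqr_cabs a; have sB := sqr_cabs b; have sAB := sqr_cabs (a - b).
move: ha hb Rea Reb A0 B0 sA sB sAB; rewrite !raddfB /=.
move: (cabs a) (cabs b) (cabs (a - b)) => A B AB.
move: (complex.Re a) (complex.Im a) (complex.Re b) (complex.Im b).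
move=> a1 a2 b1 b2 ha hb Rea Reb A0 B0 sA sB sAB.
have A2 : A <= 2 * chi.
  by rewrite -(ler_pM2r A0); nra.
have B2 : B <= 2 * chi.
  by rewrite -(ler_pM2r B0); nra.
(* |a / A + b / B| is at least the real part of a / A + b / B *)
have h1 : (a1 * B + b1 * A) ^+ 2 <= A * B * ((A + B) ^+ 2 - AB ^+ 2).
  have : 0 <= (a2 * B + b2 * A) ^+ 2 by exact: sqr_ge0.
  rewrite sAB => h.
  have -> : A * B * ((A + B) ^+ 2 - ((a1 - b1) ^+ 2 + (a2 - b2) ^+ 2)) =
    (a1 * B + b1 * A) ^+ 2 + (a2 * B + b2 * A) ^+ 2.
    have eA : A ^+ 2 = a1 ^+ 2 + a2 ^+ 2 by [].
    have eB : B ^+ 2 = b1 ^+ 2 + b2 ^+ 2 by [].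
    rewrite (_ : (A + B) ^+ 2 = A ^+ 2 + B ^+ 2 + 2 * (A * B)); last by ring.
    rewrite (_ : (a1 * B + b1 * A) ^+ 2 + (a2 * B + b2 * A) ^+ 2 =
      (a1 ^+ 2 + a2 ^+ 2) * B ^+ 2 + (b1 ^+ 2 + b2 ^+ 2) * A ^+ 2 +
      2 * (A * B) * (a1 * b1 + a2 * b2)); last by ring.
    rewrite -eA -eB (_ : (a1 - b1) ^+ 2 + (a2 - b2) ^+ 2 =
      (a1 ^+ 2 + a2 ^+ 2) + (b1 ^+ 2 + b2 ^+ 2) - 2 * (a1 * b1 + a2 * b2));
      last by ring.
    by rewrite -eA -eB; ring.
  by lra.
(* The two hypotheses multiplied by |b| and |a| respectively, then added. *)
have h2 : (A + B) * (A * B + 1) + ex * B <= 2 * chi * (a1 * B + b1 * A).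
  have := ler_wpM2r (ltW B0) ha; have := ler_wpM2r (ltW A0) hb; nra.
have h3 : ((A + B) * (A * B + 1) + ex * B) ^+ 2 <=
    4 * chi ^+ 2 * (A * B * ((A + B) ^+ 2 - AB ^+ 2)).
  apply: (@le_trans _ _ ((2 * chi * (a1 * B + b1 * A)) ^+ 2)).
    rewrite ler_sqr ?nnegrE//; last apply: le_trans h2;
      by rewrite addr_ge0 ?mulr_ge0 ?addr_ge0 ?mulr_ge0// ltW.
  rewrite exprMn (_ : (2 * chi) ^+ 2 = 4 * chi ^+ 2); last by ring.
  by rewrite ler_wpM2l// mulr_ge0// sqr_ge0.
move: h3; set T := _ - AB ^+ 2 => h3.
have AB0 : 0 < A * B by exact: mulr_gt0.
rewrite -(ler_pM2l (_ : 0 < 4 * (A * B))); last by rewrite mulr_gt0.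
have -> : 4 * (A * B) * (chi ^+ 2 * T) = 4 * chi ^+ 2 * (A * B * T) by ring.
apply: le_trans h3.
have c16 : 0 < 16 * chi ^+ 2 by rewrite mulr_gt0// exprn_gt0.
have -> : 4 * (A * B) * ((A + B) ^+ 2 * (1 + ex / (16 * chi ^+ 2))) =
  4 * (A * B) * (A + B) ^+ 2 +
  ex * (4 * (A * B) * (A + B) ^+ 2 / (16 * chi ^+ 2)).
  by field; rewrite gt_eqF.
have h4 : 4 * (A * B) * (A + B) ^+ 2 <= ((A + B) * (A * B + 1)) ^+ 2.
  rewrite exprMn mulrC ler_wpM2l ?sqr_ge0//.
  by have := sqr_ge0 (A * B - 1); nra.
have h5 : 4 * (A * B) * (A + B) ^+ 2 / (16 * chi ^+ 2) <=
    2 * B * ((A + B) * (A * B + 1)).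
  rewrite ler_pdivrMr//.
  have s4 : A + B <= 4 * chi by lra.
  have s5 : A * (A + B) <= 8 * chi ^+ 2 by have := mulr_ge0 (ltW A0) (ltW B0); nra.
  have s6 : 0 <= B * (A + B) by rewrite mulr_ge0 ?addr_ge0// ltW.
  have s7 : 4 * (A * (A + B)) <= 2 * (A * B + 1) * (16 * chi ^+ 2).
    have c2 : 0 <= chi ^+ 2 by exact: sqr_ge0.
    have := mulr_ge0 (ltW AB0) c2; nra.
  by have := ler_wpM2l s6 s7; nra.
have := ler_wpM2l ex0 h5; have := sqr_ge0 (ex * B); move: h4.
move: ((A + B) * (A * B + 1)) (4 * (A * B) * (A + B) ^+ 2 / _) => X Z.
have -> : (X + ex * B) ^+ 2 = X ^+ 2 + ex * (2 * B * X) + (ex * B) ^+ 2 by ring.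
by move: (4 * (A * B) * (A + B) ^+ 2) (ex * Z) => ? ?; lra.
Qed.

End Ellipse.

(** * Pairs of Stieltjes transforms *)

Section Stieltjes.
Context {R : realType}.
Implicit Types (s : seq R) (w alpha beta : R -> R) (nu : R[i]) (x k : R).

Definition stj s w x : R := \sum_(k <- s) w k / (x - k).

Definition cstj s w nu : R[i] := \sum_(k <- s) (w k)%:C / (nu - k%:C).

Record weights s w : Prop := Weights {
  weights_itv : forall k, k \in s -> -1 <= k <= 1;
  weights_ge0 : forall k, 0 <= w k;
  weights_sum : \sum_(k <- s) w k = 1 }.

Lemma weighted_variance s w (y : R -> R) : \sum_(k <- s) w k = 1 ->
  \sum_(k <- s) w k * (y k - \sum_(k <- s) w k * y k) ^+ 2 =
  \sum_(k <- s) w k * y k ^+ 2 - (\sum_(k <- s) w k * y k) ^+ 2.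
Proof.
move=> w1; set m := \sum_(k <- s) w k * y k.
transitivity (\sum_(k <- s) (w k * y k ^+ 2 - 2 * m * (w k * y k) +
    m ^+ 2 * w k)).
  by apply: eq_bigr => k _; ring.
rewrite !big_split /= sumrN -!mulr_sumr w1 -/m.
by ring.
Qed.

Lemma Re_cstj s w nu : complex.Re (cstj s w nu) =
  \sum_(k <- s) w k * complex.Re (nu - k%:C)^-1.
Proof.
rewrite /cstj raddf_sum /=; apply: eq_bigr => k _.
by rewrite ReMc /= mul0r subr0.
Qed.

Lemma Im_cstj s w nu : complex.Im (cstj s w nu) =
  \sum_(k <- s) w k * complex.Im (nu - k%:C)^-1.
Proof.
rewrite /cstj raddf_sum /=; apply: eq_bigr => k _.
by rewrite ImMc /= mul0r addr0.
Qed.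

(** The variance of 1 / (nu - k) under [w], the source of strict growth. *)
Definition cspread s w nu : R :=
  \sum_(k <- s) w k * cabs ((nu - k%:C)^-1 - cstj s w nu) ^+ 2.

Lemma cspreadE s w nu : \sum_(k <- s) w k = 1 -> cspread s w nu =
  \sum_(k <- s) w k * cabs (nu - k%:C)^-1 ^+ 2 - cabs (cstj s w nu) ^+ 2.
Proof.
move=> w1; rewrite sqr_cabs Re_cstj Im_cstj.
have := weighted_variance (fun k => complex.Re (nu - k%:C)^-1) w1.
have := weighted_variance (fun k => complex.Im (nu - k%:C)^-1) w1 => vI vR.
transitivity (\sum_(k <- s) (w k * (complex.Re (nu - k%:C)^-1 -
    complex.Re (cstj s w nu)) ^+ 2 + w k * (complex.Im (nu - k%:C)^-1 -
    complex.Im (cstj s w nu)) ^+ 2)).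
  by apply: eq_bigr => k _; rewrite sqr_cabs !raddfB /= mulrDr.
rewrite big_split /= Re_cstj Im_cstj vI vR.
under [in RHS]eq_bigr do rewrite sqr_cabs mulrDr.
by rewrite big_split /=; ring.
Qed.

(* With a = e f this says |a|^2 + 1 <= 2 chi Re a, with equality for a point
   mass at an endpoint of the segment. *)
Lemma cstj_disc s w nu (x y rho chi : R) (e : R[i]) :
  rho = x ^+ 2 + y ^+ 2 -> weights s w -> 1 < rho ->
  complex.Re nu = x * (1 + rho^-1) / 2 -> complex.Im nu = y * (1 - rho^-1) / 2 ->
  e = (x * (1 - rho^-1) / 2) +i* (y * (1 + rho^-1) / 2) ->
  chi = (rho + 1) / (rho - 1) ->
  cabs (e * cstj s w nu) ^+ 2 + 1 + cabs e ^+ 2 * cspread s w nu <=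
  2 * chi * complex.Re (e * cstj s w nu).
Proof.
move=> rhoE [sI w0 w1] rho1 Re_nu Im_nu eE chiE.
have rho0 : 0 < rho by lra.
have rne : rho != 0 by rewrite gt_eqF.
have rne1 : rho - 1 != 0 by rewrite subr_eq0 gt_eqF.
(* Here [e] = (u - 1/u) / 2 for u = x + i y. A single point mass satisfies the disc inequality up to
   a term of the sign of k^2 - 1; averaging over [w] then leaves the variance as the gap between the
   mean of the squares and the square of the mean. *)
have term k : k \in s -> cabs e ^+ 2 * cabs (nu - k%:C)^-1 ^+ 2 + 1 -
    2 * chi * complex.Re (e * (nu - k%:C)^-1) =
    (k ^+ 2 - 1) * cabs (nu - k%:C)^-1 ^+ 2.
  move=> ks; have D0 : nu - k%:C != 0.
    rewrite subr_eq0; apply/eqP => nuE.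
    have Im0 : y = 0.
      move: Im_nu; rewrite nuE /= => /esym/eqP; rewrite !mulf_eq0 invr_eq0.
      rewrite pnatr_eq0 orbF subr_eq0 => /orP[/eqP//|/eqP r1].
      by move: rho1; rewrite -[rho]invrK -r1 invr1 ltxx.
    have := sI _ ks; move: Re_nu; rewrite nuE /= => ->.
    have rE : rho = x ^+ 2 by rewrite rhoE Im0 expr0n addr0.
    have -> : x * (1 + rho^-1) / 2 = (rho + 1) / (2 * x).
      by rewrite rE; field; rewrite -(sqrf_eq0 x) -rE.
    have [x0|x0] := ltP 0 x.
      move=> /andP[_]; rewrite ler_pdivrMr ?mulr_gt0// mul1r.
      by move: rho1; rewrite rE => rho1; have := sqr_ge0 (x - 1); nra.
    have xn : x < 0.
      rewrite lt_neqAle x0 andbT; apply/eqP => xE.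
      by move: rho0; rewrite rE xE expr0n ltxx.
    move=> /andP[+ _]; rewrite ler_ndivlMr; last by lra.
    by move: rho1; rewrite rE => rho1; have := sqr_ge0 (x + 1); nra.
  have d0 : cabs (nu - k%:C) ^+ 2 != 0.
    by rewrite expf_neq0// cabs_eq0.
  have dE : cabs (nu - k%:C) ^+ 2 =
      (x * (1 + rho^-1) / 2 - k) ^+ 2 + (y * (1 - rho^-1) / 2) ^+ 2.
    by rewrite sqr_cabs !raddfB /= Re_nu Im_nu subr0.
  have yE : y ^+ 2 = rho - x ^+ 2 by rewrite rhoE; ring.
  rewrite cabsV exprVn ReMc ReVc ImVc.
  move: d0 dE; move: (cabs (nu - k%:C) ^+ 2) => d d0 dE.
  rewrite sqr_cabs eE !raddfB /= Re_nu Im_nu subr0 chiE.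
  apply: (mulIf d0); rewrite divfK//.
  transitivity ((x * (1 - rho^-1) / 2) ^+ 2 + (y * (1 + rho^-1) / 2) ^+ 2 + d -
    2 * ((rho + 1) / (rho - 1)) * (x * (1 - rho^-1) / 2 *
    (x * (1 + rho^-1) / 2 - k) + y * (1 + rho^-1) / 2 * (y * (1 - rho^-1) / 2))).
    by field; rewrite rne rne1 d0.
  rewrite dE; transitivity (k ^+ 2 + (x ^+ 2 * ((1 + rho^-1) ^+ 2 +
    (1 - rho^-1) ^+ 2) / 4 + y ^+ 2 * ((1 + rho^-1) ^+ 2 +
    (1 - rho^-1) ^+ 2) / 4) - k * x * (1 + rho^-1) -
    2 * ((rho + 1) / (rho - 1)) * ((x ^+ 2 + y ^+ 2) * (1 - rho^-1) *
      (1 + rho^-1) / 4 - k * x * (1 - rho^-1) / 2)).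
    by field; rewrite rne rne1.
  by rewrite yE; field; rewrite rne rne1.
have Re_e : complex.Re (e * cstj s w nu) =
    \sum_(k <- s) w k * complex.Re (e * (nu - k%:C)^-1).
  rewrite ReMc Re_cstj Im_cstj !mulr_sumr -sumrB; apply: eq_bigr => k _.
  by rewrite ReMc; ring.
have key : cabs e ^+ 2 * \sum_(k <- s) w k * cabs (nu - k%:C)^-1 ^+ 2 + 1 -
    2 * chi * complex.Re (e * cstj s w nu) <= 0.
  rewrite Re_e -[X in _ + X - _]w1 !mulr_sumr -big_split -sumrB /=.
  rewrite big_seq; apply: sumr_le0 => k ks.
  have -> : cabs e ^+ 2 * (w k * cabs (nu - k%:C)^-1 ^+ 2) + w k -
      2 * chi * (w k * complex.Re (e * (nu - k%:C)^-1)) =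
      w k * (cabs e ^+ 2 * cabs (nu - k%:C)^-1 ^+ 2 + 1 -
      2 * chi * complex.Re (e * (nu - k%:C)^-1)) by ring.
  rewrite term// mulr_ge0_le0 ?w0// mulr_le0_ge0 ?sqr_ge0//.
  by have /andP[? ?] := sI _ ks; nra.
rewrite cabsM exprMn (cspreadE _ w1); move: key; lra.
Qed.

(** [stj_pole] rules out common zeros of the two numerators at a pole; [stj_alpha1] and [stj_beta1]
    make 1 a fixed point of (f + h) / (f - h). *)
Record stieltjes_pair s alpha beta : Prop := StieltjesPair {
  stj_weightsl : weights s alpha;
  stj_weightsr : weights s beta;
  stj_uniq : uniq s;
  stj_pole : forall k, k \in s -> 0 < alpha k + beta k;
  stj_mean : \sum_(k <- s) alpha k * k = \sum_(k <- s) beta k * k;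
  stj_one : 1 \in s;
  stj_alpha1 : 0 < alpha 1;
  stj_beta1 : beta 1 = 0 }.

(** A point mass [alpha] at 1 would have mean 1. Then [beta] would have mean 1 too and be
    concentrated at 1, where it has no mass. *)
Lemma stj_other s alpha beta : stieltjes_pair s alpha beta ->
  exists k, [/\ k \in s, k != 1 & 0 < alpha k].
Proof.
move=> [[sI a0 a1] [_ b0 b1] us pole mean one al1 be1].
apply: contrapT => no.
have az k : k \in s -> k != 1 -> alpha k = 0.
  move=> ks k1; apply/eqP; rewrite eq_le a0 andbT leNgt; apply/negP => ak.
  by apply: no; exists k.
have : \sum_(k <- s) alpha k * (1 - k) = 0.
  rewrite big_seq big1// => k ks; have [->|k1] := eqVneq k 1.
    by rewrite subrr mulr0.
  by rewrite az// mul0r.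
have -> : \sum_(k <- s) alpha k * (1 - k) = \sum_(k <- s) beta k * (1 - k).
  under eq_bigr do rewrite mulrBr mulr1.
  under [RHS]eq_bigr do rewrite mulrBr mulr1.
  by rewrite !sumrB a1 b1 mean.
move=> /eqP; rewrite big_seq psumr_eq0; last first.
  by move=> k ks; rewrite mulr_ge0 ?b0// subr_ge0; have /andP[] := sI _ ks.
move=> /allP bz; have : \sum_(k <- s) beta k = 0.
  rewrite big_seq big1// => k ks; have := bz k ks; rewrite ks /= mulf_eq0.
  rewrite subr_eq0 => /orP[/eqP//|/eqP k1]; by rewrite -k1 be1.
by rewrite b1 => /eqP; rewrite oner_eq0.
Qed.

(** Since [ell] of (f + h) / (f - h) is 2 (|f| + |h|) / |f - h| and chi^-2 = 1 - 4 / ell^2,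
    [ellipse_step] compares the two axes directly. The explicit gain is bounded below between any
    two ellipses, as a uniform escape time requires. *)
Lemma cstj_growth s alpha beta : stieltjes_pair s alpha beta ->
  exists2 c : R, 0 < c & forall nu, ~ on_segment nu ->
    let f := cstj s alpha nu in let h := cstj s beta nu in
    [/\ f != 0, h != 0 & f != h ->
     ell nu ^+ 2 * (1 + c * (ell nu ^+ 2 - 4) ^+ 3 / ell nu ^+ 8) <=
     ell ((f + h) / (f - h)) ^+ 2].
Proof.
move=> H; have [k [ks k1 ak]] := stj_other H.
have [wa wb us _ _ one al1 _] := H.
have [sI a0 a1] := wa; have [_ b0 _] := wb.
pose m := Num.min (alpha 1) (alpha k).
have m0 : 0 < m by rewrite lt_min al1 ak.
have kI := sI _ ks.
(* The factors 8, 4 and 16 come from the variance, from the bound on |e|^2 and from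
   [ellipse_step]. *)
pose c := m * (1 - k) ^+ 2 / (8 * 4 * 16).
have c0 : 0 < c.
  have k1' : 0 < 1 - k by rewrite subr_gt0 lt_neqAle k1; have /andP[] := kI.
  by rewrite divr_gt0 ?mulr_gt0.
exists c => // nu nseg f h.
have [x [y [rho1 Re_nu Im_nu]]] := joukowski nseg.
have L2 := sqr_ell rho1 Re_nu Im_nu; have Lgt := ell_gt2 nseg.
have [rho rhoE] : exists rho, rho = x ^+ 2 + y ^+ 2 by eexists.
move: rho1 Re_nu Im_nu L2; rewrite -rhoE => rho1 Re_nu Im_nu L2.
have [e eE] : exists e, e = (x * (1 - rho^-1) / 2) +i* (y * (1 + rho^-1) / 2).
  by eexists.
have [chi chiE] : exists chi, chi = (rho + 1) / (rho - 1) by eexists.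
have Da := cstj_disc rhoE wa rho1 Re_nu Im_nu eE chiE.
have Db := cstj_disc rhoE wb rho1 Re_nu Im_nu eE chiE.
rewrite -/f -/h in Da Db.
have e2 : (ell nu ^+ 2 - 4) / 4 <= cabs e ^+ 2.
  have r0 : 0 < rho by lra.
  rewrite L2 eE sqr_cabs /=.
  have -> : ((rho + 1) ^+ 2 / rho - 4) / 4 = rho * (1 - rho^-1) ^+ 2 / 4.
    by field; rewrite gt_eqF.
  rewrite {1}rhoE; have : 0 < rho^-1 by rewrite invr_gt0.
  by move: (_^-1) => r r1; have := mulr_ge0 (sqr_ge0 y) (ltW r1); nra.
have spa0 : 0 <= cspread s alpha nu.
  by apply: sumr_ge0 => j _; rewrite mulr_ge0// sqr_ge0.
have spb0 : 0 <= cspread s beta nu.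
  by apply: sumr_ge0 => j _; rewrite mulr_ge0// sqr_ge0.
have chi0 : 0 < chi by rewrite chiE divr_gt0; lra.
have ex0 : 0 <= cabs e ^+ 2 * cspread s alpha nu by rewrite mulr_ge0 ?sqr_ge0.
have Db' : cabs (e * h) ^+ 2 + 1 <= 2 * chi * complex.Re (e * h).
  by apply: le_trans Db; rewrite lerDl mulr_ge0// sqr_ge0.
have nz a ex : 0 <= ex -> cabs (e * a) ^+ 2 + 1 + ex <= 2 * chi * complex.Re (e * a) ->
    a != 0.
  move=> ex1 ha; apply/eqP => aE; move: ha; rewrite aE mulr0 cabs0 expr0n /=.
  by rewrite mulr0; lra.
have f0 : f != 0 by exact: nz ex0 Da.
have h0 : h != 0 by apply: (nz h 0) => //; rewrite addr0.
split => // fh.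
have := ellipse_step chi0 ex0 Da Db'.
have e0 : 0 < cabs e.
  rewrite -(@ltr_pXn2r _ 2) ?nnegrE ?cabs_ge0// expr0n /=.
  by apply: lt_le_trans e2; rewrite divr_gt0// subr_gt0; nra.
rewrite -mulrBr !cabsM -mulrDr !exprMn.
have F0 : 0 < cabs f by rewrite cabs_gt0.
have H0 : 0 < cabs h by rewrite cabs_gt0.
have fh0 : 0 < cabs (f - h) by rewrite cabs_gt0 subr_eq0.
have -> : ell ((f + h) / (f - h)) = 2 * (cabs f + cabs h) / cabs (f - h).
  have fhn : f - h != 0 by rewrite subr_eq0.
  rewrite /ell; have -> : (f + h) / (f - h) - 1 = 2%:C * h / (f - h).
    by rewrite rmorph_nat; field.
  have -> : (f + h) / (f - h) + 1 = 2%:C * f / (f - h).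
    by rewrite rmorph_nat; field.
  by rewrite !cabsM !cabsV cabs_real ger0_norm// -mulrDl -mulrDr [cabs h + _]addrC.
set S := (cabs f + cabs h); set D := cabs (f - h).
set ex := cabs e ^+ 2 * cspread s alpha nu => step.
pose L' := (2 * S / D) ^+ 2.
have S0 : 0 < S by rewrite addr_gt0.
have L'0 : 0 < L' by rewrite exprn_gt0// divr_gt0// mulr_gt0.
have chi2 : chi ^- 2 = 1 - 4 / ell nu ^+ 2.
  by rewrite L2 chiE; field; rewrite !gt_eqF//; lra.
have l0 : 0 < ell nu by lra.
have l4 : 4 < ell nu ^+ 2 by nra.
have chi20 : 0 < chi ^+ 2 by exact: exprn_gt0.
pose eta := ex / (16 * chi ^+ 2).
have eta0 : 0 <= eta by rewrite divr_ge0// mulr_ge0// ltW.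
have step1 : (1 + eta) * chi ^- 2 <= 1 - 4 / L'.
  have DE : D ^+ 2 = 4 * S ^+ 2 / L'.
    by rewrite /L'; field; rewrite !gt_eqF.
  rewrite ler_pdivrMr//.
  have eS0 : 0 < cabs e ^+ 2 * S ^+ 2 by rewrite mulr_gt0 ?exprn_gt0.
  rewrite -(ler_pM2l eS0); apply: le_trans step _.
  by rewrite DE le_eqVlt; apply/orP; left; apply/eqP; field; rewrite gt_eqF.
have step2 : ell nu ^+ 2 * (1 + eta * chi ^- 2) <= L'.
  move: step1; rewrite mulrDl mul1r {1}chi2.
  have : 0 <= eta * chi ^- 2 by rewrite mulr_ge0// invr_ge0 ltW.
  move: (eta * chi ^- 2) => t t0 ht.
  have t1 : 4 / L' <= 4 / ell nu ^+ 2 - t by lra.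
  have t2 : 4 <= (4 / ell nu ^+ 2 - t) * L' by rewrite -ler_pdivrMr.
  have t3 : ell nu ^+ 2 <= L'.
    have : 4 / L' <= 4 / ell nu ^+ 2 by lra.
    by rewrite ler_pM2l// lef_pV2// posrE exprn_gt0.
  have t4 : (4 / ell nu ^+ 2 - t) * L' = 4 * (L' / ell nu ^+ 2) - t * L' by ring.
  have t5 : 1 + t <= L' / ell nu ^+ 2.
    have : t * 4 <= t * L' by rewrite ler_wpM2l//; lra.
    by move: t2; rewrite t4; move: (L' / _) (t * L') => ? ?; lra.
  by rewrite mulrC -ler_pdivlMr ?exprn_gt0.
apply: le_trans step2; rewrite ler_wpM2l ?sqr_ge0// lerD2l.
(* The values of 1 / (nu - j) at the atoms j = 1 and j = k are at least (1 - k) / (2 ell^2) apart,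
   so they cannot both be close to the mean [f]. *)
have spread : m * (1 - k) ^+ 2 / (8 * ell nu ^+ 4) <= cspread s alpha nu.
  have two (j l : R) : j \in s -> l \in s -> j != l ->
      alpha j * cabs ((nu - j%:C)^-1 - f) ^+ 2 +
      alpha l * cabs ((nu - l%:C)^-1 - f) ^+ 2 <= cspread s alpha nu.
    move=> js ls jl; rewrite /cspread (big_rem j)//= (big_rem l)/=; last first.
      by rewrite mem_rem_uniq// inE eq_sym jl.
    rewrite addrA lerDl; apply: sumr_ge0 => i _.
    by rewrite mulr_ge0// sqr_ge0.
  have ne1k : 1 != k by rewrite eq_sym.
  apply: le_trans (two _ _ one ks ne1k).
  set p := cabs (_ - f); set q := cabs (_ - f).
  have p0 : 0 <= p by exact: cabs_ge0.
  have q0 : 0 <= q by exact: cabs_ge0.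
  have pq : cabs ((nu - 1%:C)^-1 - (nu - k%:C)^-1) <= p + q.
    have -> : (nu - 1%:C)^-1 - (nu - k%:C)^-1 =
      ((nu - 1%:C)^-1 - f) - ((nu - k%:C)^-1 - f) by ring.
    by rewrite (le_trans (cabsD _ _))// cabsN.
  have nz1 j : j \in s -> nu - j%:C != 0.
    move=> js; rewrite subr_eq0; apply/eqP => nuE; apply: nseg.
    by rewrite nuE; split => //=; exact: sI.
  have d1 := nz1 _ one; have dk := nz1 _ ks.
  have dE : (nu - 1%:C)^-1 - (nu - k%:C)^-1 =
      (1 - k)%:C / ((nu - 1%:C) * (nu - k%:C)).
    by rewrite rmorphB /=; field; rewrite d1 dk.
  have b1 : cabs (nu - 1%:C) <= ell nu by rewrite /ell lerDl cabs_ge0.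
  have bk : cabs (nu - k%:C) <= 2 * ell nu.
    have -> : nu - k%:C = (nu - 1%:C) + (1 - k)%:C by rewrite rmorphB /=; ring.
    rewrite (le_trans (cabsD _ _))// cabs_real ger0_norm; last by lra.
    by lra.
  have pq2 : (1 - k) / (2 * ell nu ^+ 2) <= p + q.
    apply: le_trans pq; rewrite dE cabsM cabs_real cabsV cabsM ger0_norm; last by lra.
    rewrite ler_wpM2l//; first by lra.
    rewrite lef_pV2 ?posrE ?mulr_gt0 ?cabs_gt0 ?exprn_gt0//.
    have := ler_pM (cabs_ge0 _) (cabs_ge0 _) b1 bk.
    by rewrite mulrCA -expr2.
  have am : m * (p + q) ^+ 2 / 2 <= alpha 1 * p ^+ 2 + alpha k * q ^+ 2.
    have m1 : m <= alpha 1 by rewrite ge_min lexx.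
    have mk : m <= alpha k by rewrite ge_min lexx orbT.
    have := ler_wpM2r (sqr_ge0 p) m1; have := ler_wpM2r (sqr_ge0 q) mk.
    by have := mulr_ge0 (ltW m0) (sqr_ge0 (p - q)); nra.
  apply: le_trans am; rewrite -mulrA -[leRHS]mulrA ler_wpM2l ?(ltW m0)//.
  have -> : (1 - k) ^+ 2 / (8 * ell nu ^+ 4) = ((1 - k) / (2 * ell nu ^+ 2)) ^+ 2 / 2.
    by field; rewrite gt_eqF.
  rewrite ler_wpM2r// ler_sqr ?nnegrE//; last by rewrite addr_ge0.
  by apply: divr_ge0; [lra | apply: mulr_ge0 => //; exact: sqr_ge0].
have ex1 : (ell nu ^+ 2 - 4) / 4 * (m * (1 - k) ^+ 2 / (8 * ell nu ^+ 4)) <= ex.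
  apply: ler_pM => //; first by apply: divr_ge0 => //; lra.
  apply: divr_ge0; apply: mulr_ge0 => //;
    [exact: ltW | exact: sqr_ge0 | exact: exprn_ge0 (ltW l0)].
have -> : c * (ell nu ^+ 2 - 4) ^+ 3 / ell nu ^+ 8 =
  (ell nu ^+ 2 - 4) / 4 * (m * (1 - k) ^+ 2 / (8 * ell nu ^+ 4)) *
  (1 - 4 / ell nu ^+ 2) ^+ 2 / 16.
  by rewrite /c; field; rewrite gt_eqF.
rewrite -chi2 /eta.
have -> : ex / (16 * chi ^+ 2) * chi ^- 2 = ex * (chi ^- 2) ^+ 2 / 16.
  by field; rewrite gt_eqF.
by rewrite ler_wpM2r// ler_wpM2r// sqr_ge0.
Qed.

End Stieltjes.

(** * Branches on the real line *)

Section RealBranches.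
Context {R : realType}.
Implicit Types (s : seq R) (w alpha beta : R -> R) (x y k t : R).

Definition pole_poly s : {poly R} := \prod_(k <- s) ('X - k%:P).

Definition pole_cofactor s k : {poly R} := \prod_(j <- s | j != k) ('X - j%:P).

(** The numerator of [stj s w] over the common denominator [pole_poly s]; unlike the transform it is
    meaningful at the poles. *)
Definition spoly s w : {poly R} := \sum_(k <- s) w k *: pole_cofactor s k.

Lemma pole_polyE s k : uniq s -> k \in s ->
  pole_poly s = ('X - k%:P) * pole_cofactor s k.
Proof. by move=> us ks; rewrite /pole_poly (bigD1_seq k). Qed.

Lemma pole_poly_neq0 s x : x \notin s -> (pole_poly s).[x] != 0.
Proof.
move=> xs; rewrite /pole_poly horner_prod prodf_seq_neq0; apply/allP => k ks.
by rewrite /= hornerXsubC subr_eq0; apply: contraNneq xs => ->.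
Qed.

Lemma cofactor_neq0 s k : (pole_cofactor s k).[k] != 0.
Proof.
rewrite /pole_cofactor horner_prod prodf_seq_neq0; apply/allP => j js.
by apply/implyP => jk; rewrite hornerXsubC subr_eq0 eq_sym.
Qed.

Lemma cofactor_other s j k : j \in s -> j != k -> (pole_cofactor s k).[j] = 0.
Proof.
move=> js jk; rewrite /pole_cofactor horner_prod; apply/eqP.
rewrite prodf_seq_eq0; apply/hasP; exists j => //.
by rewrite jk hornerXsubC subrr eqxx.
Qed.

Lemma spoly_stj s w x : uniq s -> x \notin s ->
  (spoly s w).[x] = (pole_poly s).[x] * stj s w x.
Proof.
move=> us xs; rewrite /spoly /stj horner_sum mulr_sumr big_seq [RHS]big_seq.
apply: eq_bigr => k ks; rewrite hornerZ (pole_polyE us ks) hornerM hornerXsubC.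
have xk : x - k != 0 by rewrite subr_eq0; apply: contraNneq xs => ->.
by field.
Qed.

Lemma spoly_pole s w k : uniq s -> k \in s ->
  (spoly s w).[k] = w k * (pole_cofactor s k).[k].
Proof.
move=> us ks; rewrite /spoly horner_sum (bigD1_seq k)//= hornerZ big1 ?addr0//.
by move=> j jk; rewrite hornerZ cofactor_other ?mulr0// eq_sym.
Qed.

(** The identity 1/(t - k) = 1/(x - k) - (t - x) / ((x - k)(t - k)) with denominators cleared; it
    gives the derivative at [x] without differentiating a product over the poles. *)
Lemma spoly_split s w x : uniq s -> x \notin s ->
  spoly s w = stj s w x *: pole_poly s -
              ('X - x%:P) * spoly s (fun k => w k / (x - k)).
Proof.
move=> us xs; rewrite /spoly /stj scaler_suml mulr_sumr -sumrB.
rewrite big_seq [RHS]big_seq; apply: eq_bigr => k ks.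
have xk : x - k != 0 by rewrite subr_eq0; apply: contraNneq xs => ->.
rewrite (pole_polyE us ks) -scalerAr -scalerBr -mulrBl.
have -> : 'X - k%:P - ('X - x%:P) = (x - k)%:P by rewrite polyCB; ring.
by rewrite mul_polyC scalerA divfK.
Qed.

(** Minus the derivative of [stj s w] off the poles. *)
Definition stj2 s w x : R := \sum_(k <- s) w k / (x - k) ^+ 2.

Lemma deriv_spoly s w x : uniq s -> x \notin s -> (spoly s w)^`().[x] =
  (pole_poly s)^`().[x] * stj s w x - (pole_poly s).[x] * stj2 s w x.
Proof.
move=> us xs; rewrite (spoly_split w us xs) derivB derivZ derivM derivXsubC mul1r.
rewrite hornerD hornerN hornerZ hornerD hornerM hornerXsubC subrr mul0r addr0.
rewrite (spoly_stj _ us xs) mulrC; congr (_ - _ * _).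
rewrite /stj /stj2; apply: eq_bigr => k _.
by rewrite -mulrA -invfM -expr2.
Qed.

Lemma stj2_gt0 s w x : weights s w -> x \notin s -> 0 < stj2 s w x.
Proof.
move=> [_ w0 w1] xs.
have t0 k : 0 <= w k / (x - k) ^+ 2 by rewrite divr_ge0 ?sqr_ge0.
rewrite lt_neqAle sumr_ge0 ?andbT//; apply/eqP => /esym/eqP.
rewrite /stj2 psumr_eq0// => /allP z; move: w1 => /eqP; apply/negP.
rewrite big_seq big1 ?[0 == 1]eq_sym ?oner_eq0// => k ks.
have := z k ks; rewrite /= mulf_eq0 invr_eq0 sqrf_eq0 subr_eq0 => /orP[/eqP//|].
by move=> /eqP xk; move: xs; rewrite xk ks.
Qed.

Lemma stj_decr s w x y : weights s w -> x < y ->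
  (forall k, k \in s -> 0 < w k -> ~~ (x <= k <= y)) -> stj s w y < stj s w x.
Proof.
move=> [_ w0 w1] xy nok; rewrite -subr_gt0 /stj -sumrB.
have t0 k : k \in s -> 0 <= w k / (x - k) - w k / (y - k) ?= iff (w k == 0).
  move=> ks; have [->|wk] := eqVneq (w k) 0; first by rewrite !mul0r subr0; apply/leif_refl.
  have wk0 : 0 < w k by rewrite lt_neqAle eq_sym wk w0.
  have /nok/(_ wk0) := ks; rewrite negb_and -!ltNge => kxy.
  suff h : 0 < w k / (x - k) - w k / (y - k).
    by split; [exact: ltW | rewrite eq_sym gt_eqF].
  rewrite -mulrBr mulr_gt0// subr_gt0.
  case/orP: kxy => h.
    by rewrite ltf_pV2 ?posrE ?subr_gt0// ?ltrD2r// (lt_trans h xy).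
  rewrite -ltrN2 -!invrN !opprB ltf_pV2 ?posrE ?subr_gt0// ?ltrD2l ?ltrN2//.
  exact: lt_trans xy h.
rewrite lt_neqAle big_seq sumr_ge0 ?andbT; last by move=> k /t0[].
apply/eqP => /esym/eqP; rewrite psumr_eq0; last by move=> k /t0[].
move=> /allP z; move: w1 => /eqP; apply/negP.
rewrite big_seq big1 ?[0 == 1]eq_sym ?oner_eq0// => k ks.
by have := z k ks; rewrite ks /= eq_sym (t0 k ks).2 => /eqP.
Qed.

Lemma stj_Jensen s w x : weights s w -> -1 < x < 1 -> x \notin s ->
  1 + (1 - x ^+ 2) * stj s w x ^+ 2 +
    (1 - x ^+ 2) * \sum_(k <- s) w k * ((x - k)^-1 - stj s w x) ^+ 2 <=
  2 * (1 - x ^+ 2) * stj2 s w x + 2 * x * stj s w x.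
Proof.
move=> [sI w0 w1] /andP[x1 x2] xs.
have := weighted_variance (fun k => (x - k)^-1) w1; rewrite -/(stj s w x) => ->.
have -> : \sum_(k <- s) w k * (x - k)^-1 ^+ 2 = stj2 s w x.
  by apply: eq_bigr => k _; rewrite exprVn.
suff : 0 <= (1 - x ^+ 2) * stj2 s w x + 2 * x * stj s w x - 1 by lra.
rewrite -[X in _ - X]w1 /stj2 /stj !mulr_sumr -big_split -sumrB /= big_seq.
apply: sumr_ge0 => k ks.
have xk : x - k != 0 by rewrite subr_eq0; apply: contraNneq xs => ->.
have -> : (1 - x ^+ 2) * (w k / (x - k) ^+ 2) + 2 * x * (w k / (x - k)) - w k =
    w k * (1 - k ^+ 2) / (x - k) ^+ 2 by field.
rewrite divr_ge0 ?sqr_ge0// mulr_ge0// subr_ge0.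
by have /andP[? ?] := sI _ ks; nra.
Qed.

(* The invariant form (1 - x^2) G'^2 > 1 - G^2 of the expansion, where
   G = (f + h) / (f - h). *)
Lemma stj_expand s alpha beta x : stieltjes_pair s alpha beta ->
  -1 < x < 1 -> x \notin s ->
  let f := stj s alpha x in let h := stj s beta x in
  f * h < 0 ->
  - (f * h) * (f - h) ^+ 2 <
  (1 - x ^+ 2) * (f * stj2 s beta x - h * stj2 s alpha x) ^+ 2.
Proof.
move=> H xI xs f h fh; have [k [ks k1 ak]] := stj_other H.
have [wa wb us _ _ one al1 _] := H.
have Ja := stj_Jensen wa xI xs; have Jb := stj_Jensen wb xI xs.
rewrite -/f -/h in Ja Jb.
have [_ a0 _] := wa; have [_ b0 _] := wb.
have q0 : 0 < 1 - x ^+ 2 by case/andP: xI => ? ?; nra.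
have vb : 0 <= \sum_(k <- s) beta k * ((x - k)^-1 - h) ^+ 2.
  by apply: sumr_ge0 => j _; rewrite mulr_ge0 ?sqr_ge0.
have va : 0 < \sum_(k <- s) alpha k * ((x - k)^-1 - f) ^+ 2.
  rewrite (big_rem 1)//= (big_rem k)/=; last by rewrite mem_rem_uniq// inE k1.
  have r0 : 0 <= \sum_(j <- rem k (rem 1 s)) alpha j * ((x - j)^-1 - f) ^+ 2.
    by apply: sumr_ge0 => j _; rewrite mulr_ge0 ?sqr_ge0.
  (* 1/(x - 1) and 1/(x - k) differ, so at least one of these two atoms is off the mean. *)
  have [e1|n1] := eqVneq ((x - 1)^-1) f; last first.
    have : 0 < alpha 1 * ((x - 1)^-1 - f) ^+ 2.
      by rewrite mulr_gt0// exprn_even_gt0//= subr_eq0.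
    have : 0 <= alpha k * ((x - k)^-1 - f) ^+ 2 by rewrite mulr_ge0 ?sqr_ge0.
    by move: r0; move: (\sum_(_ <- _) _) (alpha 1 * _) (alpha k * _) => *; lra.
  have : 0 < alpha k * ((x - k)^-1 - f) ^+ 2.
    rewrite mulr_gt0// exprn_even_gt0//= subr_eq0 -e1.
    by apply: contraNneq k1 => /invr_inj; lra.
  have : 0 <= alpha 1 * ((x - 1)^-1 - f) ^+ 2 by rewrite mulr_ge0 ?sqr_ge0.
  by move: r0; move: (\sum_(_ <- _) _) (alpha 1 * _) (alpha k * _) => *; lra.
have {va}Ja : 1 + (1 - x ^+ 2) * f ^+ 2 < 2 * (1 - x ^+ 2) * stj2 s alpha x + 2 * x * f.
  by apply: lt_le_trans Ja; rewrite ltrDl mulr_gt0.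
have {vb}Jb : 1 + (1 - x ^+ 2) * h ^+ 2 <= 2 * (1 - x ^+ 2) * stj2 s beta x + 2 * x * h.
  by apply: le_trans Jb; rewrite lerDl mulr_ge0// ltW.
move: fh q0 Ja Jb; move: f h (stj2 s alpha x) (stj2 s beta x) (1 - x ^+ 2).
move=> f h A B q fh q0 Ja Jb.
have amgm : (- (f * h) * 4 * q) <= (1 + q * - (f * h)) ^+ 2.
  by have := sqr_ge0 (1 - q * - (f * h)); nra.
pose p := Num.sg f.
(* The two Jensen inequalities are weighted by |h| and |f|; as f and h have opposite signs, the
   terms in [x] cancel in the sum. *)
have key : (f - h) ^+ 2 * (1 + q * - (f * h)) ^+ 2 <
    (2 * q * (f * B - h * A)) ^+ 2.
  rewrite -exprMn.
  have pos : 0 < 1 + q * - (f * h) by nra.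
  have [f0|f0|f0] := ltrgtP f 0; last by move: fh; rewrite f0 mul0r ltxx.
    have h0 : 0 < h by nra.
    have t1 : h * (1 + q * f ^+ 2) < h * (2 * q * A + 2 * x * f).
      by rewrite ltr_pM2l.
    have t2 : - f * (1 + q * h ^+ 2) <= - f * (2 * q * B + 2 * x * h).
      by rewrite ler_wpM2l//; lra.
    have t3 : (h - f) * (1 + q * - (f * h)) < 2 * q * (h * A - f * B) by nra.
    have -> : ((f - h) * (1 + q * - (f * h))) ^+ 2 =
      ((h - f) * (1 + q * - (f * h))) ^+ 2 by ring.
    have -> : (2 * q * (f * B - h * A)) ^+ 2 = (2 * q * (h * A - f * B)) ^+ 2 by ring.
    have t4 : 0 <= (h - f) * (1 + q * - (f * h)) by rewrite mulr_ge0 ?ltW//; lra.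
    by rewrite ltr_pXn2r ?nnegrE// (le_trans t4)// ltW.
  have h0 : h < 0 by nra.
  have t1 : - h * (1 + q * f ^+ 2) < - h * (2 * q * A + 2 * x * f).
    by rewrite ltr_pM2l//; lra.
  have t2 : f * (1 + q * h ^+ 2) <= f * (2 * q * B + 2 * x * h).
    by rewrite ler_wpM2l// ltW.
  have t3 : (f - h) * (1 + q * - (f * h)) < 2 * q * (f * B - h * A) by nra.
  have t4 : 0 <= (f - h) * (1 + q * - (f * h)) by rewrite mulr_ge0 ?ltW//; lra.
  by rewrite ltr_pXn2r ?nnegrE// (le_trans t4)// ltW.
rewrite -(ltr_pM2l (_ : 0 < 4 * q)); last by rewrite mulr_gt0.
have -> : 4 * q * (q * (f * B - h * A) ^+ 2) = (2 * q * (f * B - h * A)) ^+ 2 by ring.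
apply: le_lt_trans key.
have -> : 4 * q * (- (f * h) * (f - h) ^+ 2) = (f - h) ^+ 2 * (- (f * h) * 4 * q) by ring.
by rewrite ler_wpM2l// sqr_ge0.
Qed.

End RealBranches.

(** * Sign changes of the numerators *)

Section SignChanges.
Context {R : realType}.
Implicit Types (p : {poly R}) (s : seq R) (w : R -> R) (x t : R).

Lemma poly_next_zero p x r : x < r -> p.[x] < 0 -> 0 <= p.[r] ->
  exists b, [/\ x < b, b <= r, p.[b] = 0 & forall t, x <= t -> t < b -> p.[t] < 0].
Proof.
move=> xr px pr.
pose S := `[x, r]%classic `&` (horner p @^-1` [set y | 0 <= y]).
have S0 : S !=set0 by exists r; split => //=; rewrite in_itv /= lexx ltW.
have cS : compact S.
  apply: compact_closedI; first exact: segment_compact.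
  by apply: closed_comp; [move=> t _; exact: continuous_horner | exact: closed_ge].
have [] := @compact_EVT_min _ R id S S0 cS; first by apply: continuous_subspaceT => t; exact: cvg_id.
move=> b /set_mem[/=]; rewrite in_itv /= => /andP[xb br] pb mb.
have nb t : x <= t -> t < b -> p.[t] < 0.
  move=> xt tb; rewrite ltNge; apply/negP => pt.
  have : t \in S.
    by apply/mem_set; split => //=; rewrite in_itv /= xt (le_trans (ltW tb)).
  by move=> /mb; rewrite leNgt tb.
have {}xb : x < b.
  by rewrite lt_neqAle xb andbT; apply/eqP => xE; move: px; rewrite xE ltNge pb.
exists b; split => //.
have [|c] := @polyrcf.poly_ivt R p x b (ltW xb); first by rewrite nmulr_rle0.
rewrite in_itv /= => /andP[xc cb] /eqP pc.
suff -> : b = c by [].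
apply/eqP; rewrite eq_le cb andbT leNgt; apply/negP => /(nb c xc).
by rewrite pc ltxx.
Qed.

Lemma poly_prev_zero p x l : l < x -> p.[x] < 0 -> 0 <= p.[l] ->
  exists a, [/\ a < x, l <= a, p.[a] = 0 & forall t, t <= x -> a < t -> p.[t] < 0].
Proof.
move=> lx px pl; pose q := p \Po (- 'X).
have qE t : q.[t] = p.[- t] by rewrite horner_comp hornerN hornerX.
have [|||b [xb bl qb nq]] := @poly_next_zero q (- x) (- l).
- by rewrite ltrN2.
- by rewrite qE opprK.
- by rewrite qE opprK.
exists (- b); split; rewrite -?qE//; [by rewrite ltrNl|by rewrite lerNr|].
move=> t tx bt; rewrite -(opprK t) -qE; apply: nq; first by rewrite lerN2.
by rewrite ltrNl.
Qed.

Lemma poly_same_sign p x : p.[x] != 0 -> exists2 e : R, 0 < e &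
  forall t, `|t - x| < e -> 0 < p.[x] * p.[t].
Proof.
move=> px.
have : 0 < (p.[x] *: p).[x] by rewrite hornerZ -expr2 exprn_even_gt0.
have /cvgrPdist_lt := @continuous_horner R (p.[x] *: p) x.
move=> /[swap] p0 /(_ _ p0) /nbhs_normP[e /= e0 ep].
exists e => // t te; have := ep t; rewrite /= distrC => /(_ te).
by rewrite ltr_norml !hornerZ; lra.
Qed.

Lemma seq_isolated s x : exists2 e : R, 0 < e &
  forall k, k \in s -> k != x -> e <= `|k - x|.
Proof.
elim: s => [|k s [e e0 IH]]; first by exists 1.
have [->|kx] := eqVneq k x.
  by exists e => // j; rewrite inE => /orP[/eqP->|]; [rewrite eqxx|exact: IH].
exists (Num.min e `|k - x|); first by rewrite lt_min e0 normr_gt0 subr_eq0.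
move=> j; rewrite inE ge_min => /orP[/eqP->|js jx]; first by rewrite lexx orbT.
by rewrite (IH j js jx).
Qed.

(* At a zero of one transform that is not a common zero, the product of the two
   is negative on one side. *)
Lemma spoly_side s w1 w2 x : uniq s -> weights s w1 -> weights s w2 ->
  (spoly s w2).[x] = 0 -> (spoly s w1).[x] != 0 ->
  exists2 e : R, 0 < e &
    (forall t, x < t -> t < x + e -> (spoly s w1).[t] * (spoly s w2).[t] < 0) \/
    (forall t, x - e < t -> t < x -> (spoly s w1).[t] * (spoly s w2).[t] < 0).
Proof.
move=> us W1 W2 F2 F1; have [e0 e00 iso] := seq_isolated s x.
have [_ w10 _] := W1; have [_ w20 _] := W2.
have fresh t : t != x -> `|t - x| < e0 -> t \notin s.
  by move=> tx te; apply/negP => /iso/(_ tx); rewrite leNgt te.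
have dec x1 x2 : x - e0 < x1 -> x1 < x2 -> x2 < x + e0 ->
    (x \in s -> w2 x = 0) -> (x \notin s -> true) -> stj s w2 x2 < stj s w2 x1.
  move=> h1 h12 h2 w2x _; apply: stj_decr => // k ks wk; apply/negP => /andP[l1 l2].
  have [kx|kx] := eqVneq k x; first by move: wk; rewrite kx w2x ?ltxx// -kx.
  by have := iso k ks kx; rewrite leNgt ltr_norml; case/negP; apply/andP; split; lra.
(* At a pole [x] the second measure has no mass and the pole of the first transform leaves a factor
   t - x, so the sign of the second transform at [x] selects the side. Off the poles the second
   transform decreases through 0 and the sign of the rest selects it. *)
have [xs|xs] := boolP (x \in s).
  have c0 := cofactor_neq0 s x.
  have w2x : w2 x = 0.
    by move: F2; rewrite spoly_pole// => /eqP; rewrite mulf_eq0 (negbTE c0) orbF => /eqP.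
  have w1x : 0 < w1 x.
    move: F1; rewrite spoly_pole// mulf_eq0 negb_or => /andP[w1x _].
    by rewrite lt_neqAle eq_sym w1x w10.
  pose P := spoly s w1 * pole_cofactor s x.
  have Px : 0 < P.[x].
    by rewrite /P hornerM spoly_pole// -mulrA mulr_gt0// -expr2 exprn_even_gt0.
  have [e1 e10 sg] := poly_same_sign (lt0r_neq0 Px).
  have prodE t : t != x -> `|t - x| < e0 -> (spoly s w1).[t] * (spoly s w2).[t] =
      P.[t] * ((t - x) * stj s w2 t).
    move=> tx te; rewrite (spoly_stj w2 us (fresh t tx te)) (pole_polyE us xs).
    by rewrite /P !hornerM hornerXsubC; ring.
  have Pt t : `|t - x| < e1 -> 0 < P.[t] by move=> /sg; rewrite pmulr_rgt0.
  exists (Num.min e0 e1); first by rewrite lt_min e00.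
  have [h0|h0] := leP 0 (stj s w2 x).
    right => t; rewrite ltrBlDr -ltrBlDl => t1 t2.
    have [te0 te1] : `|t - x| < e0 /\ `|t - x| < e1.
      by rewrite ler0_norm; [move: t1; rewrite lt_min opprB => /andP[]|lra].
    rewrite prodE ?lt_eqF// pmulr_rlt0 ?Pt// nmulr_rlt0; last by lra.
    apply: le_lt_trans h0 _; apply: dec => //; last by lra.
    by move: te0; rewrite ltr_norml; lra.
  left => t t1; rewrite -ltrBlDl => t2.
  have [te0 te1] : `|t - x| < e0 /\ `|t - x| < e1.
    by rewrite ger0_norm; [move: t2; rewrite lt_min => /andP[]|lra].
  rewrite prodE ?gt_eqF// pmulr_rlt0 ?Pt// pmulr_rlt0; last by lra.
  apply: lt_trans h0; apply: dec => //; first by lra.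
  by move: te0; rewrite ltr_norml; lra.
have W0 := pole_poly_neq0 xs.
have h0 : stj s w2 x = 0.
  by move: F2; rewrite spoly_stj// => /eqP; rewrite mulf_eq0 (negbTE W0) => /eqP.
pose P := spoly s w1 * pole_poly s.
have Px : P.[x] != 0 by rewrite /P hornerM mulf_neq0.
have [e1 e10 sg] := poly_same_sign Px.
have prodE t : t != x -> `|t - x| < e0 -> (spoly s w1).[t] * (spoly s w2).[t] =
    P.[t] * stj s w2 t.
  by move=> tx te; rewrite (spoly_stj w2 us (fresh t tx te)) /P hornerM; ring.
exists (Num.min e0 e1); first by rewrite lt_min e00.
have [P0|P0|P0] := ltrgtP 0 P.[x]; last by rewrite P0 eqxx in Px.
  left => t t1; rewrite -ltrBlDl => t2.
  have [te0 te1] : `|t - x| < e0 /\ `|t - x| < e1.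
    by rewrite ger0_norm; [move: t2; rewrite lt_min => /andP[]|lra].
  have := sg t te1; rewrite pmulr_rgt0// => Pt.
  rewrite prodE ?gt_eqF// pmulr_rlt0// -h0; apply: dec => //; first by lra.
    by move: te0; rewrite ltr_norml; lra.
  by rewrite (negbTE xs).
right => t; rewrite ltrBlDr -ltrBlDl => t1 t2.
have [te0 te1] : `|t - x| < e0 /\ `|t - x| < e1.
  by rewrite ler0_norm; [move: t1; rewrite lt_min opprB => /andP[]|lra].
have := sg t te1; rewrite nmulr_rgt0// => Pt.
rewrite prodE ?lt_eqF// nmulr_rlt0// -h0; apply: dec => //; last 2 first.
- by lra.
- by rewrite (negbTE xs).
by move: te0; rewrite ltr_norml; lra.
Qed.

Lemma size_spoly s w : (size (spoly s w) <= size s)%N.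
Proof.
rewrite /spoly (leq_trans (size_sum _ _ _))//; apply/bigmax_leqP_seq => k ks _.
rewrite (leq_trans (size_scale_leq _ _))// /pole_cofactor -big_filter.
rewrite size_prod_XsubC size_filter.
rewrite -(count_predC (fun j => j != k) s).
by rewrite -addn1 leq_add2l -has_count; apply/hasP; exists k => //=; rewrite negbK.
Qed.

(** X/(X - k) = 1 + k/(X - k), and the constants cancel when the weights sum to 0. Together with
    [size_spoly], each use lowers the degree bound by one. *)
Lemma mulX_spoly s w : uniq s -> \sum_(k <- s) w k = 0 ->
  'X * spoly s w = spoly s (fun k => w k * k).
Proof.
move=> us w0; rewrite -[RHS]addr0 -(scale0r (pole_poly s)) -w0 /spoly scaler_suml.
rewrite mulr_sumr -big_split /= big_seq [RHS]big_seq; apply: eq_bigr => k ks.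
rewrite (pole_polyE us ks) -!mul_polyC polyCM.
by ring.
Qed.

End SignChanges.

(** * The map (f + h) / (f - h) *)

Section PairMap.
Context {R : realType}.
Local Notation sphere := (sphere R).
Implicit Types (x y t k : R) (nu : R[i]) (z : sphere).

Definition unit_segment : set sphere :=
  [set z | exists2 y : R, -1 <= y <= 1 & z = Some y%:C].

Lemma continuous_real_point : continuous (fun x : R => Some x%:C : sphere).
Proof. by move=> x A nA; exact: (@continuous_of_real R x (Some @^-1` A) nA). Qed.

Lemma unit_segment_closed : closed unit_segment.
Proof.
apply: (compact_closed (@hausdorff_sphere R)).
have -> : unit_segment = (fun x : R => Some x%:C : sphere) @` `[-1, 1]%classic.
  by apply/seteqP; split => z [y] yI; [move=> ->|move=> <-]; exists y;
    rewrite //= ?in_itv // in yI *.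
apply: continuous_compact; last exact: segment_compact.
by apply: continuous_subspaceT; exact: continuous_real_point.
Qed.

Lemma unit_segmentP nu : unit_segment (Some nu) <-> on_segment nu.
Proof.
split=> [[y yI [->]]//|[Im0 ReI]].
by exists (complex.Re nu) => //; congr Some; apply/eqP; rewrite eq_complex /= Im0 !eqxx.
Qed.

Lemma horner_spolyC (s : seq R) (w : R -> R) nu : uniq s ->
  (forall k, k \in s -> nu != k%:C) ->
  (map_poly (real_complex R) (spoly s w)).[nu] =
  (map_poly (real_complex R) (pole_poly s)).[nu] * cstj s w nu.
Proof.
move=> us ns; rewrite /spoly /cstj rmorph_sum /= horner_sum mulr_sumr.
rewrite big_seq [RHS]big_seq; apply: eq_bigr => k ks.
rewrite map_polyZ hornerZ (pole_polyE us ks) rmorphM hornerM /=.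
rewrite map_polyXsubC hornerXsubC.
have nk : nu - k%:C != 0 by rewrite subr_eq0 ns.
by field.
Qed.

Lemma horner_pole_polyC (s : seq R) nu : (forall k, k \in s -> nu != k%:C) ->
  (map_poly (real_complex R) (pole_poly s)).[nu] != 0.
Proof.
move=> ns; rewrite /pole_poly rmorph_prod /= horner_prod prodf_seq_neq0.
by apply/allP => k ks; rewrite /= map_polyXsubC hornerXsubC subr_eq0 ns.
Qed.

Definition pair_num s alpha beta : {poly R[i]} :=
  map_poly (real_complex R) (spoly s alpha + spoly s beta).

Definition pair_den s alpha beta : {poly R[i]} :=
  map_poly (real_complex R) (spoly s alpha - spoly s beta).

(** At a common zero of f and h the quotient reads 0/0. [pair_deriv] gives the value of the
    continuous extension, which is needed to see that such real points leave the segment. *)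
Record pair_map s alpha beta (G : sphere -> sphere) : Prop := PairMap {
  pair_stieltjes : stieltjes_pair s alpha beta;
  pair_continuous : continuous G;
  pair_infty : G None = None;
  pair_hcoord : forall nu,
    ((pair_num s alpha beta).[nu], (pair_den s alpha beta).[nu]) != (0, 0) ->
    G (Some nu) = hcoord (pair_num s alpha beta).[nu] (pair_den s alpha beta).[nu];
  pair_deriv : forall nu,
    (pair_num s alpha beta).[nu] = 0 -> (pair_den s alpha beta).[nu] = 0 ->
    ((pair_num s alpha beta)^`().[nu], (pair_den s alpha beta)^`().[nu]) != (0, 0) ->
    G (Some nu) =
      hcoord (pair_num s alpha beta)^`().[nu] (pair_den s alpha beta)^`().[nu] }.

Variables (s : seq R) (alpha beta : R -> R) (G : sphere -> sphere).
Hypothesis HG : pair_map s alpha beta G.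
Let A := pair_num s alpha beta.
Let B := pair_den s alpha beta.
Let H := pair_stieltjes HG.
Let G_infty := pair_infty HG.
Let G_hcoord := pair_hcoord HG.

Let us := stj_uniq H.
Let wa := stj_weightsl H.
Let wb := stj_weightsr H.

Let off_pole nu k : ~ on_segment nu -> k \in s -> nu != k%:C.
Proof.
move=> nseg ks; apply/eqP => nuE; apply: nseg; rewrite nuE; split => //=.
by have [sI _ _] := wa; exact: sI.
Qed.

Lemma G_off_segment nu : ~ on_segment nu ->
  let f := cstj s alpha nu in let h := cstj s beta nu in
  G (Some nu) = hcoord (f + h) (f - h).
Proof.
move=> nseg f h; have ns k := @off_pole nu k nseg.
have W0 := horner_pole_polyC ns.
have [c _ /(_ nu nseg) [f0 h0 _]] := cstj_growth H.
have AE : A.[nu] = (map_poly (real_complex R) (pole_poly s)).[nu] * (f + h).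
  by rewrite /A /pair_num rmorphD hornerD !horner_spolyC// mulrDr.
have BE : B.[nu] = (map_poly (real_complex R) (pole_poly s)).[nu] * (f - h).
  by rewrite /B /pair_den rmorphB hornerD hornerN !horner_spolyC// mulrBr.
rewrite G_hcoord AE BE ?hcoordM// xpair_eqE negb_and !mulf_eq0 !(negbTE W0) /=.
rewrite -negb_and; apply/negP => /andP[/eqP p /eqP q].
have : f + h + (f - h) = 0 by rewrite p q addr0.
have -> : f + h + (f - h) = 2 * f by ring.
by move/eqP; rewrite mulf_eq0 pnatr_eq0 /= (negbTE f0).
Qed.

(* [beyond l z]: z lies outside the ellipse with foci -1, 1 and axis l. *)
Definition beyond (l : R) z : Prop := if z is Some nu then l <= ell nu else True.

Lemma beyond_le l l' z : l <= l' -> beyond l' z -> beyond l z.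
Proof. by case: z => //= nu; exact: le_trans. Qed.

Lemma beyond_segment l z : 2 < l -> beyond l z -> ~ unit_segment z.
Proof.
by move=> l2 bz [y yI zE]; move: bz; rewrite zE /= ell_real// leNgt l2.
Qed.

Lemma segment_beyond z : ~ unit_segment z -> exists2 l, 2 < l & beyond l z.
Proof.
case: z => [nu /unit_segmentP nseg|_]; last by exists 3 => //; rewrite ltr_nat.
by exists (ell nu) => /=; [exact: ell_gt2|].
Qed.

Lemma beyond_ell nu : 2 < ell nu -> ~ on_segment nu.
Proof.
move=> l2 /unit_segmentP; apply: (beyond_segment l2); exact: lexx.
Qed.

(** The growth factor is uniform only for levels in a bounded range, since the gain fades both at
    the segment and at infinity. *)
Lemma G_beyond_step l1 l2 : 2 < l1 -> exists2 eps : R, 0 < eps & forall z l,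
  l1 <= l -> l <= l2 -> beyond l z -> beyond (l * (1 + eps)) (G z).
Proof.
move=> l12; have [c c0 growth] := cstj_growth H.
have [l2l|l1l] := ltP l2 l1.
  by exists 1 => // z l h1 /(le_trans h1); rewrite leNgt l2l.
have l20 : 0 < l2 by lra.
(* Points with [ell] at least [L] already exceed l (1 + eps) because eps <= 1, so monotonicity
   suffices for them. *)
pose L := l2 * 2.
have L0 : 0 < L by rewrite /L; lra.
pose d := c * (l1 ^+ 2 - 4) ^+ 3 / L ^+ 8.
have d0 : 0 < d.
  rewrite divr_gt0 ?exprn_gt0// mulr_gt0// exprn_gt0//.
  by rewrite subr_gt0; nra.
(* For eps <= 1 one has (1 + eps)^2 <= 1 + 3 eps <= 1 + d. *)
pose eps := Num.min 1 (d / 3).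
have e0 : 0 < eps by rewrite lt_min ltr01 divr_gt0.
exists eps => // -[nu|] l h1 h2 /=; last by rewrite G_infty.
move=> lnu; have l2nu : 2 < ell nu by lra.
have nseg := beyond_ell l2nu.
have [f0 h0 gr] := growth _ nseg.
rewrite (G_off_segment nseg) /hcoord subr_eq0.
have [//|fh] := eqVneq; rewrite /=; have {gr} := gr fh.
move: (ell (_ / _)) (ell_ge0 ((cstj s alpha nu + cstj s beta nu) / (cstj s alpha nu - cstj s beta nu))) => m m0 gr.
have lnu0 : 0 < ell nu by lra.
have mono : ell nu <= m.
  rewrite -(@ler_pXn2r _ 2) ?nnegrE ?(ltW lnu0)//; apply: le_trans gr.
  rewrite ler_pMr ?exprn_gt0// lerDl divr_ge0 ?exprn_ge0 ?ltW//.
  by rewrite mulr_gt0// exprn_gt0// subr_gt0; nra.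
have eps1 : eps <= 1 by rewrite ge_min lexx.
have [big|small] := leP L (ell nu).
  apply: le_trans mono; apply: le_trans big; rewrite /L.
  by apply: ler_pM => //; lra.
have eps3 : eps <= d / 3 by rewrite ge_min lexx orbT.
rewrite -(@ler_pXn2r _ 2) ?nnegrE//; last by rewrite mulr_ge0//; lra.
apply: le_trans gr; rewrite exprMn; apply: ler_pM.
- exact: sqr_ge0.
- exact: sqr_ge0.
- by rewrite ler_pXn2r ?nnegrE//; lra.
apply: (@le_trans _ _ (1 + d)).
  have : eps * eps <= eps * 1 by rewrite ler_pM2l.
  by nra.
rewrite lerD2l /d; apply: ler_pM.
- by rewrite mulr_ge0 ?ltW// exprn_gt0// subr_gt0; nra.
- by rewrite invr_ge0 exprn_ge0// ltW.
- have q1 : 0 <= l1 ^+ 2 - 4 by nra.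
  have q2 : 0 <= ell nu ^+ 2 - 4 by nra.
  rewrite ler_pM2l// ler_pXn2r ?nnegrE//.
  by rewrite lerD2r; nra.
by rewrite lef_pV2 ?posrE ?exprn_gt0//; apply: lerXn2r; rewrite ?nnegrE; exact: ltW.
Qed.

Lemma G_beyond l z : 2 < l -> beyond l z -> beyond l (G z).
Proof.
move=> l2; have [e e0 /(_ z l (lexx _) (lexx _))] := @G_beyond_step l l l2.
move=> h /h; apply: beyond_le; rewrite ler_peMr//; lra.
Qed.

Lemma iter_G_beyond l n z : 2 < l -> beyond l z -> beyond l (iter n G z).
Proof. by move=> l2 lz; elim: n => //= n; exact: G_beyond. Qed.

(** Geometric growth up to level [l2]. The time [N] does not depend on the point, which is what
    uniform convergence of the iterates needs. *)
Lemma G_escape l1 l2 : 2 < l1 -> exists N, forall n z, (N <= n)%N ->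
  beyond l1 z -> beyond l2 (iter n G z).
Proof.
move=> h; have [e e0 step] := G_beyond_step l2 h.
have grow n z : beyond l1 z -> beyond (Num.min l2 (l1 * (1 + e) ^+ n)) (iter n G z).
  elim: n => [|n IH] bz.
    by apply: beyond_le bz; rewrite expr0 mulr1 ge_min lexx orbT.
  have {}IH := IH bz; rewrite iterS.
  have pow : l1 <= l1 * (1 + e) ^+ n by rewrite ler_peMr ?exprn_ege1//; lra.
  have [le|lt] := leP l2 (l1 * (1 + e) ^+ n).
    have l1l2 := @G_beyond (Num.max l1 l2) (iter n G z).
    apply: (@beyond_le _ (Num.max l1 l2)); first by rewrite ge_min le_max lexx orbT.
    apply: l1l2; first by rewrite lt_max h.
    have := iter_G_beyond n h bz; move: IH; rewrite (min_idPl le).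
    by case: (iter n G z) => //= nu b1 b2; rewrite ge_max b1 b2.
  move: IH; rewrite (min_idPr (ltW lt)) => /(step _ _ pow (ltW lt)).
  by apply: beyond_le; rewrite exprSr mulrA ge_min lexx orbT.
pose N := Num.bound `|l2 / e|.
exists N => n z Nn bz; apply: beyond_le (grow n z bz).
rewrite le_min lexx /=.
have l10 : 1 <= l1 by lra.
have : l2 <= n%:R * e.
  rewrite -ler_pdivrMr//; apply: le_trans (_ : N%:R <= _); last by rewrite ler_nat.
  apply: le_trans (ler_norm _) _; exact/ltW/archi_boundP/normr_ge0.
have bern : 1 + n%:R * e <= (1 + e) ^+ n.
  elim: n {Nn} => [|n IH]; first by rewrite mul0r addr0 expr0.
  rewrite exprS -natr1; have := ler_wpM2l (_ : 0 <= 1 + e) IH.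
  have : 0 <= n%:R * (e * e) by rewrite mulr_ge0 ?mulr_ge0// ltW.
  by move=> ? /(_ _) h'; have := h' ltac:(lra); nra.
move=> h2; apply: (@le_trans _ _ ((1 + e) ^+ n)); first by lra.
by rewrite ler_peMl// exprn_ge0//; lra.
Qed.

Lemma G_segment_pre z : unit_segment (G z) -> unit_segment z.
Proof.
move=> Gz; apply: contrapT => /segment_beyond[l l2 /(G_beyond l2)].
by move=> /(beyond_segment l2).
Qed.

End PairMap.

(** * The map on the real segment and its branches *)

Section PairDynamics.
Context {R : realType}.
Local Notation sphere := (sphere R).
Implicit Types (x y t k : R) (z : sphere).

Lemma poly_const_sign (p : {poly R}) a b :
  (forall t, a < t < b -> p.[t] != 0) ->
  (forall t, a < t < b -> 0 < p.[t]) \/ (forall t, a < t < b -> p.[t] < 0).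
Proof.
move=> p0.
have same t u : a < t < b -> a < u < b -> t <= u -> 0 < p.[t] * p.[u].
  move=> tI uI tu; rewrite lt_neqAle eq_sym mulf_neq0 ?p0//= leNgt.
  apply/negP => /(polyrcf.poly_ivtoo tu) [c]; rewrite in_itv /= => /andP[tc cu].
  apply/negP/p0; case/andP: tI uI => at_ _ /andP[_ ub].
  by rewrite (lt_trans at_ tc) (lt_trans cu ub).
have [ab|ba] := ltP a b; last first.
  by left => t /andP[at_ tb]; have := lt_trans at_ tb; rewrite ltNge ba.
pose c := (a + b) / 2; have cI : a < c < b by rewrite /c; apply/andP; split; lra.
have pc := p0 _ cI.
have sg t : a < t < b -> 0 < p.[c] * p.[t].
  by move=> tI; have [ct|tc] := leP c t; [exact: same|rewrite mulrC same// ltW].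
have [c0|c0|c0] := ltrgtP 0 p.[c]; last by rewrite c0 eqxx in pc.
  by left => t /sg; rewrite pmulr_rgt0.
by right => t /sg; rewrite nmulr_rgt0.
Qed.

Lemma asin_within : {within `[-1, 1], continuous (@asin R)}.
Proof.
have pi2 : - (pi / 2) <= pi / 2 :> R by have := pi_gt0 R; lra.
have := @segment_can_le_continuous R (- (pi / 2)) (pi / 2) sin asin pi2.
rewrite sinN sin_pihalf; apply; first by apply: continuous_subspaceT => x; exact: continuous_sin.
exact: sinK.
Qed.

Lemma asin_comp_within (q : R -> R) a b :
  (forall x, a <= x <= b -> {for x, continuous q}) ->
  (forall x, a <= x <= b -> -1 <= q x <= 1) ->
  {within `[a, b], continuous (asin \o q)}.
Proof.
move=> cq qI; apply/subspace_continuousP => x /=; rewrite in_itv /= => xI.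
have /subspace_continuousP/(_ (q x)) := asin_within.
rewrite /= in_itv /= => /(_ (qI _ xI)) ca U /ca [e /= e0 eU].
have /cvgrPdist_lt/(_ e e0) := cq x xI; apply: filterS => t /= qt.
rewrite in_itv /= => tI; apply: eU => //=.
by rewrite in_itv; exact: qI.
Qed.

Lemma asin_lt x y : -1 <= x -> x < y -> y <= 1 -> asin x < asin y.
Proof.
move=> x1 xy y1; rewrite ltNge; apply/negP => yx.
have xI : x \in `[-1, 1] by rewrite in_itv /= x1 (le_trans (ltW xy)).
have yI : y \in `[-1, 1] by rewrite in_itv /= y1 (le_trans x1 (ltW xy)).
have := xy; rewrite -(asinK xI) -(asinK yI) ltNge => /negP; apply.
have [b1 b2] : -(pi / 2) <= asin y /\ asin x <= pi / 2.
  by split; [apply: asin_geNpi2|apply: asin_lepi2]; rewrite in_itv in xI yI.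
have [e|lt] := eqVneq (asin y) (asin x); first by rewrite e.
apply/ltW; rewrite ltr_sin ?in_itv /= ?b1 ?b2 ?(le_trans b1) ?(le_trans _ b2)//.
by rewrite lt_neqAle lt.
Qed.

Variables (s : seq R) (alpha beta : R -> R) (G : sphere -> sphere).
Hypothesis HG : pair_map s alpha beta G.
Let H := pair_stieltjes HG.
Let us := stj_uniq H.
Let wa := stj_weightsl H.
Let wb := stj_weightsr H.
Let F1 := spoly s alpha.
Let F2 := spoly s beta.

Definition real_map x : R := (F1.[x] + F2.[x]) / (F1.[x] - F2.[x]).

Definition stays x : Prop := unit_segment (G (Some x%:C)).

Let num_at_real x : (pair_num s alpha beta).[x%:C] = (F1.[x] + F2.[x])%:C.
Proof. by rewrite /pair_num horner_map hornerD. Qed.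

Let den_at_real x : (pair_den s alpha beta).[x%:C] = (F1.[x] - F2.[x])%:C.
Proof. by rewrite /pair_den horner_map hornerD hornerN. Qed.

Let sum_diff0 (a b : R) : (a + b == 0) && (a - b == 0) = (a == 0) && (b == 0).
Proof.
apply/idP/idP => /andP[/eqP h1 /eqP h2]; apply/andP; split; apply/eqP; lra.
Qed.

Lemma G_real x : (F1.[x], F2.[x]) != (0, 0) ->
  G (Some x%:C) = hcoord (F1.[x] + F2.[x])%:C (F1.[x] - F2.[x])%:C.
Proof.
move=> F0; rewrite (pair_hcoord HG) ?num_at_real ?den_at_real//.
by rewrite xpair_eqE !fmorph_eq0 sum_diff0 -xpair_eqE.
Qed.

Lemma common_zero x : F1.[x] = 0 -> F2.[x] = 0 ->
  [/\ x \notin s, stj s alpha x = 0 & stj s beta x = 0].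
Proof.
move=> f0 h0; have xs : x \notin s.
  apply/negP => xs; have := stj_pole H xs; have c0 := cofactor_neq0 s x.
  move: f0 h0; rewrite /F1 /F2 !spoly_pole// => /eqP + /eqP.
  rewrite !mulf_eq0 (negbTE c0) !orbF => /eqP -> /eqP ->.
  by rewrite addr0 ltxx.
have W0 := pole_poly_neq0 xs; move: f0 h0; rewrite /F1 /F2 !spoly_stj//.
by move=> /eqP + /eqP; rewrite !mulf_eq0 (negbTE W0) /= => /eqP ? /eqP ?.
Qed.

(** |(a + b) / (a - b)| <= 1 amounts to a b <= 0. At a common zero both transforms have negative
    derivatives, so the derivatives of the numerators have the same sign and the value falls outside
    the segment. *)
Lemma staysP x : stays x <->
  (F1.[x], F2.[x]) != (0, 0) /\ F1.[x] * F2.[x] <= 0.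
Proof.
rewrite /stays; split.
  have [/eqP|F0] := eqVneq (F1.[x], F2.[x]) (0, 0).
    rewrite xpair_eqE => /andP[/eqP f0 /eqP h0] seg; exfalso.
    have [xs fz hz] := common_zero f0 h0.
    have W0 := pole_poly_neq0 xs.
    have dF1 : F1^`().[x] = - ((pole_poly s).[x] * stj2 s alpha x).
      by rewrite /F1 deriv_spoly// fz mulr0 sub0r.
    have dF2 : F2^`().[x] = - ((pole_poly s).[x] * stj2 s beta x).
      by rewrite /F2 deriv_spoly// hz mulr0 sub0r.
    have pos : 0 < F1^`().[x] * F2^`().[x].
      rewrite dF1 dF2 mulrNN mulrACA -expr2.
      by rewrite mulr_gt0 ?exprn_even_gt0// mulr_gt0// stj2_gt0.
    have dA : (pair_num s alpha beta)^`().[x%:C] = (F1^`().[x] + F2^`().[x])%:C.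
      by rewrite /pair_num deriv_map horner_map derivD hornerD.
    have dB : (pair_den s alpha beta)^`().[x%:C] = (F1^`().[x] - F2^`().[x])%:C.
      by rewrite /pair_den deriv_map horner_map derivB hornerD hornerN.
    move: seg; rewrite (pair_deriv HG) ?num_at_real ?den_at_real ?f0 ?h0 ?addr0 ?subr0//;
      rewrite dA dB.
      rewrite /hcoord fmorph_eq0 => -[y /andP[y1 y2]].
      case: eqP => // /eqP d0 /Some_inj/esym; rewrite -fmorph_div => /complexI yE.
      move: y1 y2 pos d0; rewrite yE; move: (F1^`().[x]) (F2^`().[x]) => a b.
      move=> y1 y2 pos d0.
      have : ((a + b) / (a - b)) ^+ 2 <= 1 by nra.
      by rewrite expr_div_n ler_pdivrMr ?exprn_even_gt0// mul1r; nra.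
    rewrite xpair_eqE !fmorph_eq0 sum_diff0 negb_and; apply/orP; left.
    by apply: contraTneq pos => ->; rewrite mul0r ltxx.
  rewrite G_real// /hcoord fmorph_eq0 => -[y /andP[y1 y2]].
  case: eqP => // /eqP d0 /Some_inj/esym; rewrite -fmorph_div => /complexI yE.
  split => //; move: y1 y2 d0; rewrite yE; move: (F1.[x]) (F2.[x]) => a b y1 y2 d0.
  have : ((a + b) / (a - b)) ^+ 2 <= 1 by nra.
  by rewrite expr_div_n ler_pdivrMr ?exprn_even_gt0// mul1r; nra.
move=> [F0 neg]; rewrite G_real// /hcoord fmorph_eq0.
have d0 : F1.[x] - F2.[x] != 0.
  rewrite subr_eq0; apply: contraNneq F0 => e; move: neg.
  rewrite e -expr2 => h; have : F2.[x] ^+ 2 == 0 by rewrite eq_le h sqr_ge0.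
  by rewrite sqrf_eq0 => /eqP ->.
rewrite (negbTE d0); exists (real_map x); last by rewrite fmorph_div.
rewrite -ler_norml -[leRHS](@normr1 R) -ler_sqr ?nnegrE// !real_normK ?num_real//.
rewrite /real_map expr_div_n expr1n ler_pdivrMr ?exprn_even_gt0// mul1r.
by move: neg; move: (F1.[x]) (F2.[x]) => a b; nra.
Qed.

Lemma stays_den x : stays x -> F1.[x] - F2.[x] != 0.
Proof.
move=> /staysP[F0 neg]; rewrite subr_eq0; apply: contraNneq F0 => e; move: neg.
rewrite e -expr2 => h; have : F2.[x] ^+ 2 == 0 by rewrite eq_le h sqr_ge0.
by rewrite sqrf_eq0 => /eqP ->.
Qed.

Lemma stays_map x : stays x -> G (Some x%:C) = Some (real_map x)%:C.
Proof.
move=> sx; have d0 := stays_den sx; case/staysP: sx => F0 _.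
by rewrite G_real// /hcoord fmorph_eq0 (negbTE d0) fmorph_div.
Qed.

Lemma stays_itv x : stays x -> -1 <= x <= 1 /\ -1 <= real_map x <= 1.
Proof.
move=> sx; split.
  by have [y yI /Some_inj/complexI ->] := G_segment_pre HG sx.
by move: (sx); rewrite /stays stays_map// => -[y yI /Some_inj/complexI ->].
Qed.

Lemma continuous_real_map x : F1.[x] - F2.[x] != 0 -> {for x, continuous real_map}.
Proof.
move=> d0; apply: cvgM.
  by apply: cvgD; exact: continuous_horner.
by apply: cvgV => //; apply: cvgB; exact: continuous_horner.
Qed.

Lemma is_derive_real_map x : F1.[x] - F2.[x] != 0 ->
  is_derive x 1 real_map
   (2 * (F1.[x] * F2^`().[x] - F2.[x] * F1^`().[x]) / (F1.[x] - F2.[x]) ^+ 2).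
Proof.
move=> d0; pose A := F1 + F2; pose B := F1 - F2.
have BE t : B.[t] = F1.[t] - F2.[t] by rewrite hornerD hornerN.
have AE t : A.[t] = F1.[t] + F2.[t] by rewrite hornerD.
have -> : real_map = (horner A) * (fun t => (B.[t])^-1).
  by apply: funext => t; rewrite /real_map -AE -BE.
have B0 : B.[x] != 0 by rewrite BE.
have dV := @is_deriveV R (horner B) x _ 1 B0 (is_derive_poly B x).
have dM := @is_deriveM R _ _ _ x 1 _ _ (is_derive_poly A x) dV.
apply: is_derive_eq dM _; rewrite -[_ *: _]/(_ * _) -[X in _ + X]/(_ * _).
rewrite /A /B !derivD !derivN !hornerD !hornerN -![_ *: _]/(_ * _).
by field.
Qed.

(** [stj_expand] makes asin of the image move faster than asin of the point wherever f h < 0, and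
    integrating this gives the expansion. The endpoint values are 1 and -1 because one of the
    numerators vanishes there. *)
Lemma real_map_branch a b : -1 <= a -> a < b -> b <= 1 ->
  F1.[a] * F2.[a] = 0 -> F1.[b] * F2.[b] = 0 ->
  (forall t, a < t < b -> F1.[t] * F2.[t] < 0) -> branch asin real_map stays a b.
Proof.
move=> a1 ab b1 Za Zb Zlt.
have fresh t : a < t < b -> t \notin s.
  move=> /Zlt; apply: contraTN => ts; rewrite -leNgt /F1 /F2 !spoly_pole//.
  rewrite mulrACA -expr2 mulr_ge0 ?sqr_ge0// mulr_ge0//; first by case: wa.
  by case: wb.
have FE t : t \notin s -> F1.[t] * F2.[t] =
    (pole_poly s).[t] ^+ 2 * (stj s alpha t * stj s beta t).
  by move=> ts; rewrite /F1 /F2 !spoly_stj//; ring.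
(* Both transforms are decreasing; vanishing together at an endpoint they would have equal signs
   inside the interval, against f h < 0. *)
have noco x t : a < t < b -> F1.[x] = 0 -> F2.[x] = 0 ->
    (x = a) + (x = b) -> False.
  move=> tI f0 h0; have [xs fz hz] := common_zero f0 h0 => xab.
  have out k : k \in s -> ~~ (a <= k <= b) \/ (k = a \/ k = b).
    move=> ks; have [/andP[ak kb]|] := boolP (a <= k <= b); last by left.
    right; move: ak kb; rewrite !le_eqVlt => /orP[/eqP->|ak]; first by left.
    move=> /orP[/eqP->|kb]; first by right.
    by have := fresh k; rewrite ak kb ks => /(_ isT).
  have ts := fresh t tI; have := Zlt t tI; rewrite FE// ltNge => /negP; apply.
  rewrite mulr_ge0 ?sqr_ge0//; case/andP: tI => at_ tb.
  have ne k : k \in s -> k != x by move=> ks; apply: contraNneq xs => <-.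
  case: xab => xE.
    have d w : weights s w -> stj s w x = 0 -> stj s w t < 0.
      move=> ww <-; apply: stj_decr => //; first by rewrite xE.
      move=> k ks _; apply/negP => /andP[xk kt]; case: (out k ks).
        by rewrite -xE xk (le_trans kt (ltW tb)).
      by case=> kE; [have := ne k ks; rewrite kE xE eqxx|move: kt; rewrite kE leNgt tb].
    by rewrite mulr_le0 ?ltW ?d.
  have d w : weights s w -> stj s w x = 0 -> 0 < stj s w t.
    move=> ww <-; apply: stj_decr => //; first by rewrite xE.
    move=> k ks _; apply/negP => /andP[tk kx]; case: (out k ks).
      by rewrite -xE kx (le_trans (ltW at_) tk).
    by case=> kE; [move: tk; rewrite kE leNgt at_|have := ne k ks; rewrite kE xE eqxx].
  by rewrite mulr_ge0 ?ltW ?d.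
pose c := (a + b) / 2; have cI : a < c < b by rewrite /c; apply/andP; split; lra.
have st t : a <= t <= b -> stays t.
  move=> /andP[at_ tb]; apply/staysP.
  have [tI|] := boolP (a < t < b).
    have Zt := Zlt t tI; split; last exact: ltW.
    by apply: contraTneq Zt => -[-> ->]; rewrite mul0r ltxx.
  rewrite negb_and -!leNgt => tab.
  have tE : (t = a) + (t = b).
    have [ta|ta] := eqVneq t a; first by left.
    right; apply/eqP; rewrite eq_le tb; case/orP: tab => // ta'.
    by move: ta; rewrite eq_le ta' at_.
  split; last by case: tE => ->; rewrite ?Za ?Zb.
  apply/eqP => -[f0 h0]; exact: noco cI f0 h0 tE.
have ends t : (t = a) + (t = b) -> real_map t = 1 \/ real_map t = -1.
  move=> tE; have tI : a <= t <= b by case: tE => ->; rewrite lexx ltW.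
  have d0 := stays_den (st t tI).
  have : F1.[t] * F2.[t] = 0 by case: tE => ->.
  rewrite /real_map; move/eqP; rewrite mulf_eq0 => /orP[] /eqP z;
    move: d0; rewrite z ?add0r ?sub0r ?addr0 ?subr0 ?oppr_eq0 => d0.
    by right; rewrite invrN mulrN divff.
  by left; rewrite divff.
have cont : {within `[a, b], continuous real_map}.
  apply: continuous_in_subspaceT => t; rewrite inE /= in_itv /= => tI.
  exact/continuous_real_map/stays_den/st.
have cphi : {within `[a, b], continuous (asin \o real_map)}.
  apply: asin_comp_within => t tI; first exact/continuous_real_map/stays_den/st.
  by have [] := stays_itv (st t tI).
have cid : {within `[a, b], continuous (@asin R)}.
  apply: (@within_subitv R _ (-1) 1) => //; exact: asin_within.
pose D t := 2 * (F1.[t] * F2^`().[t] - F2.[t] * F1^`().[t]) /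
  (F1.[t] - F2.[t]) ^+ 2.
have DE t : a < t < b -> D t = 2 * (stj s beta t * stj2 s alpha t -
    stj s alpha t * stj2 s beta t) / (stj s alpha t - stj s beta t) ^+ 2.
  move=> tI; have ts := fresh t tI; have W0 := pole_poly_neq0 ts.
  have d0 : F1.[t] - F2.[t] != 0 by apply/stays_den/st; case/andP: tI => ? ?; rewrite !ltW.
  move: d0; rewrite /D /F1 /F2 !deriv_spoly// !spoly_stj// -mulrBr mulf_eq0.
  rewrite (negbTE W0) /= => d0.
  by field; rewrite d0 W0.
have strict t : a < t < b -> let q := real_map t in
   [/\ -1 < t < 1, -1 < q < 1 & 1 - q ^+ 2 < (1 - t ^+ 2) * D t ^+ 2].
  move=> tI q; have ts := fresh t tI; have W0 := pole_poly_neq0 ts.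
  have Zt := Zlt t tI; case/andP: (tI) => at_ tb.
  have tI1 : -1 < t < 1 by apply/andP; split; lra.
  have d0 : F1.[t] - F2.[t] != 0 by apply/stays_den/st; rewrite !ltW.
  have fh : stj s alpha t * stj s beta t < 0.
    by move: Zt; rewrite FE// pmulr_rlt0// exprn_even_gt0.
  have d1 : stj s alpha t - stj s beta t != 0.
    by move: d0; rewrite /F1 /F2 !spoly_stj// -mulrBr mulf_eq0 negb_or => /andP[].
  have qE : q = (stj s alpha t + stj s beta t) / (stj s alpha t - stj s beta t).
    rewrite /q /real_map /F1 /F2 !spoly_stj// -mulrBr -mulrDr -mulf_div divff//.
    by rewrite mul1r.
  have d2 : 0 < (stj s alpha t - stj s beta t) ^+ 2 by rewrite exprn_even_gt0.
  have q2 : 1 - q ^+ 2 = 4 * - (stj s alpha t * stj s beta t) /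
      (stj s alpha t - stj s beta t) ^+ 2 by rewrite qE; field.
  have q2pos : 0 < 1 - q ^+ 2 by rewrite q2 divr_gt0//; lra.
  split => //; first by apply/andP; split; nra.
  have := stj_expand H tI1 ts fh; rewrite q2 DE//.
  move: (stj s alpha t) (stj s beta t) (stj2 s alpha t) (stj2 s beta t) d2 d1.
  move=> f h A B d2 d1 ex; rewrite ltr_pdivrMr//.
  have -> : (1 - t ^+ 2) * (2 * (h * A - f * B) / (f - h) ^+ 2) ^+ 2 * (f - h) ^+ 2 =
      4 * ((1 - t ^+ 2) * (f * B - h * A) ^+ 2) / (f - h) ^+ 2 by field.
  by rewrite ltr_pdivlMr//; lra.
have dphi t : a < t < b -> is_derive t 1 (asin \o real_map)
    ((Num.sqrt (1 - real_map t ^+ 2))^-1 * D t).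
  move=> tI; have [_ qI _] := strict t tI.
  have d1 := is_derive1_asin qI.
  have d2 : is_derive t 1 real_map (D t).
    by apply: is_derive_real_map; apply/stays_den/st; case/andP: tI => ? ?; rewrite !ltW.
  exact: (is_derive1_comp d1 d2).
have speed t : a < t < b ->
    (Num.sqrt (1 - t ^+ 2))^-1 < (Num.sqrt (1 - real_map t ^+ 2))^-1 * `|D t|.
  move=> tI; have [/andP[t1 t2] /andP[q1 q2] ex] := strict t tI.
  have u0 : 0 < 1 - t ^+ 2 by nra.
  have v0 : 0 < 1 - real_map t ^+ 2 by nra.
  rewrite mulrC ltr_pdivlMr ?sqrtr_gt0// mulrC ltr_pdivrMr ?sqrtr_gt0//.
  rewrite -sqrtr_sqr -sqrtrM ?sqr_ge0// ltr_sqrt.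
    by rewrite mulrC.
  by apply: lt_trans v0 _; rewrite mulrC.
(* Where f h < 0 the sign of [D] is opposite to that of f, and [F1 * pole_poly s] has the sign of f
   and no zero in the interval. *)
have signD : (forall t, a < t < b -> D t < 0) \/ (forall t, a < t < b -> 0 < D t).
  have sg t : a < t < b -> 0 < (F1 * pole_poly s).[t] -> D t < 0.
    move=> tI; have ts := fresh t tI; have W0 := pole_poly_neq0 ts.
    rewrite hornerM /F1 spoly_stj// mulrAC -expr2 pmulr_rgt0 ?exprn_even_gt0// => f0.
    have := Zlt t tI; rewrite FE// pmulr_rlt0 ?exprn_even_gt0// pmulr_rlt0// => h0.
    have [_ _] := strict t tI; rewrite DE// => ex.
    have A0 := stj2_gt0 wa ts; have B0 := stj2_gt0 wb ts.
    rewrite pmulr_llt0 ?invr_gt0 ?exprn_even_gt0//=; last first.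
      by rewrite subr_eq0 gt_eqF// (lt_trans h0).
    by nra.
  have sg' t : a < t < b -> (F1 * pole_poly s).[t] < 0 -> 0 < D t.
    move=> tI; have ts := fresh t tI; have W0 := pole_poly_neq0 ts.
    rewrite hornerM /F1 spoly_stj// mulrAC -expr2 pmulr_rlt0 ?exprn_even_gt0// => f0.
    have := Zlt t tI; rewrite FE// pmulr_rlt0 ?exprn_even_gt0// nmulr_rlt0// => h0.
    have A0 := stj2_gt0 wa ts; have B0 := stj2_gt0 wb ts.
    rewrite DE// pmulr_lgt0 ?invr_gt0 ?exprn_even_gt0//=; last first.
      by rewrite subr_eq0 lt_eqF// (lt_trans f0).
    by nra.
  have nz t : a < t < b -> (F1 * pole_poly s).[t] != 0.
    move=> tI; rewrite hornerM mulf_neq0 ?pole_poly_neq0 ?fresh//.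
    by have := Zlt t tI; apply: contraTneq => ->; rewrite mul0r ltxx.
  have [h|h] := poly_const_sign nz; [left|right] => t tI.
    exact/sg/h.
  exact/sg'/h.
(* By the speed bound asin(G) + asin decreases if [D] is negative, and asin(G) - asin increases if
   [D] is positive. *)
have expand x y : a <= x -> x < y -> y <= b ->
    asin y - asin x < `|asin (real_map y) - asin (real_map x)|.
  move=> ax xy yb; case: signD => sD.
    have := @ltr0_derive1_lt_cc R ((asin \o real_map) + asin) a b.
    move=> /(_ _ _ _ y x) mono.
    have : asin (real_map y) + asin y < asin (real_map x) + asin x.
      apply: mono => //.
      - move=> t; rewrite in_itv /= => tI; have dt := dphi t tI.
        have [tI1 _ _] := strict t tI; have da := is_derive1_asin tI1.
        by apply: derivableD; [case: dt|case: da].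
      - move=> t; rewrite in_itv /= => tI; have dt := dphi t tI.
        have [tI1 _ _] := strict t tI; have da := is_derive1_asin tI1.
        rewrite derive1E deriveD; [|by case: dt|by case: da].
        rewrite (@derive_val _ _ _ _ _ _ _ dt) (@derive_val _ _ _ _ _ _ _ da).
        have := speed t tI; rewrite (ltr0_norm (sD t tI)) mulrN.
        by move: (_^-1) (_ * _) => p q; lra.
      - by move=> t; apply: cvgD; [exact: cphi|exact: cid].
      - by rewrite in_itv /= yb (le_trans ax (ltW xy)).
      - by rewrite in_itv /= ax (le_trans (ltW xy) yb).
    move=> lt; rewrite ltr_normr; apply/orP; right; lra.
  have := @gtr0_derive1_lt_cc R ((asin \o real_map) - asin) a b.
  move=> /(_ _ _ _ x y) mono.
  have : asin (real_map x) - asin x < asin (real_map y) - asin y.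
    apply: mono => //.
    - move=> t; rewrite in_itv /= => tI; have dt := dphi t tI.
      have [tI1 _ _] := strict t tI; have da := is_derive1_asin tI1.
      by apply: derivableB; [case: dt|case: da].
    - move=> t; rewrite in_itv /= => tI; have dt := dphi t tI.
      have [tI1 _ _] := strict t tI; have da := is_derive1_asin tI1.
      rewrite derive1E deriveB; [|by case: dt|by case: da].
      rewrite (@derive_val _ _ _ _ _ _ _ dt) (@derive_val _ _ _ _ _ _ _ da).
      by have := speed t tI; rewrite (gtr0_norm (sD t tI)) subr_gt0.
    - by move=> t; apply: cvgB; [exact: cphi|exact: cid].
    - by rewrite in_itv /= ax (le_trans (ltW xy) yb).
    - by rewrite in_itv /= yb (le_trans ax (ltW xy)).
  by move=> lt; rewrite ltr_normr; apply/orP; left; lra.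
split => //.
have ne : real_map a <> real_map b.
  move=> e; have := expand a b (lexx _) ab (lexx _).
  by rewrite e subrr normr0 subr_lt0 ltNge ltW// asin_lt.
by have [ea|ea] := ends a (inl erefl); have [eb|eb] := ends b (inr erefl);
  [case: ne; rewrite ea eb|right|left|case: ne; rewrite ea eb].
Qed.

End PairDynamics.

(** * The dichotomy for trapped points *)

Section PairDichotomy.
Context {R : realType}.
Local Notation sphere := (sphere R).
Variables (s : seq R) (alpha beta : R -> R) (G : sphere -> sphere).
Hypothesis HG : pair_map s alpha beta G.
Let H := pair_stieltjes HG.
Let us := stj_uniq H.
Let wa := stj_weightsl H.
Let wb := stj_weightsr H.
Let F1 := spoly s alpha.
Let F2 := spoly s beta.
Let g := real_map s alpha beta.

(** The product of the numerators is nonnegative at every pole, in particular at 1, and at -1, where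
    off the poles both transforms are nonpositive. So a point of negativity has a zero on either
    side within [-1, 1]. *)
Lemma real_map_zone x : (F1 * F2).[x] < 0 -> exists a b,
  [/\ branch asin g (stays G) a b, a < x < b, (F1 * F2).[a] = 0,
      (F1 * F2).[b] = 0 & forall t, a < t < b -> (F1 * F2).[t] < 0].
Proof.
move=> Zx; have [sI a0 _] := wa; have [_ b0 _] := wb.
have at_pole k : k \in s -> 0 <= (F1 * F2).[k].
  move=> ks; rewrite hornerM /F1 /F2 !spoly_pole// mulrACA -expr2.
  by rewrite mulr_ge0 ?sqr_ge0// mulr_ge0.
have Z1 : 0 <= (F1 * F2).[1] by apply: at_pole; exact: stj_one H.
have ZN1 : 0 <= (F1 * F2).[-1].
  have [|ns] := boolP (-1 \in s); first exact: at_pole.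
  rewrite hornerM /F1 /F2 !spoly_stj// mulrACA -expr2 mulr_ge0 ?sqr_ge0//.
  have neg w : weights s w -> stj s w (-1) <= 0.
    move=> [_ w0 _]; rewrite /stj big_seq; apply: sumr_le0 => k ks.
    rewrite mulr_ge0_le0// invr_le0 subr_le0.
    by have /andP[] := sI _ ks.
  by rewrite mulr_le0 ?neg.
have /(stays_itv HG)[/andP[x1 x2] _] : stays G x.
  apply/(staysP HG); rewrite -/F1 -/F2 -hornerM ltW//; split => //.
  by apply: contraTneq Zx => -[h1 h2]; rewrite hornerM h1 mul0r ltxx.
have xl1 : x < 1.
  by rewrite lt_neqAle x2 andbT; apply: contraTneq Zx => ->; rewrite -leNgt.
have xgN1 : -1 < x.
  by rewrite lt_neqAle x1 andbT; apply: contraTneq Zx => <-; rewrite -leNgt.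
have [b [xb b1 Zb nb]] := poly_next_zero xl1 Zx Z1.
have [a [ax a1 Za na]] := poly_prev_zero xgN1 Zx ZN1.
have neg t : a < t < b -> (F1 * F2).[t] < 0.
  by move=> /andP[at_ tb]; have [tx|xt] := leP t x; [exact: na|apply: nb => //; exact: ltW].
exists a, b; split => //; last by rewrite ax.
apply: (real_map_branch HG) => //; rewrite -?hornerM//.
  exact: lt_trans ax xb.
by move=> t /neg; rewrite hornerM.
Qed.

(** At a zero of the product, [spoly_side] makes it negative on one side; the zone of a nearby point
    there cannot end before reaching [x], since the product vanishes at its ends. *)
Lemma stays_branch x : stays G x ->
  exists a b, branch asin g (stays G) a b /\ a <= x <= b.
Proof.
move=> /(staysP HG)[]; rewrite -/F1 -/F2 -hornerM => F0.
rewrite le_eqVlt => /orP[/eqP Z|Zx]; last first.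
  by have [a [b [br /andP[ax xb] _ _ _]]] := real_map_zone Zx; exists a, b; rewrite !ltW.
have [e e0 side] : exists2 e : R, 0 < e &
    (forall t, x < t -> t < x + e -> (F1 * F2).[t] < 0) \/
    (forall t, x - e < t -> t < x -> (F1 * F2).[t] < 0).
  move: Z F0; rewrite hornerM xpair_eqE negb_and => /eqP; rewrite mulf_eq0 => Z F0.
  have [h0|h0] := boolP (F2.[x] == 0).
    have f1 : F1.[x] != 0 by move: F0; rewrite h0 orbF.
    have [e e0 sd] := spoly_side us wa wb (eqP h0) f1.
    by exists e => //; case: sd => sd; [left|right] => t *; rewrite hornerM; exact: sd.
  have f0 : F1.[x] == 0 by move: Z; rewrite (negbTE h0) orbF.
  have [e e0 sd] := spoly_side us wb wa (eqP f0) h0.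
  by exists e => //; case: sd => sd; [left|right] => t *; rewrite hornerM mulrC; exact: sd.
case: side => side.
  pose y := x + e / 2; have xy : x < y by rewrite /y; lra.
  have ye : y < x + e by rewrite /y; lra.
  have [a [b [br /andP[ay yb] Za _ neg]]] := real_map_zone (side y xy ye).
  exists a, b; split => //; rewrite (le_trans (ltW xy) (ltW yb)) andbT leNgt.
  apply/negP => xa; have := side a xa (lt_trans ay ye).
  by rewrite Za ltxx.
pose y := x - e / 2; have xy : y < x by rewrite /y; lra.
have ye : x - e < y by rewrite /y; lra.
have [a [b [br /andP[ay yb] _ Zb neg]]] := real_map_zone (side y ye xy).
exists a, b; split => //; rewrite (le_trans (ltW ay) (ltW xy)) leNgt.
apply/negP => bx; have := side b (lt_trans ye yb) bx.
by rewrite Zb ltxx.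
Qed.

Definition trapped : set R := [set x | forall n, unit_segment (iter n G (Some x%:C))].

Lemma trapped_iter x n : (forall m, (m < n)%N -> stays G (iter m g x)) ->
  iter n G (Some x%:C) = Some (iter n g x)%:C.
Proof.
elim: n => //= n IH st; rewrite IH; last by move=> m mn; apply: st; exact: ltnW.
by apply: (stays_map HG); exact: st.
Qed.

Lemma trappedE : trapped = survivors g (stays G).
Proof.
apply/seteqP; split => x tx.
  move=> n; have [m] := ubnP n; elim: m n => // m IH n nm.
  have := tx n.+1; rewrite iterS trapped_iter// => l ln; apply: IH.
  by rewrite (leq_trans ln).
case=> [|n]; last first.
  by rewrite iterS trapped_iter//; exact: tx.
by have [xI _] := stays_itv HG (tx 0%N); exists x.
Qed.

Lemma iter_continuous n : continuous (iter n G).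
Proof.
elim: n => [|n IH] z; first by move=> A.
have -> : iter n.+1 G = G \o iter n G by [].
by apply: continuous_comp; [exact: IH | exact: (pair_continuous HG)].
Qed.

Lemma trapped_closed : closed trapped.
Proof.
have -> : trapped = \bigcap_(n in setT)
    ((fun x : R => iter n G (Some x%:C)) @^-1` unit_segment).
  by apply/seteqP; split => x tx n *; exact: tx.
apply: closed_bigI => n _; apply: closed_comp; last exact: unit_segment_closed.
move=> x _; apply: (@continuous_comp _ _ _ (fun x : R => Some x%:C : sphere)).
  exact: continuous_real_point.
exact: iter_continuous.
Qed.

Lemma fixed_one : stays G 1 /\ g 1 = 1.
Proof.
have h0 : F2.[1] = 0.
  by rewrite /F2 spoly_pole ?(stj_one H)// (stj_beta1 H) mul0r.
have f0 : F1.[1] != 0.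
  rewrite /F1 spoly_pole ?(stj_one H)// mulf_neq0 ?cofactor_neq0//.
  by rewrite gt_eqF// (stj_alpha1 H).
split; first by apply/(staysP HG); rewrite -/F1 -/F2 h0 mulr0 xpair_eqE negb_and f0.
by rewrite /g /real_map -/F1 -/F2 h0 addr0 subr0 divff.
Qed.

Lemma trapped_one : trapped 1.
Proof.
have [st1 g1] := fixed_one; rewrite trappedE => n.
by have -> : iter n g 1 = 1 by elim: n => //= n ->.
Qed.

(* Otherwise the zeros of h between consecutive poles would be common zeros of
   f and h, hence zeros of f - h, whose numerator has too small a degree. *)
Lemma second_preimage : exists e, [/\ stays G e, g e = 1 & e != 1].
Proof.
apply: contrapT => no.
(* A zero of h other than 1 at which f does not vanish would be the desired second preimage. *)
have common x : F2.[x] = 0 -> x != 1 -> F1.[x] = 0.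
  move=> h0 x1; apply: contrapT => /eqP f0; apply: no; exists x; split => //.
    by apply/(staysP HG); rewrite -/F1 -/F2 h0 mulr0 xpair_eqE negb_and f0.
  by rewrite /g /real_map -/F1 -/F2 h0 addr0 subr0 divff.
have [sI a0 a1] := wa; have [_ b0 b1] := wb.
have beta_gt0 k : k \in s -> k != 1 -> 0 < beta k.
  move=> ks k1; rewrite lt_neqAle b0 andbT eq_sym; apply/eqP => bk.
  have h0 : F2.[k] = 0 by rewrite /F2 spoly_pole// bk mul0r.
  have := common k h0 k1; rewrite /F1 spoly_pole// => /eqP.
  rewrite mulf_eq0 (negbTE (cofactor_neq0 s k)) orbF => /eqP ak.
  by have := stj_pole H ks; rewrite ak bk addr0 ltxx.
pose l := sort <=%R s.
have lp : perm_eq l s by rewrite /l perm_sort.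
have ls : sorted <%R l by rewrite sort_lt_sorted.
have l_mem i : (i < size s)%N -> l`_i \in s.
  by move=> is_; rewrite -(perm_mem lp) mem_nth// (perm_size lp).
have l_lt i j : (i < j)%N -> (j < size s)%N -> l`_i < l`_j.
  move=> ij js; rewrite (sorted_ltn_nth lt_trans)// ?inE (perm_size lp)//.
  exact: ltn_trans js.
have l_ne1 i : (i.+1 < size s)%N -> l`_i != 1.
  move=> is_; rewrite lt_eqF// (lt_le_trans (l_lt i i.+1 _ is_))//.
  by have /andP[] := sI _ (l_mem _ is_).
(* The bound on [i] keeps the largest pole 1, where [beta] vanishes, out of the pair; at the other
   poles [beta] is positive and the numerator of h alternates in sign. *)
have gap i : (i.+2 < size s)%N -> exists2 t, l`_i < t < l`_i.+1 & F2.[t] = 0.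
  move=> is_; have i1 : (i.+1 < size s)%N by exact: ltnW.
  have i0 : (i < size s)%N by exact: ltnW.
  have lt := l_lt i i.+1 (leqnn _) i1.
  set p := l`_i in lt *; set q := l`_i.+1 in lt *.
  have ps : p \in s by exact: l_mem.
  have qs : q \in s by exact: l_mem.
  have between k : k \in s -> ~~ (p < k < q).
    rewrite -(perm_mem lp) => /(nthP 0)[j]; rewrite (perm_size lp) => js <-.
    rewrite negb_and -!leNgt; have [ji|ij] := leqP j i.
      apply/orP; left; rewrite /p; move: ji; rewrite leq_eqVlt => /orP[/eqP->//|ji].
      by apply/ltW/l_lt.
    apply/orP; right; move: ij; rewrite leq_eqVlt => /orP[/eqP<-//|ij].
    by apply/ltW/l_lt.
  (* Apart from p - q and q - p, the factors of the two cofactors agree in sign, as no pole lies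
     between [p] and [q]. *)
  have sgn : (pole_cofactor s p).[p] * (pole_cofactor s q).[q] < 0.
    have pq : p != q by rewrite lt_eqF.
    have cE (u v : R) : v \in s -> v != u -> (pole_cofactor s u).[u] =
        (u - v) * \prod_(j <- s | (j != u) && (j != v)) (u - j).
      move=> vS vu; rewrite /pole_cofactor -big_filter horner_prod.
      rewrite (bigD1_seq v) ?filter_uniq//=; last by rewrite mem_filter vu.
      rewrite hornerXsubC big_filter_cond; congr (_ * _).
      by apply: eq_bigr => j _; rewrite hornerXsubC.
    rewrite (cE p q)//; last by rewrite eq_sym.
    rewrite (cE q p)// mulrACA.
    under [X in _ * (_ * X)]eq_bigl do rewrite andbC.
    rewrite -big_split /= nmulr_rlt0; last first.
      by rewrite nmulr_rlt0 ?subr_gt0// subr_lt0.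
    rewrite big_seq_cond; apply: prodr_gt0 => j /and3P[js jp jq].
    have := between j js; rewrite negb_and -!leNgt => /orP[] h.
      have jp' : j < p by rewrite lt_neqAle jp.
      by rewrite mulr_gt0 // subr_gt0// (lt_trans jp' lt).
    have qj : q < j by rewrite lt_neqAle eq_sym jq.
    by rewrite nmulr_rgt0 subr_lt0// (lt_trans lt).
  have pq0 : F2.[p] * F2.[q] < 0.
    rewrite /F2 !spoly_pole// mulrACA pmulr_rlt0// mulr_gt0// beta_gt0//.
      exact: l_ne1.
    exact: l_ne1.
  have [t] := polyrcf.poly_ivtoo (ltW lt) pq0; rewrite in_itv /= => tI /eqP ft.
  by exists t.
pose P := F1 - F2.
have PE : P = spoly s (fun k => alpha k - beta k).
  by rewrite /P /F1 /F2 /spoly -sumrB; apply: eq_bigr => k _; rewrite scalerBl.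
have P0 : P != 0.
  apply: contraTneq (stj_alpha1 H) => P0; have := congr1 (horner^~ 1) P0.
  rewrite PE /= horner0 spoly_pole ?(stj_one H)// => /eqP.
  rewrite mulf_eq0 (negbTE (cofactor_neq0 s 1)) orbF (stj_beta1 H) subr0.
  by move=> /eqP ->; rewrite ltxx.
(* Total mass and mean of [alpha - beta] both vanish, so [mulX_spoly] applies twice. *)
have sP : (size P + 2 <= size s)%N.
  have m0 : \sum_(k <- s) (alpha k - beta k) = 0 by rewrite sumrB a1 b1 subrr.
  have m1 : \sum_(k <- s) (alpha k - beta k) * k = 0.
    by under eq_bigr do rewrite mulrBl; rewrite sumrB (stj_mean H) subrr.
  have := size_spoly s (fun k => (alpha k - beta k) * k * k).
  rewrite -mulX_spoly// -mulX_spoly// -PE mulrA -expr2 mulrC size_mulXn//.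
  by rewrite addnC.
have [t tP] : exists t : nat -> R, forall i, (i.+2 < size s)%N ->
    l`_i < t i < l`_i.+1 /\ P.[t i] = 0.
  have ex i : exists u, (i.+2 < size s)%N -> l`_i < u < l`_i.+1 /\ P.[u] = 0.
    have [is_|] := boolP (i.+2 < size s)%N; last by exists 0.
    have [u uI u0] := gap i is_; exists u => _; split => //.
    have u1 : u != 1.
      rewrite lt_eqF//; case/andP: uI => _ /lt_le_trans; apply.
      by have /andP[] := sI _ (l_mem i.+1 (ltnW is_)).
    by rewrite /P hornerD hornerN u0 (common u u0 u1) subr0.
  by exists (fun i => projT1 (cid (ex i))) => i; exact: projT2 (cid (ex i)).
have t_lt i j : (i < j)%N -> (j.+2 < size s)%N -> t i < t j.
  move=> ij js; have is_ : (i.+2 < size s)%N by exact: ltn_trans js.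
  have [/andP[_ ti] _] := tP i is_; have [/andP[tj _] _] := tP j js.
  apply: lt_trans ti (le_lt_trans _ tj).
  move: ij; rewrite leq_eqVlt => /orP[/eqP->//|ij].
  by apply/ltW/l_lt => //; exact: ltnW (ltnW js).
pose rs := [seq t i | i <- iota 0 (size s - 2)].
have in_rs i : i \in iota 0 (size s - 2) -> (i.+2 < size s)%N.
  by rewrite mem_iota add0n => /andP[_]; rewrite ltn_subRL addnC addn2.
have urs : uniq rs.
  rewrite map_inj_in_uniq ?iota_uniq// => i j /in_rs is_ /in_rs js tij.
  by have [ij|ji|//] := ltngtP i j; [have := t_lt i j ij js|have := t_lt j i ji is_];
    rewrite tij ltxx.
have rrs : all (root P) rs.
  by apply/allP => _ /mapP[i /in_rs is_ ->]; apply/eqP; have [] := tP i is_.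
(* There are at least size s - 2 distinct roots, while the degree is smaller than that number. *)
have := max_poly_roots P0 rrs urs.
by rewrite size_map size_iota ltnNge -(leq_add2r 2) subnK ?sP// (leq_trans _ sP)// leq_addl.
Qed.

Lemma trapped_dichotomy :
  (forall x, -1 <= x <= 1 -> trapped x) \/
  ((forall a b, a < b -> ~ (forall x, a <= x <= b -> trapped x)) /\
   (forall x, trapped x -> forall eps, 0 < eps ->
      exists y, [/\ trapped y, y != x & `|y - x| < eps])).
Proof.
have cl := trapped_closed; have one := trapped_one; rewrite trappedE in cl one *.
have [st1 g1] := fixed_one.
have [[a [b [ab sab]]]|no] := pselect (exists a b, a < b /\
    forall x, a <= x <= b -> survivors g (stays G) x).
  left; exact: (survivors_seg asin_lt asin_within (stays_itv HG) stays_branch cl g1 ab sab).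
right; split; first by move=> a b ab sab; apply: no; exists a, b.
have [e [se ge e1]] := second_preimage.
have Se : survivors g (stays G) e by apply: survivors_pre; rewrite // ge.
apply: (survivors_perfect asin_lt (stays_itv HG) stays_branch one Se e1).
by move=> a b ab sab; apply: no; exists a, b.
Qed.

End PairDichotomy.

(** * The Julia set *)

Section Chordal.
Context {R : realType}.
Local Notation sphere := (sphere R).
Implicit Types (a c : R[i]) (z w : sphere).

Lemma chordalC z w : chordal z w = chordal w z.
Proof.
case: z => [a|]; case: w => [c|] //=; rewrite cabsB; congr (_ / _); exact: mulrC.
Qed.

Lemma chordal_refl z : chordal z z = 0.
Proof. by case: z => //= a; rewrite subrr cabs0 mulr0 mul0r. Qed.

Lemma chordal_zero a : chordal (Some a) (Some 0) <= 2 * cabs a.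
Proof.
rewrite /chordal subr0 cabs0 expr0n /= addr0 sqrtr1 mulr1.
have s1 : 1 <= Num.sqrt (1 + cabs a ^+ 2).
  by rewrite -[leLHS]sqrtr1 ler_wsqrtr// lerDl sqr_ge0.
rewrite ler_pdivrMr; last exact: lt_le_trans s1.
by rewrite ler_peMr// mulr_ge0// cabs_ge0.
Qed.

(** Stands in for the triangle inequality of the chordal distance near 0, the only region where
    closeness has to be chained. *)
Lemma chordal_small (r : R) z c : 0 < r -> r <= 1 -> cabs c <= r ->
  chordal z (Some c) < r / 4 -> exists2 a, z = Some a & cabs a <= 2 * r.
Proof.
move=> r0 r1 cr; have c0 := cabs_ge0 c.
have sc : Num.sqrt (1 + cabs c ^+ 2) <= 2.
  rewrite -[leRHS]ger0_norm// -sqrtr_sqr ler_wsqrtr//; nra.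
have sc0 : 0 < Num.sqrt (1 + cabs c ^+ 2).
  by rewrite sqrtr_gt0; have := sqr_ge0 (cabs c); lra.
case: z => [a|] /=; last first.
  rewrite ltNge => /negP[]; rewrite ler_pdivlMr//; nra.
move=> ch; exists a => //; rewrite leNgt; apply/negP => ar.
have a0 : 0 < cabs a by lra.
have sa0 : 0 < Num.sqrt (1 + cabs a ^+ 2) by rewrite sqrtr_gt0; nra.
move: ch; rewrite ltNge => /negP; apply.
have dist : cabs a / 2 <= cabs (a - c).
  have := cabsD (a - c) c; rewrite subrK; lra.
rewrite ler_pdivlMr ?mulr_gt0//.
apply: (@le_trans _ _ (cabs a)); last by lra.
have sa : r / 4 * (2 * Num.sqrt (1 + cabs a ^+ 2)) <= cabs a.
  have lhs0 : 0 <= r / 4 * (2 * Num.sqrt (1 + cabs a ^+ 2)).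
    by rewrite !mulr_ge0 ?invr_ge0 ?(ltW r0) ?(ltW sa0).
  rewrite -ler_sqr ?nnegrE ?(ltW a0)//.
  have -> : (r / 4 * (2 * Num.sqrt (1 + cabs a ^+ 2))) ^+ 2 =
     r ^+ 2 / 4 * Num.sqrt (1 + cabs a ^+ 2) ^+ 2 by field.
  rewrite sqr_sqrtr; last by nra.
  have h1 : 4 * r ^+ 2 <= cabs a ^+ 2 by nra.
  have h2 : r ^+ 2 * cabs a ^+ 2 <= cabs a ^+ 2.
    by rewrite ler_piMl ?sqr_ge0//; nra.
  have -> : r ^+ 2 / 4 * (1 + cabs a ^+ 2) =
    r ^+ 2 / 4 + (r ^+ 2 * cabs a ^+ 2) / 4 by field.
  have := sqr_ge0 (cabs a); move: h1 h2.
  by move: (cabs a ^+ 2) (r ^+ 2) (r ^+ 2 * _) => t q p; lra.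
apply: le_trans sa; rewrite ler_wpM2l ?divr_ge0 ?(ltW r0)//.
by rewrite mulrC ler_pM2r.
Qed.

End Chordal.

(** * A criterion for normality *)

Section Normality.
Context {R : realType}.
Local Notation sphere := (sphere R).

(** Either some exponent recurs infinitely often along the sequence, which gives a constant
    subsequence, or the exponents tend to infinity and the sequence itself converges to [l]. *)
Lemma iterates_normal (D : sphere -> sphere) (U : set sphere) (l : sphere) :
  (forall e : R, 0 < e -> exists N, forall n, (N <= n)%N -> forall z, U z ->
     chordal (iter n D z) l < e) ->
  normal_on U [set h | exists n : nat, h = iter n D].
Proof.
move=> ul u uP; have [n nE] : exists n : nat -> nat, forall k, u k = iter (n k) D.
  exists (fun k => projT1 (cid (uP k))) => k; exact: projT2 (cid (uP k)).
have [often|rare] := pselect (exists j, forall K, exists2 k, (K <= k)%N & n k = j).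
  have [j jP] := often.
  pose next K := projT1 (cid2 (jP K)).
  have nextP K : (K <= next K)%N /\ n (next K) = j.
    by rewrite /next; case: cid2.
  pose phi := fix phi m := if m is m'.+1 then next (phi m').+1 else next 0%N.
  have phin m : n (phi m) = j by case: m => [|m] /=; exact: (nextP _).2.
  exists phi, (iter j D); split.
    move=> a b; elim: b => // b IH; rewrite ltnS leq_eqVlt => /orP[/eqP->|ab];
      last apply: (ltn_trans (IH ab)); exact: (nextP _).1.
  move=> A cA AU e e0; exists 0%N => k _ z Az.
  by rewrite nE phin chordal_refl.
exists id, (fun=> l); split => // A cA AU e e0.
have [N NP] := ul e e0.
have [K KP] : exists K, forall k, (K <= k)%N -> (N <= n k)%N.
  elim: N {NP} => [|N [K KP]]; first by exists 0%N.
  have [K' K'P] : exists K', forall k, (K' <= k)%N -> n k != N.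
    apply: contrapT => noK; apply: rare; exists N => K'.
    apply: contrapT => nok; apply: noK; exists K' => k K'k.
    by apply/eqP => nk; apply: nok; exists k.
  exists (maxn K K') => k; rewrite geq_max => /andP[Kk K'k].
  by rewrite ltn_neqAle eq_sym K'P// KP.
by exists K => k Kk z Az; rewrite nE; apply: NP; [exact: KP|exact: AU].
Qed.

End Normality.

(** * Fatou and Julia sets through the change of variable *)

Section JuliaPair.
Context {R : realType}.
Local Notation sphere := (sphere R).
Implicit Types (z w : sphere) (x t : R).

Definition sphere_affine (m k : R[i]) z : sphere :=
  if z is Some a then Some (m * a + k) else None.

Lemma continuous_sphere_affine (m k : R[i]) : m != 0 ->
  continuous (sphere_affine m k).
Proof.
move=> m0; have -> : sphere_affine m k = ratmap (m *: 'X + k%:P) 1.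
  apply: funext => -[a|] /=.
    by rewrite hornerC /hcoord oner_eq0 divr1 hornerD hornerZ hornerX hornerC.
  by rewrite size_polyC oner_eq0 -mul_polyC size_MXaddC polyC_eq0 (negbTE m0) /=
    size_polyC m0.
by apply: continuous_ratmap; rewrite ?coprimep1 ?oner_eq0.
Qed.

Variables (s : seq R) (alpha beta : R -> R) (G D : sphere -> sphere) (m k : R).
Hypothesis HG : pair_map s alpha beta G.
Hypothesis D_cont : continuous D.
Hypothesis m_gt0 : 0 < m.
Hypothesis mk1 : m + `|k| <= 1.

(** The Moebius map z = 1 / (m nu + k); it carries the attracting point at infinity of [G] to 0. *)
Definition to_z z : sphere := sphere_inv (sphere_affine m%:C k%:C z).

Definition of_z z : sphere :=
  sphere_affine (m%:C)^-1 (- k%:C / m%:C) (sphere_inv z).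

Hypothesis conj_DG : forall z, D (to_z z) = to_z (G z).

Let mC : m%:C != 0. Proof. by rewrite fmorph_eq0 gt_eqF. Qed.

Lemma to_zK : cancel to_z of_z.
Proof.
move=> z; rewrite /of_z /to_z sphere_invK; case: z => [a|] //=.
by congr Some; field.
Qed.

Lemma of_zK : cancel of_z to_z.
Proof.
move=> z; rewrite /of_z /to_z -[RHS]sphere_invK; congr sphere_inv.
by case: (sphere_inv z) => [a|] //=; congr Some; field.
Qed.

Lemma continuous_to_z : continuous to_z.
Proof.
move=> z; apply: continuous_comp; first exact: continuous_sphere_affine.
exact: continuous_sphere_inv.
Qed.

Lemma continuous_of_z : continuous of_z.
Proof.
move=> z; apply: continuous_comp; first exact: continuous_sphere_inv.
by apply: continuous_sphere_affine; rewrite invr_eq0.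
Qed.

Lemma iter_conj n z : iter n D (to_z z) = to_z (iter n G z).
Proof. by elim: n => //= n ->. Qed.

Let point x : sphere := to_z (Some x%:C).

(** For y in [-1, 1] one has |m y + k| <= m + |k| <= 1. Escaping orbits tend to 0, and this gap is
    what defeats normality at trapped points. *)
Lemma point_trapped x n : trapped G x -> forall a,
  iter n D (point x) = Some a -> 1 <= cabs a.
Proof.
move=> /(_ n) [y /andP[y1 y2] E] a; rewrite iter_conj E /to_z /=.
rewrite -rmorphM -rmorphD /= fmorph_eq0; case: eqP => // /eqP n0 [<-].
rewrite cabsV cabs_real invf_ge1 ?normr_gt0//.
apply: le_trans mk1; apply: le_trans (ler_normD _ _) _.
rewrite lerD2r normrM (gtr0_norm m_gt0) ler_piMr ?(ltW m_gt0)//.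
by rewrite ler_norml y1.
Qed.

Lemma beyond_to_z (r : R) : 0 < r -> exists l, forall z, beyond l z ->
  exists2 a, to_z z = Some a & cabs a <= r.
Proof.
move=> r0; pose M := (r^-1 + `|k|) / m.
have V0 : 0 < r^-1 by rewrite invr_gt0.
exists (2 * M + 2) => -[a|_] /=; last first.
  by exists 0 => //; rewrite cabs0 ltW.
move=> la; have aM : M <= cabs a by have := ell_le_cabs a; lra.
have low : r^-1 <= cabs (m%:C * a + k%:C).
  have := cabsD (m%:C * a + k%:C) (- k%:C); rewrite addrK cabsM cabsN !cabs_real.
  rewrite (gtr0_norm m_gt0); move: aM; rewrite /M ler_pdivrMr//; lra.
have n0 : m%:C * a + k%:C != 0 by rewrite -cabs_gt0 (lt_le_trans V0).
exists (m%:C * a + k%:C)^-1; first by rewrite /to_z /= (negbTE n0).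
by rewrite cabsV -[leRHS]invrK lef_pV2 // posrE (lt_le_trans V0).
Qed.

Lemma open_beyond (l : R) :
  open [set z : sphere | if z is Some a then l < ell a else True].
Proof.
rewrite openE => -[a|] /=.
  move=> la; apply/nbhs_finite; exists ((ell a - l) / 2); first by lra.
  move=> b; rewrite cabsB => ba; change (l < ell b).
  have := cabsD (a - b) (b - 1); rewrite addrA subrK.
  have := cabsD (a - b) (b + 1); rewrite addrA subrK.
  by move: la ba; rewrite /ell; lra.
move=> _; apply/nbhs_infty; split => //; exists l => b lb.
by change (l < ell b); have := cabs_le_ell b; have := cabs_ge0 b; lra.
Qed.

Lemma escape_fatou z : ~ (exists2 x, trapped G x & z = point x) -> fatou_set D z.
Proof.
move=> nz; have [n nseg] : exists n, ~ unit_segment (iter n G (of_z z)).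
  apply: contrapT => all_in; apply: nz.
  have seg n : unit_segment (iter n G (of_z z)).
    by apply: contrapT => ns; apply: all_in; exists n.
  have [x _ xE] := seg 0%N; exists x; first by move=> n; rewrite -xE.
  by rewrite /point -xE of_zK.
have [l l2 bl] := segment_beyond nseg.
(* A level strictly between 2 and [l] leaves room for an open set that still escapes uniformly. *)
pose l' := (l + 2) / 2; have l'2 : 2 < l' by rewrite /l'; lra.
have l'l : l' < l by rewrite /l'; lra.
pose W := [set w : sphere | if w is Some a then l' < ell a else True].
exists ((fun w => iter n G (of_z w)) @^-1` W); split.
- apply: open_comp; last exact: open_beyond.
  move=> w _; apply: (@continuous_comp _ _ _ of_z); first exact: continuous_of_z.
  exact: (iter_continuous HG).
- by move: bl; rewrite /W /=; case: (iter n G _) => //= a; exact: lt_le_trans.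
apply: (@iterates_normal _ _ _ (Some 0)) => e e0.
have e4 : 0 < e / 4 by rewrite divr_gt0.
have [L LP] := beyond_to_z e4.
have [N NP] := G_escape HG L l'2.
exists (N + n)%N => j Nj w Ww; rewrite -(of_zK w) iter_conj.
have nj : (n <= j)%N by rewrite (leq_trans _ Nj)// leq_addl.
rewrite -(subnK nj) iterD.
have [|a -> ar] := LP (iter (j - n) G (iter n G (of_z w))).
  apply: NP; first by rewrite leq_subRL// addnC.
  by move: Ww; rewrite /W /=; case: (iter n G _) => //= a /ltW.
apply: le_lt_trans (chordal_zero _) _; lra.
Qed.

(** Under normality one fixed iterate would be small at all non-real points of a neighbourhood,
    because they escape; by continuity its value near [x] stays close to one of modulus at least
    1. *)
Lemma trapped_julia x : trapped G x -> julia_set D (point x).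
Proof.
move=> tx [U [oU Ux nU]].
have [phi [g [phi_lt conv]]] := nU (fun n => iter n D) (fun n => ex_intro _ n erefl).
have nbU : nbhs (point x) U by apply: open_nbhs_nbhs.
have reg : {for point x, regular_space sphere}.
  apply: (compact_regular (@hausdorff_sphere R) (@compact_sphere R)).
  exact: filterT.
have [B nB BU] := reg U nbU.
have cB : compact (closure B).
  by apply: closed_sphere_compact; exact: closed_closure.
(* Two applications of [chordal_small] follow: a late iterate of modulus at most 1/8 bounds the
   limit by 1/4, and the limit bounds the iterate of index [phi N] by 1/2. *)
have e0 : 0 < (1 / 8 / 4 : R) by lra.
have [N NP] := conv _ cB BU _ e0.
have near_zero y : closure B y -> ~ unit_segment (of_z y) ->
    exists2 a, iter (phi N) D y = Some a & cabs a <= 1 / 2.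
  move=> By ns; have [l l2 bl] := segment_beyond ns.
  have r8 : 0 < 1 / 8 :> R by lra.
  have [L LP] := beyond_to_z r8.
  have [M MP] := G_escape HG L l2.
  have phi_ge n : (n <= phi n)%N.
    by elim: n => // n IH; exact: leq_ltn_trans IH (phi_lt _ _ (ltnSn n)).
  pose n := maxn N M.
  have [b bE br] := LP _ (MP (phi n) _ (leq_trans (leq_maxr N M) (phi_ge n)) bl).
  rewrite -iter_conj of_zK in bE.
  have := NP n (leq_maxl _ _) y By; rewrite bE chordalC => gb.
  have [|c gE cr] := chordal_small r8 _ br gb; first by lra.
  have := NP N (leqnn _) y By; rewrite gE => ch.
  have [||||a aE ar] := @chordal_small R (1 / 4) (iter (phi N) D y) c.
  - by lra.
  - by lra.
  - by lra.
  - by apply: lt_le_trans ch _; lra.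
  by exists a => //; lra.
pose V := [set w : sphere | if w is Some a then 1 / 2 < cabs a else True].
have nV : nbhs (iter (phi N) D (point x)) V.
  have : V (iter (phi N) D (point x)).
    rewrite /V /=; case E: (iter _ _ _) => [a|] //.
    by have := point_trapped tx E; lra.
  case: (iter _ _ _) => [a|] /= Va.
    apply/nbhs_finite; exists (cabs a - 1 / 2); first by rewrite subr_gt0.
    move=> b ba; rewrite /V /=; have := cabsD (a - b) b; rewrite subrK cabsB; lra.
  by apply/nbhs_infty; split => //; exists (1 / 2).
have nV' : nbhs (Some x%:C : sphere) [set w | V (iter (phi N) D (to_z w))].
  have ci : continuous (iter (phi N) D).
    elim: (phi N) => [|j IH] w; first by move=> W.
    have -> : iter j.+1 D = D \o iter j D by [].
    by apply: continuous_comp; [exact: IH | exact: D_cont].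
  exact: (continuous_comp (@continuous_to_z (Some x%:C)) (ci _)) nV.
have nB' : nbhs (Some x%:C : sphere) [set w | B (to_z w)].
  exact: (@continuous_to_z (Some x%:C)).
have /nbhs_finite[d d0 dP] : nbhs (Some x%:C : sphere)
    ([set w | V (iter (phi N) D (to_z w))] `&` [set w | B (to_z w)]).
  exact: filterI.
(* A non-real point close to [x], hence off the segment. *)
pose b : R[i] := x +i* (d / 2).
have [|Vb Bb] := dP b.
  rewrite cabsE !raddfB /= subrr expr0n add0r subr0 sqrtr_sqr gtr0_norm; lra.
have [|a aE ar] := near_zero (to_z (Some b)) (subset_closure Bb).
  rewrite to_zK => /unit_segmentP[/= Im0 _].
  by move: d0; rewrite (_ : d = 0) ?ltxx//; lra.
by move: Vb; rewrite /V /= aE; lra.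
Qed.

Lemma julia_pairE : julia_set D = point @` trapped G.
Proof.
apply/seteqP; split => z.
  move=> Jz; apply: contrapT => nz; apply: Jz; apply: escape_fatou.
  by case=> x tx zE; apply: nz; exists x.
by move=> [x tx <-]; exact: trapped_julia.
Qed.

Let continuous_point : continuous point.
Proof.
move=> x; apply: (@continuous_comp _ _ _ (fun x : R => Some x%:C : sphere)).
  exact: continuous_real_point.
exact: continuous_to_z.
Qed.

Let point_inj : injective point.
Proof. by move=> x y /(can_inj to_zK) /Some_inj /complexI. Qed.

Let point_real x : real_circle (point x).
Proof.
rewrite /point /to_z /= -rmorphM -rmorphD /= fmorph_eq0.
by case: eqP => // _; rewrite -fmorphV.
Qed.

Let coord z : R := if of_z z is Some a then complex.Re a else 0.

Let coordK x : coord (point x) = x.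
Proof. by rewrite /coord /point to_zK. Qed.

Let continuous_coord x : {for point x, continuous coord}.
Proof.
have c1 : {for (Some x%:C : sphere), continuous
    (fun w : sphere => if w is Some a then complex.Re a else 0 : R)}.
  by move=> A /= nA; exact: (@continuous_Re R (x%:C : R[i]^o) A nA).
apply: (@continuous_comp _ _ _ of_z
  (fun w : sphere => if w is Some a then complex.Re a else 0 : R)).
  exact: continuous_of_z.
by rewrite /point to_zK.
Qed.

Theorem julia_pair_dichotomy :
  real_interval (julia_set D) \/ cantor_set (julia_set D).
Proof.
rewrite julia_pairE.
have J0 : point @` trapped G !=set0.
  by exists (point 1); exists 1 => //; exact: (trapped_one HG).
have trI x : trapped G x -> -1 <= x <= 1.
  by move=> /(_ 0%N) [y yI /= /Some_inj/complexI ->].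
have ct : compact (trapped G).
  apply: (subclosed_compact (trapped_closed HG) (@segment_compact R (-1) 1)).
  by move=> x /trI; rewrite /= in_itv.
have cJ : compact (point @` trapped G).
  by apply: continuous_compact ct; exact: continuous_subspaceT continuous_point.
have clJ : closed (point @` trapped G).
  exact: compact_closed (@hausdorff_sphere R) cJ.
have [full|[noseg perf]] := trapped_dichotomy HG; [left|right].
  split => //; first by move=> _ [x _ <-]; exact: point_real.
  have -> : trapped G = `[-1, 1]%classic.
    by apply/seteqP; split => x; rewrite /= in_itv; [exact: trI | exact: full].
  apply: connected_continuous_connected; first exact: segment_connected.
  exact: continuous_subspaceT continuous_point.
split => //.
  split => //; apply/seteqP; split => z.
    by move=> lz; apply: clJ => B /lz[y [_ Jy By]]; exists y.
  move=> [x tx <-] A nA; have := continuous_point nA => /nbhs_normP[e /= e0 eA].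
  have [y [ty yx ye]] := perf x tx e e0.
  exists (point y); split; [by rewrite inj_eq | by exists y |].
  by apply: eA; rewrite /ball_ /= distrC.
move=> z Jz; apply/seteqP; split => [w|_ ->]; last exact: connected_component_refl.
move=> [B [Bz BJ cB] Bw].
(* Read in the real coordinate, a connected part of the Julia set is an interval of trapped points,
   and these are degenerate. *)
have cc : connected (coord @` B).
  apply: connected_continuous_connected => //.
  apply: continuous_in_subspaceT => y; rewrite inE => /BJ[x _ <-].
  exact: continuous_coord.
have [x tx xE] := BJ _ Bz; have [y ty yE] := BJ _ Bw.
have inB t : (coord @` B) t -> trapped G t.
  by move=> [b /BJ[u tu <-] <-]; rewrite coordK.
have Bx : (coord @` B) x by exists z => //; rewrite -xE coordK.
have By : (coord @` B) y by exists w => //; rewrite -yE coordK.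
have itv := (connected_intervalP _).1 cc.
have same u v : (coord @` B) u -> (coord @` B) v -> ~ u < v.
  move=> Bu Bv uv; apply: (noseg _ _ uv) => t tI; apply: inB.
  exact: (itv u v).
have [xy|yx|xy] := ltgtP x y; [by case: (same _ _ Bx By)|by case: (same _ _ By Bx)|].
by rewrite -yE -xE xy.
Qed.

End JuliaPair.

(** * From spectral data to a pair of Stieltjes transforms *)

Section SpectralData.
Context {R : realType}.
Local Notation sphere := (sphere R).
Variables (n : nat) (kap a b : 'I_n -> R) (c : R).
Hypothesis c_gt0 : 0 < c.
Hypothesis c_le1 : c <= 1.
Hypothesis kap_itv : forall i, - c <= kap i <= 1.
Hypothesis a_ge0 : forall i, 0 <= a i.
Hypothesis b_ge0 : forall i, 0 <= b i.
Hypothesis a_sum : \sum_i a i = 1.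
Hypothesis b_sum : \sum_i b i = 1.
Hypothesis mean_eq : \sum_i a i * kap i = \sum_i b i * kap i.
Hypothesis a_one : exists2 i, kap i = 1 & 0 < a i.
Hypothesis b_one : forall i, kap i = 1 -> b i = 0.

(** The numerator of the sum of u_i / (1 - kap_i z) over the product of all denominators. *)
Definition spectral_poly (u : 'I_n -> R) : {poly R[i]} :=
  \sum_i (u i)%:C *: \prod_(j | j != i) (1 - (kap j)%:C *: 'X).

Variable d : {fraction {poly R[i]}}.
Hypothesis dE : d = tofrac (spectral_poly (fun i => a i - b i)) /
                    tofrac (spectral_poly (fun i => a i + c * b i)).

(** nu -> m nu + k maps [-1, 1] onto [-c, 1], and m = 1 - k = c + k is what turns (f - h) / (f + c
    h) into (f + h) / (f - h). *)
Let m : R := (1 + c) / 2.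
Let k : R := (1 - c) / 2.
Let pt i : R := (kap i - k) / m.

Let m_gt0 : 0 < m. Proof. by move: c_gt0; rewrite /m; lra. Qed.
Let mE : m = 1 - k. Proof. by rewrite /m /k; lra. Qed.
Let mE' : m = c + k. Proof. by rewrite /m /k; lra. Qed.

(** Eigenvalues may coincide or carry no weight: equal ones are merged and weightless ones dropped,
    as [stj_uniq] and [stj_pole] demand. *)
Definition spectral_support : seq R :=
  undup [seq pt i | i <- enum 'I_n & 0 < a i + b i].

Definition grouped (u : 'I_n -> R) (t : R) : R := \sum_(i | pt i == t) u i.

Let group_sum (V : zmodType) (u : 'I_n -> R) (g : R -> R -> V) :
  (forall i, 0 <= u i) -> (forall i, u i != 0 -> 0 < a i + b i) ->
  (forall t x y, g t (x + y) = g t x + g t y) -> (forall t, g t 0 = 0) ->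
  \sum_(t <- spectral_support) g t (grouped u t) = \sum_i g (pt i) (u i).
Proof.
move=> u0 us gD g0.
have gsum t (P : pred 'I_n) : g t (\sum_(i | P i) u i) = \sum_(i | P i) g t (u i).
  by apply: (big_morph (g t)).
under eq_bigr do rewrite gsum.
rewrite (exchange_big_dep xpredT)//=; apply: eq_bigr => i _.
have [ui|ui] := eqVneq (u i) 0.
  by rewrite ui g0 big1// => t _; rewrite g0.
have iS : pt i \in spectral_support.
  rewrite mem_undup; apply/mapP; exists i => //.
  by rewrite mem_filter us// mem_enum.
rewrite -big_filter (_ : [seq t <- _ | pt i == t] = [:: pt i]) ?big_seq1//.
have -> : [seq t <- spectral_support | pt i == t] =
    seq.filter (pred1 (pt i)) spectral_support.
  by apply: eq_filter => t; rewrite eq_sym.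
by rewrite filter_pred1_uniq// undup_uniq.
Qed.

Let a_supp i : a i != 0 -> 0 < a i + b i.
Proof.
by move=> ai; rewrite ltr_pwDl// lt_neqAle eq_sym ai a_ge0.
Qed.

Let b_supp i : b i != 0 -> 0 < a i + b i.
Proof.
by move=> bi; rewrite ltr_wpDl// lt_neqAle eq_sym bi b_ge0.
Qed.

Let pt_itv i : -1 <= pt i <= 1.
Proof.
have /andP[h1 h2] := kap_itv i.
by rewrite /pt ler_pdivlMr// ler_pdivrMr//; apply/andP; split; rewrite /m /k;
  move: h1 h2; lra.
Qed.

Let pt_one i : (pt i == 1) = (kap i == 1).
Proof.
rewrite /pt -subr_eq0 -[RHS]subr_eq0.
have -> : (kap i - k) / m - 1 = (kap i - 1) / m.
  have kE : k = 1 - m by rewrite mE; ring.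
  by rewrite kE; field; rewrite gt_eqF.
by rewrite mulf_eq0 invr_eq0 [X in _ || X]gt_eqF ?orbF.
Qed.

Lemma spectral_pair : stieltjes_pair spectral_support (grouped a) (grouped b).
Proof.
have sI t : t \in spectral_support -> -1 <= t <= 1.
  by rewrite mem_undup => /mapP[i _ ->].
have sumw (u : 'I_n -> R) : (forall i, 0 <= u i) -> (forall i, u i != 0 -> 0 < a i + b i) ->
    \sum_(t <- spectral_support) grouped u t = \sum_i u i.
  by move=> u0 us; exact: (group_sum (g := fun _ x => x)).
have meanw (u : 'I_n -> R) : (forall i, 0 <= u i) -> (forall i, u i != 0 -> 0 < a i + b i) ->
    \sum_(t <- spectral_support) grouped u t * t = \sum_i u i * pt i.
  move=> u0 us; apply: (group_sum (g := fun t x => x * t)) => // t.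
    by move=> x y; rewrite mulrDl.
  by rewrite mul0r.
have g0 (u : 'I_n -> R) t : (forall i, 0 <= u i) -> 0 <= grouped u t.
  by move=> u0; apply: sumr_ge0.
split.
- by split => // [t|]; [exact: g0 | rewrite sumw].
- by split => // [t|]; [exact: g0 | rewrite sumw].
- exact: undup_uniq.
- move=> t; rewrite mem_undup => /mapP[j]; rewrite mem_filter => /andP[abj _] ->.
  rewrite /grouped -big_split /= (bigD1 j)//= ltr_wpDr//.
  by apply: sumr_ge0 => l _; rewrite addr_ge0.
- rewrite !meanw//.
  have e (u : 'I_n -> R) : \sum_i u i = 1 -> \sum_i u i * pt i =
      (\sum_i u i * kap i - k) / m.
    move=> u1; rewrite mulrBl -[k in RHS]mulr1 -u1 mulr_sumr !mulr_suml -sumrB.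
    by apply: eq_bigr => i _; rewrite /pt; ring.
  by rewrite !e// mean_eq.
- have [i ki ai] := a_one; rewrite mem_undup; apply/mapP; exists i.
    by rewrite mem_filter mem_enum andbT ltr_pwDl.
  by apply/esym/eqP; rewrite pt_one ki.
- have [i ki ai] := a_one; rewrite /grouped (bigD1 i)/=; last by rewrite pt_one ki.
  by rewrite ltr_pwDl// sumr_ge0.
- by rewrite /grouped big1// => i; rewrite pt_one => /eqP; exact: b_one.
Qed.

Let tz := @to_z R m k.
Let oz := @of_z R m k.
Let G z := oz (ratfun_eval d (tz z)).

Lemma spectral_poly0 (u : 'I_n -> R) : (spectral_poly u).[0] = (\sum_i u i)%:C.
Proof.
rewrite /spectral_poly horner_sum rmorph_sum /=; apply: eq_bigr => i _.
rewrite hornerZ horner_prod big1 ?mulr1// => j _.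
by rewrite hornerD hornerN hornerZ hornerX mulr0 subr0 hornerC.
Qed.

Let den0 : (spectral_poly (fun i => a i + c * b i)).[0] = (1 + c)%:C.
Proof. by rewrite spectral_poly0 big_split /= -mulr_sumr a_sum b_sum mulr1. Qed.

Let den_neq0 : spectral_poly (fun i => a i + c * b i) != 0.
Proof.
apply/eqP => q0; have := den0; rewrite q0 horner0 => /esym/complexI.
by move: c_gt0; lra.
Qed.

(** At z = 1 / (m nu + k) the factor 1 - kap z equals m (nu - pt) / (m nu + k). The factor [C] does
    not depend on the weights and cancels in the quotient. *)
Let spectral_poly_at (u : 'I_n -> R) (nu : R[i]) : nu * m%:C + k%:C != 0 ->
  (forall i, nu != (pt i)%:C) -> exists2 C : R[i], C != 0 &
  forall u : 'I_n -> R, (spectral_poly u).[(m%:C * nu + k%:C)^-1] =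
    C * \sum_i (u i)%:C / (nu - (pt i)%:C).
Proof.
rewrite mulrC; set x := _ + _ => x0 npt.
have mC : m%:C != 0 by rewrite fmorph_eq0 gt_eqF.
have fE j : 1 - (kap j)%:C * x^-1 = m%:C * (nu - (pt j)%:C) / x.
  have -> : (pt j)%:C = ((kap j)%:C - k%:C) / m%:C.
    by rewrite /pt fmorph_div rmorphB.
  by rewrite /x; field; rewrite -/x x0 mC.
have f0 j : 1 - (kap j)%:C * x^-1 != 0.
  by rewrite fE !mulf_neq0 ?invr_eq0// subr_eq0.
exists (x / m%:C * \prod_j (1 - (kap j)%:C * x^-1)).
  by rewrite !mulf_neq0 ?invr_eq0//; apply/prodf_neq0.
move=> {}u; rewrite /spectral_poly horner_sum mulr_sumr; apply: eq_bigr => i _.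
rewrite hornerZ horner_prod [in RHS](bigD1 i)//= fE.
under eq_bigr do rewrite hornerD hornerN hornerZ hornerX hornerC.
move: (\prod_(_ | _) _) => Pi.
have ni : nu - (pt i)%:C != 0 by rewrite subr_eq0.
by field; rewrite x0 mC ni.
Qed.

Let grouped_cstj (u : 'I_n -> R) nu : (forall i, 0 <= u i) ->
  (forall i, u i != 0 -> 0 < a i + b i) ->
  cstj spectral_support (grouped u) nu = \sum_i (u i)%:C / (nu - (pt i)%:C).
Proof.
move=> u0 us; apply: (group_sum (g := fun t x => x%:C / (nu - t%:C))) => // t.
  by move=> x y; rewrite rmorphD mulrDl.
by rewrite rmorph0 mul0r.
Qed.

Lemma spectral_pair_map : pair_map spectral_support (grouped a) (grouped b) G.
Proof.
have H := spectral_pair; have us := stj_uniq H.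
have mC : m%:C != 0 by rewrite fmorph_eq0 gt_eqF.
have Gc : continuous G.
  move=> z; apply: (@continuous_comp _ _ _ (fun z => ratfun_eval d (tz z))).
    apply: (@continuous_comp _ _ _ tz); first exact: continuous_to_z.
    exact: continuous_ratfun_eval.
  exact: continuous_of_z.
have Ginf : G None = None.
  have tz0 : tz None = Some 0 by [].
  rewrite /G tz0 (ratfun_eval_hcoord den_neq0 dE).
    rewrite den0 spectral_poly0 sumrB a_sum b_sum subrr rmorph0.
    rewrite /hcoord fmorph_eq0 gt_eqF ?mul0r; last by move: c_gt0; lra.
    by rewrite /oz /of_z /= eqxx.
  rewrite den0 xpair_eqE negb_and fmorph_eq0 [X in _ || X](_ : _ = true) ?orbT//.
  by rewrite gt_eqF//; move: c_gt0; lra.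
have num0 : (pair_num spectral_support (grouped a) (grouped b),
             pair_den spectral_support (grouped a) (grouped b)) != (0, 0).
  rewrite xpair_eqE negb_and; apply/orP; left; apply/eqP => n0.
  have := congr1 (horner^~ (1 : R)%:C) n0; rewrite /= /pair_num horner_map horner0.
  move=> /complexI; rewrite hornerD !spoly_pole ?(stj_one H)// (stj_beta1 H).
  rewrite mul0r addr0 => /eqP; rewrite mulf_eq0 (negbTE (cofactor_neq0 _ _)) orbF.
  by rewrite gt_eqF// (stj_alpha1 H).
(* The exceptional points: where z is infinite, and the images of the eigenvalues. *)
pose S := - k%:C / m%:C :: [seq (pt i)%:C | i <- enum 'I_n].
have [|h1 h2] := hcoord_generic (s := S) Gc num0; last by split.
move=> nu; rewrite inE negb_or => /andP[nu0 nuS] AB.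
have x0 : m%:C * nu + k%:C != 0.
  apply: contraNneq nu0 => e; apply/eqP/(mulfI mC).
  by rewrite mulrCA divff// mulr1; apply/eqP; rewrite -subr_eq0 opprK e.
have npt i : nu != (pt i)%:C.
  by apply: contraNneq nuS => ->; apply: map_f; rewrite mem_enum.
have ns t : t \in spectral_support -> nu != t%:C.
  by rewrite mem_undup => /mapP[i _ ->].
have [|C C0 PE] := spectral_poly_at a (nu := nu) _ npt; first by rewrite mulrC.
set f := cstj spectral_support (grouped a) nu.
set h := cstj spectral_support (grouped b) nu.
have W0 := horner_pole_polyC ns.
have AE : (pair_num spectral_support (grouped a) (grouped b)).[nu] =
    (map_poly (real_complex R) (pole_poly spectral_support)).[nu] * (f + h).
  by rewrite /pair_num rmorphD hornerD !horner_spolyC// mulrDr.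
have BE : (pair_den spectral_support (grouped a) (grouped b)).[nu] =
    (map_poly (real_complex R) (pole_poly spectral_support)).[nu] * (f - h).
  by rewrite /pair_den rmorphB hornerD hornerN !horner_spolyC// mulrBr.
have fh : (f, h) != (0, 0).
  by apply: contraNneq AB => -[f0 h0]; rewrite AE BE f0 h0 addr0 subr0 mulr0.
rewrite AE BE hcoordM//.
have fE : f = \sum_i (a i)%:C / (nu - (pt i)%:C) by rewrite /f grouped_cstj.
have hE : h = \sum_i (b i)%:C / (nu - (pt i)%:C) by rewrite /h grouped_cstj.
have Pn : (spectral_poly (fun i => a i - b i)).[(m%:C * nu + k%:C)^-1] = C * (f - h).
  rewrite PE fE hE -sumrB; congr (_ * _); apply: eq_bigr => i _.
  by rewrite rmorphB mulrBl.
have Pd : (spectral_poly (fun i => a i + c * b i)).[(m%:C * nu + k%:C)^-1] =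
    C * (f + c%:C * h).
  rewrite PE fE hE; congr (_ * _); rewrite mulr_sumr -big_split; apply: eq_bigr => i _.
  by rewrite rmorphD rmorphM /= mulrDl mulrA.
have c1 : (1 + c)%:C != 0 by rewrite fmorph_eq0 gt_eqF//; move: c_gt0; lra.
have PQ : (f - h, f + c%:C * h) != (0, 0).
  apply: contraNneq fh => -[e1 e2].
  have fhE : f = h by apply/eqP; rewrite -subr_eq0 e1.
  have : (1 + c)%:C * h = 0 by rewrite -e2 fhE rmorphD rmorph1; ring.
  by move/eqP; rewrite mulf_eq0 (negbTE c1) /= fhE => /eqP ->.
have tzE : tz (Some nu) = Some (m%:C * nu + k%:C)^-1.
  by rewrite /tz /to_z /= (negbTE x0).
rewrite /G tzE (ratfun_eval_hcoord den_neq0 dE); last first.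
  by rewrite Pn Pd xpair_eqE !mulf_eq0 (negbTE C0) /= -xpair_eqE.
rewrite Pn Pd hcoordM// /oz /of_z sphere_inv_hcoord// /hcoord.
case: eqP => // /eqP fh0 /=; congr Some.
have mE1 : m%:C = 1 - k%:C by rewrite mE rmorphB.
have cE : c%:C = m%:C - k%:C by rewrite -rmorphB; congr _%:C; rewrite {1}mE'; ring.
have kE : k%:C = 1 - m%:C by rewrite mE1; ring.
by rewrite cE kE; field; rewrite fh0 mC.
Qed.

Theorem spectral_julia : real_interval (julia_set (ratfun_eval d)) \/
  cantor_set (julia_set (ratfun_eval d)).
Proof.
apply: (@julia_pair_dichotomy R _ _ _ G _ m k spectral_pair_map) => //.
- exact: continuous_ratfun_eval.
- by move: c_le1 => c1; rewrite ger0_norm /m /k; lra.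
by move=> z; rewrite /G of_zK.
Qed.

End SpectralData.

(** * Random walk on a finite graph *)

Section MatrixOfFunction.
Context {K : fieldType} {T : finType}.
Implicit Types (F : T -> T -> K).

Definition mxfun F : 'M[K]_#|T| := \matrix_(i, j) F (enum_val i) (enum_val j).

Lemma mxfunE F x y : mxfun F (enum_rank x) (enum_rank y) = F x y.
Proof. by rewrite mxE !enum_rankK. Qed.

Lemma sum_enum_val (V : nmodType) (E : T -> V) :
  \sum_(i < #|T|) E (enum_val i) = \sum_x E x.
Proof.
by rewrite (reindex (@enum_val T T)) //; apply: onW_bij; exact: enum_val_bij.
Qed.

Lemma mxfunM F F' : mxfun F *m mxfun F' = mxfun (fun x z => \sum_y F x y * F' y z).
Proof.
apply/matrixP => i j; rewrite !mxE -sum_enum_val.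
by apply: eq_bigr => l _; rewrite !mxE.
Qed.

Lemma mxfun1 : mxfun (fun x y => (x == y)%:R) = 1%:M.
Proof.
by apply/matrixP => i j; rewrite !mxE (inj_eq enum_val_inj).
Qed.

Lemma mxfun_eq F F' : F =2 F' -> mxfun F = mxfun F'.
Proof. by move=> FF; apply/matrixP => i j; rewrite !mxE FF. Qed.

(** The permuted [G] is again a left inverse of [F], and the inverse of a square matrix is
    unique. *)
Lemma left_inverse_perm F G (f : T -> T) : injective f ->
  (forall x z, \sum_y G x y * F y z = (x == z)%:R) ->
  (forall x y, F (f x) (f y) = F x y) -> forall x y, G (f x) (f y) = G x y.
Proof.
move=> fi GF Ff x y.
have e1 : mxfun G *m mxfun F = 1%:M.
  by rewrite mxfunM -mxfun1; apply: mxfun_eq.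
have e2 : mxfun (fun x y => G (f x) (f y)) *m mxfun F = 1%:M.
  rewrite mxfunM -mxfun1; apply: mxfun_eq => a b.
  rewrite -(inj_eq fi) -GF [RHS](reindex_inj fi) /=.
  by apply: eq_bigr => t _; rewrite Ff.
have /mulmx1C e3 := e1.
have : mxfun (fun x y => G (f x) (f y)) = mxfun G.
  by rewrite -[LHS]mulmx1 -e3 mulmxA e2 mul1mx.
by move=> /matrixP/(_ (enum_rank x) (enum_rank y)); rewrite !mxfunE.
Qed.

(* rho is the probability generating function of being absorbed at w. *)
Lemma absorbed_inverse (Q G : T -> T -> K) (Z : K) (B : pred T) v w (g1 sigma : K) :
  (forall x z, \sum_y G x y * ((y == z)%:R - Z * Q y z) = (x == z)%:R) ->
  v \notin B -> w \in B -> sigma != 0 ->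
  (forall b, b \in B -> G v b = g1) ->
  (forall b, b \in B -> \sum_(x in B) G x b = sigma) ->
  let N := 1%:M - Z *: mxfun (fun x y => if x \in B then 0 else Q x y) in
  N \in unitmx -> invmx N (enum_rank v) (enum_rank w) = g1 / sigma.
Proof.
move=> GQ vB wB s0 Gv GB N uN; set rho := g1 / sigma.
(* The row of [v] in the Green function, corrected by the rows of [B] so as to vanish on [B];
   together with the value [rho] on [B] it is the row of [v] for the walk stopped on [B]. *)
pose y' x := G v x - rho * \sum_(b in B) G b x.
have y'B x : x \in B -> y' x = 0.
  by move=> xB; rewrite /y' Gv// GB// /rho divfK// subrr.
pose yv : 'rV[K]_#|T| := \row_j ((enum_val j \in B)%:R * rho + y' (enum_val j)).
have yN : yv *m N = delta_mx 0 (enum_rank v).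
  apply/rowP => j; rewrite /N mulmxBr mulmx1 -scalemxAr !mxE eqxx /=.
  set z := enum_val j.
  have -> : (j == enum_rank v) = (v == z).
    by rewrite -(inj_eq enum_val_inj) enum_rankK eq_sym.
  under eq_bigr do rewrite !mxE.
  rewrite (sum_enum_val (fun x => ((x \in B)%:R * rho + y' x) *
    (if x \in B then 0 else Q x z))).
  have -> : \sum_x ((x \in B)%:R * rho + y' x) * (if x \in B then 0 else Q x z) =
      \sum_x y' x * Q x z.
    apply: eq_bigr => x _; case: ifP => xB; last by rewrite mul0r add0r.
    by rewrite y'B// mulr0 mul0r.
  rewrite -addrA -[y' z](_ : \sum_x y' x * (x == z)%:R = _); last first.
    rewrite (bigD1 z)//= eqxx mulr1 big1 ?addr0// => x xz.
    by rewrite (negbTE xz) mulr0.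
  rewrite mulr_sumr -sumrB.
  have -> : \sum_x (y' x * (x == z)%:R - Z * (y' x * Q x z)) =
      \sum_x y' x * ((x == z)%:R - Z * Q x z).
    by apply: eq_bigr => x _; ring.
  have BQ : \sum_x (\sum_(b in B) G b x) * ((x == z)%:R - Z * Q x z) =
      \sum_(b in B) (b == z)%:R.
    under eq_bigr do rewrite mulr_suml.
    by rewrite exchange_big; apply: eq_bigr => b _; rewrite GQ.
  rewrite /y'; under eq_bigr do rewrite mulrBl -mulrA.
  rewrite sumrB GQ -mulr_sumr BQ.
  have -> : \sum_(b in B) (b == z)%:R = (z \in B)%:R :> K.
    have [zB|zB] := boolP (z \in B).
      rewrite (bigD1 z)//= eqxx big1 ?addr0// => b /andP[_ bz].
      by rewrite (negbTE bz).
    by rewrite big1// => b bB; case: eqP => // bz; rewrite -bz bB in zB.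
  by ring.
have -> : invmx N (enum_rank v) (enum_rank w) =
    (delta_mx 0 (enum_rank v) *m invmx N) (0 : 'I_1) (enum_rank w).
  rewrite mxE (bigD1 (enum_rank v))//= !mxE !eqxx mul1r big1 ?addr0// => j jv.
  by rewrite !mxE (negbTE jv) mul0r.
by rewrite -yN mulmxK// mxE enum_rankK wB mul1r y'B// addr0.
Qed.

End MatrixOfFunction.

(** * Spectral decomposition of the walk on one cell *)

Section FiniteGraph.
Context {R : realType} {T : finType}.
Variables (e : rel T) (bd : {set T}) (v w : T).
Local Notation C := R[i].

Definition fdeg (x : T) : nat := (\sum_(y | e x y) 1)%N.

Hypothesis e_sym : symmetric e.
Hypothesis fdeg_gt0 : forall x, (0 < fdeg x)%N.
Hypothesis bd_indep : forall x y, x \in bd -> y \in bd -> ~~ e x y.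
Hypothesis e_connected : forall x y, connect e x y.
Hypothesis v_bd : v \in bd.
Hypothesis w_bd : w \in bd.
Hypothesis vw : v != w.
Hypothesis bd_homog : forall x1 x2 y1 y2, x1 \in bd -> x2 \in bd -> x1 != x2 ->
  y1 \in bd -> y2 \in bd -> y1 != y2 -> exists f : T -> T,
  [/\ injective f, forall x y, e (f x) (f y) = e x y, f x1 = y1 & f x2 = y2].

Hypothesis e_lower : forall phi : T -> C,
  0 <= \sum_x \sum_(y | e x y) phi x * (phi y)^* +
       ((#|bd|%:R - 1)^-1)%:C * \sum_x (fdeg x)%:R * (phi x * (phi x)^*).

Let th : nat := #|bd|.
Let c : R := (th%:R - 1)^-1.

Let th_gt1 : (1 < th)%N.
Proof.
rewrite /th (cardD1 v) v_bd (cardD1 w) !inE w_bd.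
by rewrite eq_sym vw.
Qed.

Let c_gt0 : 0 < c.
Proof. by rewrite /c invr_gt0 subr_gt0 ltr1n. Qed.

Let c_le1 : c <= 1.
Proof.
rewrite /c invf_le1; first by rewrite lerBrDr -[1 + 1]/(2%:R) ler_nat.
by rewrite subr_gt0 ltr1n.
Qed.

Let rt x : R := Num.sqrt (fdeg x)%:R.

Let rt_gt0 x : 0 < rt x.
Proof. by rewrite sqrtr_gt0 ltr0n. Qed.

Let rt_sqr x : rt x ^+ 2 = (fdeg x)%:R.
Proof. by rewrite sqr_sqrtr// ler0n. Qed.

(** The transition matrix conjugated by the square roots of the degrees, which makes it
    Hermitian. *)
Let hfun x y : C := if e x y then ((rt x * rt y)^-1)%:C else 0.

Let H : 'M[C]_#|T| := mxfun hfun.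

Let P := spectralmx H.
Let Pf i x : C := P i (enum_rank x).

Let H_herm : H \is hermsymmx.
Proof.
apply: realsym_hermsym.
  apply/is_hermitianmxP; apply/matrixP => i j; rewrite !mxE expr0 mul1r /hfun e_sym.
  by case: ifP => // _; rewrite mulrC.
apply/mxOverP => i j; rewrite mxE /hfun; case: ifP => _; last exact: real0.
by apply/complex_realP; eexists.
Qed.

Definition eigen i : R := complex.Re (spectral_diag H 0 i).

Let spectralE : P *m H = diag_mx (spectral_diag H) *m P.
Proof.
have /orthomx_spectralP := hermitian_normalmx H_herm.
rewrite -/P => HE.
have -> : P *m H = P *m (invmx P *m diag_mx (spectral_diag H) *m P) by rewrite -HE.
by rewrite !mulmxA mulmxV ?mul1mx// spectral_unit.
Qed.

Let eigenE i : spectral_diag H 0 i = (eigen i)%:C.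
Proof.
have /mxOverP/(_ 0 i) := hermitian_spectral_diag_real H_herm.
by move=> /RRe_real.
Qed.

Let eigen_eq i z : \sum_x Pf i x * hfun x z = (eigen i)%:C * Pf i z.
Proof.
have /matrixP/(_ i (enum_rank z)) := spectralE; rewrite mul_diag_mx !mxE eigenE => <-.
rewrite -(sum_enum_val (fun x => Pf i x * hfun x z)); apply: eq_bigr => j _.
by rewrite /Pf enum_valK !mxE enum_rankK.
Qed.

Let orth x z : \sum_i (Pf i x)^* * Pf i z = (x == z)%:R.
Proof.
have uP : P \is unitarymx by exact: spectral_unitarymx.
have /unitarymxP/mulmx1C/matrixP/(_ (enum_rank x) (enum_rank z)) := uP.
rewrite !mxE (inj_eq enum_rank_inj) => <-.
by apply: eq_bigr => i _; rewrite !mxE.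
Qed.

Let norm1 i : \sum_x Pf i x * (Pf i x)^* = 1.
Proof.
have uP : P \is unitarymx by exact: spectral_unitarymx.
have /unitarymxP/matrixP/(_ i i) := uP; rewrite !mxE eqxx mulr1n => <-.
rewrite -sum_enum_val; apply: eq_bigr => j _.
by rewrite /Pf enum_valK !mxE.
Qed.

Let mul_conj (z : C) : (z * z^*)%R = (cabs z ^+ 2)%:C.
Proof. by rewrite -sqr_normc normcE_cabs rmorphXn. Qed.

Let rtC x : (rt x)%:C != 0.
Proof. by rewrite fmorph_eq0 gt_eqF. Qed.

Let phi i x : C := Pf i x / (rt x)%:C.

Let conj_phi i x : ((phi i x)^*)%R = (Pf i x)^*%R / (rt x)%:C.
Proof.
rewrite /phi -fmorphV /=; case: (Pf i x) => p q; apply/eqP; rewrite eq_complex /=.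
by apply/andP; split; apply/eqP; ring.
Qed.

Let phi_energy i : \sum_x \sum_(y | e x y) phi i x * (phi i y)^* = (eigen i)%:C.
Proof.
under eq_bigr do under eq_bigr do rewrite conj_phi /phi.
rewrite -[RHS]mulr1 -(norm1 i) mulr_sumr (exchange_big_dep xpredT) //.
apply: eq_bigr => y _; rewrite mulrA -eigen_eq mulr_suml big_mkcond.
apply: eq_bigr => x _; rewrite /hfun.
have [exy|/negbTE exy] := boolP (e x y); rewrite ?exy /=; last by rewrite mulr0 mul0r.
have -> : ((rt x * rt y)^-1)%:C = (rt x)%:C^-1 * (rt y)%:C^-1.
  by rewrite -!fmorphV -rmorphM invfM.
move: (rt x)%:C^-1 (rt y)%:C^-1 (Pf i x) (Pf i y)^*%R => p q r t.
by rewrite [t * q]mulrC -!mulrA.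
Qed.

Let degC x : (fdeg x)%:R = (rt x)%:C ^+ 2 :> C.
Proof. by rewrite -rmorphXn /= rt_sqr rmorph_nat. Qed.

Let phi_norm i : \sum_x (fdeg x)%:R * (phi i x * (phi i x)^*) = 1.
Proof.
rewrite -[RHS](norm1 i); apply: eq_bigr => x _.
rewrite degC conj_phi /phi; move: (Pf i x) (Pf i x)^*%R (rt x)%:C (rtC x) => p q r r0.
by field.
Qed.

Let eigen_lower i : - c <= eigen i.
Proof.
have := e_lower (phi i); rewrite phi_energy phi_norm mulr1 -rmorphD /= ler0c.
by rewrite -lerBlDr sub0r.
Qed.

(** The Dirichlet form as a sum of squares: its sign gives the upper bound 1 on the spectrum, and
    its vanishing makes eigenfunctions for 1 constant along edges. *)
Let phi_dirichlet i : \sum_x \sum_(y | e x y)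
  (phi i x - phi i y) * (phi i x - phi i y)^* = (2 - 2 * eigen i)%:C.
Proof.
transitivity (\sum_x \sum_(y | e x y) (phi i x * (phi i x)^* +
    phi i y * (phi i y)^* - phi i x * (phi i y)^* - phi i y * (phi i x)^*)).
  apply: eq_bigr => x _; apply: eq_bigr => y _; rewrite rmorphB /=.
  move: (phi i x) (phi i y) (phi i x)^*%R (phi i y)^*%R => p q p' q'.
  by ring.
have swap (F : T -> T -> C) : \sum_x \sum_(y | e x y) F y x =
    \sum_x \sum_(y | e x y) F x y.
  rewrite (exchange_big_dep xpredT) //=; apply: eq_bigr => x _; apply: eq_bigl => y.
  by rewrite e_sym.
have diag : \sum_x \sum_(y | e x y) phi i x * (phi i x)^* = 1.
  rewrite -[RHS](phi_norm i); apply: eq_bigr => x _.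
  rewrite /fdeg natr_sum mulr_suml; apply: eq_bigr => y _.
  by rewrite mul1r.
under eq_bigr do rewrite !sumrB big_split /=.
rewrite !sumrB big_split /= (swap (fun x y => phi i x * (phi i x)^*)).
rewrite (swap (fun x y => phi i x * (phi i y)^*)) diag phi_energy.
by rewrite rmorphB rmorphM /= !rmorph_nat; ring.
Qed.

Let sqr_ge0C (z : C) : 0 <= (z * z^*)%R.
Proof. by rewrite mul_conj ler0c sqr_ge0. Qed.

Let eigen_le1 i : eigen i <= 1.
Proof.
have : 0 <= (2 - 2 * eigen i)%:C.
  rewrite -phi_dirichlet; apply: sumr_ge0 => x _; apply: sumr_ge0 => y _.
  exact: sqr_ge0C.
by rewrite ler0c; lra.
Qed.

Let eigen1_const i : eigen i = 1 -> forall x y, phi i x = phi i y.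
Proof.
move=> e1.
have edge x y : e x y -> phi i x = phi i y.
  move=> exy.
  have s0 : \sum_x \sum_(y | e x y) (phi i x - phi i y) * (phi i x - phi i y)^* = 0.
    by rewrite phi_dirichlet e1 mulr1 subrr.
  have s1 := psumr_eq0P (fun x' _ => sumr_ge0 _ (fun y' _ => sqr_ge0C _)) s0.
  have /eqP := psumr_eq0P (fun y' _ => sqr_ge0C _) (s1 x isT) exy.
  by rewrite mulf_eq0 conjC_eq0 orbb subr_eq0 => /eqP.
move=> x y; have /connectP[p pp ->] := e_connected x y.
elim: p x pp => //= z p IH x /andP[xz zp]; rewrite (edge _ _ xz); exact: IH.
Qed.

Let fdeg_perm (f : T -> T) x : injective f ->
  (forall x y, e (f x) (f y) = e x y) -> fdeg (f x) = fdeg x.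
Proof.
move=> fi fe; rewrite /fdeg [LHS](reindex_inj fi) /=.
by apply: eq_bigl => y; rewrite fe.
Qed.

Let bd_deg x y : x \in bd -> y \in bd -> fdeg x = fdeg y.
Proof.
move=> xb yb; have [->//|xy] := eqVneq x y.
have yx : y != x by rewrite eq_sym.
have [f [fi fe <- _]] := bd_homog xb yb xy yb xb yx.
by rewrite fdeg_perm.
Qed.

Let rt_bd x y : x \in bd -> y \in bd -> rt x = rt y.
Proof. by move=> xb yb; rewrite /rt (bd_deg xb yb). Qed.

Let eigen1_bd i : eigen i = 1 -> Pf i v = Pf i w.
Proof.
move=> e1; have := eigen1_const e1 v w; rewrite /phi (rt_bd v_bd w_bd).
by move/(mulIf (invr_neq0 (rtC w))).
Qed.

(** [aw] and [bw] are the spectral measures of two unit vectors: the boundary indicator divided by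
    sqrt th, and the difference of the point masses at [v] and [w] divided by sqrt 2. *)
Let aw i : R := cabs (\sum_(x in bd) Pf i x) ^+ 2 / th%:R.
Let bw i : R := cabs (Pf i v - Pf i w) ^+ 2 / 2.

Let aC i : (aw i)%:C = th%:R^-1 * \sum_(x in bd) \sum_(y in bd) (Pf i x)^* * Pf i y.
Proof.
have -> : (aw i)%:C = th%:R^-1 * (cabs (\sum_(x in bd) Pf i x) ^+ 2)%:C.
  by rewrite /aw rmorphM fmorphV rmorph_nat mulrC.
rewrite -mul_conj; congr (_ * _).
rewrite mulrC rmorph_sum mulr_suml; apply: eq_bigr => x _.
by rewrite mulr_sumr.
Qed.

Let bC i : (bw i)%:C = 2^-1 * ((Pf i v)^* * Pf i v + (Pf i w)^* * Pf i w -
  (Pf i v)^* * Pf i w - (Pf i w)^* * Pf i v)%R.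
Proof.
have -> : (bw i)%:C = 2^-1 * (cabs (Pf i v - Pf i w) ^+ 2)%:C.
  by rewrite /bw rmorphM fmorphV rmorph_nat mulrC.
rewrite -mul_conj; congr (_ * _).
rewrite rmorphB /=; move: (Pf i v) (Pf i w) (Pf i v)^*%R (Pf i w)^*%R => p q p' q'.
by ring.
Qed.

(** The entry (x, y) of g(H) over an extension field; g = 1, kappa and 1 / (1 - kappa z) give the
    identity, [H] and the resolvent. *)
Let sp (K : fieldType) (io : {rmorphism C -> K}) (g : 'I_#|T| -> K) x y : K :=
  \sum_i io ((Pf i x)^* * Pf i y) * g i.

Let sum_aw (K : fieldType) (io : {rmorphism C -> K}) (g : 'I_#|T| -> K) :
  \sum_i io (aw i)%:C * g i =
  th%:R^-1 * \sum_(x in bd) \sum_(y in bd) sp io g x y.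
Proof.
under eq_bigr do rewrite aC rmorphM fmorphV rmorph_nat -mulrA.
rewrite -mulr_sumr; congr (_ * _).
under eq_bigr do rewrite rmorph_sum mulr_suml.
rewrite exchange_big; apply: eq_bigr => x _.
under eq_bigr do rewrite rmorph_sum mulr_suml.
by rewrite exchange_big.
Qed.

Let sum_bw (K : fieldType) (io : {rmorphism C -> K}) (g : 'I_#|T| -> K) :
  \sum_i io (bw i)%:C * g i =
  2^-1 * (sp io g v v + sp io g w w - sp io g v w - sp io g w v).
Proof.
under eq_bigr do rewrite bC rmorphM fmorphV rmorph_nat -mulrA.
rewrite -mulr_sumr; congr (_ * _).
rewrite /sp -big_split -!sumrB; apply: eq_bigr => i _.
by rewrite !rmorphB rmorphD !mulrBl mulrDl.
Qed.

Let sp_h x z : sp (idfun : {rmorphism C -> C}) (fun i => (eigen i)%:C) x z = hfun x z.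
Proof.
transitivity (\sum_i \sum_y ((Pf i x)^* * Pf i y) * hfun y z).
  apply: eq_bigr => i _ /=; rewrite -mulrA [Pf i z * _]mulrC -eigen_eq mulr_sumr.
  by apply: eq_bigr => y _; rewrite mulrA.
rewrite exchange_big (bigD1 x)//= -mulr_suml orth eqxx mul1r big1 ?addr0// => y yx.
by rewrite -mulr_suml orth eq_sym (negbTE yx) mul0r.
Qed.

Let sum_delta (K : nzRingType) x : x \in bd -> \sum_(y in bd) (x == y)%:R = 1 :> K.
Proof.
move=> xb; rewrite (bigD1 x)//= eqxx big1 ?addr0// => y /andP[_ yx].
by rewrite eq_sym (negbTE yx).
Qed.

Let thK (K : fieldType) (io : {rmorphism C -> K}) n : (0 < n)%N -> n%:R != 0 :> K.
Proof. by move=> n0; rewrite -(rmorph_nat io) fmorph_eq0 pnatr_eq0 -lt0n. Qed.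

Let sp_1 x z : sp (idfun : {rmorphism C -> C}) (fun=> 1) x z = (x == z)%:R.
Proof. by rewrite -orth; apply: eq_bigr => i _; rewrite mulr1. Qed.

Let aw_sum : \sum_i aw i = 1.
Proof.
apply: (@complexI R); rewrite rmorph_sum rmorph1.
transitivity (\sum_i (idfun : {rmorphism C -> C}) (aw i)%:C * 1).
  by apply: eq_bigr => i _; rewrite mulr1.
rewrite sum_aw; under eq_bigr => x xb.
  under eq_bigr do rewrite sp_1.
  rewrite sum_delta//.
  over.
by rewrite sumr_const mulVf// pnatr_eq0 -lt0n; exact: ltnW.
Qed.

Let bw_sum : \sum_i bw i = 1.
Proof.
apply: (@complexI R); rewrite rmorph_sum rmorph1.
transitivity (\sum_i (idfun : {rmorphism C -> C}) (bw i)%:C * 1).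
  by apply: eq_bigr => i _; rewrite mulr1.
rewrite sum_bw !sp_1 !eqxx (eq_sym w v) (negbTE vw) !subr0.
by rewrite mulVf// pnatr_eq0.
Qed.

Let hfun_bd x y : x \in bd -> y \in bd -> hfun x y = 0.
Proof. by move=> xb yb; rewrite /hfun (negbTE (bd_indep xb yb)). Qed.

(** The mean is the quadratic form of [H] at a vector supported on the boundary, where no two
    vertices are adjacent. *)
Let aw_eigen : \sum_i aw i * eigen i = 0.
Proof.
apply: (@complexI R); rewrite rmorph_sum rmorph0.
transitivity (\sum_i (idfun : {rmorphism C -> C}) (aw i)%:C * (eigen i)%:C).
  by apply: eq_bigr => i _; rewrite rmorphM.
rewrite sum_aw big1 ?mulr0// => x xb; rewrite big1// => y yb.
by rewrite sp_h hfun_bd.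
Qed.

Let bw_eigen : \sum_i bw i * eigen i = 0.
Proof.
apply: (@complexI R); rewrite rmorph_sum rmorph0.
transitivity (\sum_i (idfun : {rmorphism C -> C}) (bw i)%:C * (eigen i)%:C).
  by apply: eq_bigr => i _; rewrite rmorphM.
by rewrite sum_bw !sp_h !hfun_bd// !subr0 addr0 mulr0.
Qed.

Let aw_ge0 i : 0 <= aw i.
Proof. by rewrite divr_ge0// sqr_ge0. Qed.

Let bw_ge0 i : 0 <= bw i.
Proof. by rewrite divr_ge0// sqr_ge0. Qed.

Let bw_one i : eigen i = 1 -> bw i = 0.
Proof.
by move/eigen1_bd => vwE; rewrite /bw vwE subrr /cabs normr0 /= expr0n mul0r.
Qed.

(* The vector of square roots of the degrees is fixed by H, so only the
   eigenvectors of eigenvalue 1 contribute to its expansion. *)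
Let stationary i : (eigen i)%:C * (\sum_x Pf i x * (rt x)%:C) = \sum_x Pf i x * (rt x)%:C.
Proof.
rewrite mulr_sumr.
transitivity (\sum_z \sum_x Pf i x * (hfun x z * (rt z)%:C)).
  apply: eq_bigr => z _; rewrite mulrA -eigen_eq mulr_suml.
  by apply: eq_bigr => x _; rewrite mulrA.
rewrite exchange_big; apply: eq_bigr => x _; rewrite -mulr_sumr; congr (_ * _).
transitivity (\sum_(z | e x z) (rt x)%:C^-1).
  rewrite [RHS]big_mkcond; apply: eq_bigr => z _; rewrite /hfun.
  case: (e x z); last by rewrite mul0r.
  by rewrite -fmorphV -rmorphM invfM mulfVK// gt_eqF.
transitivity ((fdeg x)%:R * (rt x)%:C^-1).
  by rewrite /fdeg natr_sum mulr_suml; apply: eq_bigr => z _; rewrite mul1r.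
by rewrite degC expr2 mulfK.
Qed.

(** Otherwise the boundary indicator would be orthogonal to the vector of square roots of degrees,
    although their product is a sum of positive terms. *)
Let aw_one : exists2 i, eigen i = 1 & 0 < aw i.
Proof.
apply: contrapT => none.
have a0 i : eigen i = 1 -> \sum_(x in bd) Pf i x = 0.
  move=> e1; have : ~~ (0 < aw i) by apply/negP => a_gt0; apply: none; exists i.
  rewrite lt_def aw_ge0 andbT negbK => /eqP aw0.
  have : (\sum_(x in bd) Pf i x) * (\sum_(x in bd) Pf i x)^*%R = 0.
    have th0 : th%:R != 0 :> R by rewrite pnatr_eq0 -lt0n; exact: ltnW.
    by rewrite mul_conj -[cabs _ ^+ 2](divfK th0) -/(aw i) aw0 mul0r.
  by move/eqP; rewrite mulf_eq0 conjC_eq0 orbb => /eqP.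
have : \sum_(b in bd) (rt b)%:C = 0 :> C.
  transitivity (\sum_i (\sum_(b in bd) (Pf i b)^*) * \sum_x Pf i x * (rt x)%:C); last first.
    rewrite big1// => i _; have [e1|e1] := eqVneq (eigen i) 1.
      by rewrite -rmorph_sum a0// rmorph0 mul0r.
    have e1C : (eigen i)%:C - 1 != 0.
      by rewrite -[1]/(1%:C) -rmorphB fmorph_eq0 subr_eq0.
    have /eqP := stationary i; rewrite -subr_eq0 -[X in _ - X]mul1r -mulrBl.
    by rewrite mulf_eq0 (negbTE e1C) => /eqP ->; rewrite mulr0.
  under [RHS]eq_bigr do rewrite mulr_suml.
  rewrite [RHS]exchange_big; apply: eq_bigr => b _.
  under [RHS]eq_bigr do rewrite mulr_sumr.
  rewrite [RHS]exchange_big (bigD1 b)//=.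
  under eq_bigr do rewrite mulrA.
  rewrite -mulr_suml orth eqxx mul1r big1 ?addr0// => x xb.
  under eq_bigr do rewrite mulrA.
  by rewrite -mulr_suml orth eq_sym (negbTE xb) mul0r.
rewrite -rmorph_sum => /eqP; rewrite fmorph_eq0 psumr_eq0; last by move=> x _; exact: ltW.
by move/allP/(_ v); rewrite mem_index_enum v_bd gt_eqF// => /(_ isT).
Qed.

(** * Green function over the rational functions *)

Section Resolvent.
Variables (Kz : fieldType) (h : {rmorphism {poly C} -> Kz}).
Hypothesis h_eq0 : forall p, (h p == 0) = (p == 0).
Let iota : {rmorphism C -> Kz} := (h \o polyC)%FUN.
Let Z : Kz := h 'X.
Let den i : Kz := 1 - iota (eigen i)%:C * Z.

Let denE i : den i = h (1 - (eigen i)%:C *: 'X).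
Proof. by rewrite rmorphB rmorph1 -mul_polyC rmorphM. Qed.

Let den_neq0 i : den i != 0.
Proof.
rewrite denE h_eq0; apply/eqP => /(congr1 (horner^~ 0)).
rewrite hornerD hornerN hornerZ hornerX mulr0 oppr0 addr0 horner0.
rewrite -[1 in LHS]/(1%:P) hornerC => /eqP.
by rewrite oner_eq0.
Qed.

Let iota1 : iota 1%:C = 1.
Proof. by rewrite -[RHS](rmorph1 iota). Qed.

Let iota_div x : iota (rt x / rt x)%:C = 1.
Proof. by rewrite divff ?gt_eqF// iota1. Qed.

Let prod_den_neq0 : \prod_i den i != 0.
Proof.
apply: (big_ind (fun x => x != 0)); first exact: oner_neq0.
  by move=> x y; exact: mulf_neq0.
by move=> i _; exact: den_neq0.
Qed.

Let S x y := sp iota (fun i => (den i)^-1) x y.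

Let S_inv x z : \sum_y S x y * ((y == z)%:R - Z * iota (hfun y z)) = (x == z)%:R.
Proof.
have key i : \sum_y iota (Pf i y) * ((y == z)%:R - Z * iota (hfun y z)) =
    den i * iota (Pf i z).
  under eq_bigr do rewrite mulrBr mulrCA -rmorphM.
  rewrite sumrB -mulr_sumr -rmorph_sum eigen_eq rmorphM /den mulrBl mul1r.
  congr (_ - _); last by rewrite mulrCA mulrA.
  rewrite (bigD1 z)//= eqxx mulr1 big1 ?addr0// => y yz.
  by rewrite (negbTE yz) mulr0.
under eq_bigr do rewrite mulr_suml.
rewrite exchange_big -(rmorph_nat iota) -orth rmorph_sum; apply: eq_bigr => i _.
transitivity (iota (Pf i x)^*%R / den i * \sum_y iota (Pf i y) *
    ((y == z)%:R - Z * iota (hfun y z))).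
  rewrite mulr_sumr; apply: eq_bigr => y _; rewrite rmorphM !mulrA.
  by congr (_ * _); rewrite mulrAC.
by rewrite key mulrA mulfVK// -rmorphM.
Qed.

Let Q x y : Kz := if e x y then (fdeg x)%:R^-1 else 0.

Let hQ y z : iota (hfun y z) = iota (rt y / rt z)%:C * Q y z.
Proof.
rewrite /hfun /Q; case: (e y z); last by rewrite rmorph0 mulr0.
rewrite -(rmorph_nat iota) degC -fmorphV -rmorphM; congr (iota _).
rewrite -rmorphXn -fmorphV -rmorphM; congr (_%:C).
by field; rewrite !gt_eqF.
Qed.

(** Undoes the conjugation by degrees: the Green function of the walk itself. *)
Let Gf x y := iota (rt y / rt x)%:C * S x y.

Let Gf_inv x z : \sum_y Gf x y * ((y == z)%:R - Z * Q y z) = (x == z)%:R.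
Proof.
transitivity (\sum_y iota (rt z / rt x)%:C *
    (S x y * ((y == z)%:R - Z * iota (hfun y z)))).
  apply: eq_bigr => y _; rewrite hQ /Gf.
  have rE : iota (rt y / rt x)%:C = iota (rt z / rt x)%:C * iota (rt y / rt z)%:C.
    rewrite -!rmorphM; congr (iota _%:C); field.
    by rewrite !gt_eqF.
  have [->|yz] := eqVneq y z.
    by rewrite iota_div mul1r mulrA.
  rewrite rE; move: (iota _) (iota _) (S x y) (Q y z) => p q r t.
  by rewrite !sub0r; ring.
rewrite -mulr_sumr S_inv; have [->|_] := eqVneq x z; last by rewrite mulr0.
by rewrite iota_div mul1r.
Qed.

Let Gf_S x y : x \in bd -> y \in bd -> S x y = Gf x y.
Proof.
move=> xb yb; rewrite /Gf (rt_bd xb yb).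
by rewrite iota_div mul1r.
Qed.

Let Gf_perm (f : T -> T) x y : injective f ->
  (forall x y, e (f x) (f y) = e x y) -> Gf (f x) (f y) = Gf x y.
Proof.
move=> fi fe.
apply: (left_inverse_perm fi Gf_inv) => x' y'.
by rewrite (inj_eq fi) /Q fe fdeg_perm.
Qed.

(** Automorphisms preserve the Green function, so double transitivity leaves one value on the
    diagonal of the boundary and one off it. *)
Let Gf_bd x y : x \in bd -> y \in bd ->
  Gf x y = Gf v w + (x == y)%:R * (Gf v v - Gf v w).
Proof.
move=> xb yb; have [<-|xy] := eqVneq x y; last first.
  have [f [fi fe <- <-]] := bd_homog v_bd w_bd vw xb yb xy.
  by rewrite Gf_perm// mul0r addr0.
rewrite mul1r addrC subrK; have [->//|xv] := eqVneq x v.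
have vx : v != x by rewrite eq_sym.
have [f [fi fe <- _]] := bd_homog v_bd xb vx xb v_bd xv.
by rewrite Gf_perm.
Qed.

Let Gf_colsum y : y \in bd ->
  \sum_(x in bd) Gf x y = Gf v v + (th%:R - 1) * Gf v w.
Proof.
move=> yb; under eq_bigr => x xb do rewrite Gf_bd// eq_sym.
move: (Gf v v) (Gf v w) => p q.
rewrite big_split -mulr_suml sum_delta// mul1r sumr_const -/th -[q *+ _]mulr_natl /=.
by ring.
Qed.

Let f1E : \sum_i iota (aw i)%:C / den i = Gf v v + (th%:R - 1) * Gf v w.
Proof.
rewrite (sum_aw iota (fun i => (den i)^-1)) exchange_big /=.
under eq_bigr => y yb.
  under eq_bigr => x xb do rewrite [sp _ _ _ _]Gf_S//.
  rewrite Gf_colsum//.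
  over.
move: (Gf v v + _) => X.
rewrite sumr_const -/th -[X *+ _]mulr_natl mulrA mulVf ?mul1r// (thK iota)//.
exact: ltnW.
Qed.

Let f2E : \sum_i iota (bw i)%:C / den i = Gf v v - Gf v w.
Proof.
rewrite (sum_bw iota (fun i => (den i)^-1)) -/(S _ _) -/(S v v) -/(S w w) -/(S v w).
rewrite -/(S w v) !Gf_S// (Gf_bd w_bd w_bd) (Gf_bd w_bd v_bd) eqxx eq_sym (negbTE vw).
have n2 : 2 != 0 :> Kz by rewrite (thK iota).
by move: (Gf v v) (Gf v w) => p q; rewrite mul1r mul0r; field.
Qed.

Let h_spectral (u : 'I_#|T| -> R) : h (spectral_poly eigen u) =
  (\prod_i den i) * \sum_i iota (u i)%:C / den i.
Proof.
rewrite /spectral_poly rmorph_sum mulr_sumr; apply: eq_bigr => i _.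
rewrite -mul_polyC rmorphM rmorph_prod [in RHS](bigD1 i)//=.
have -> : \prod_(j | j != i) h (1 - (eigen j)%:C *: 'X) =
    \prod_(j | j != i) den j by apply: eq_bigr => j _; rewrite denE.
move: (\prod_(_ | _) _) (den_neq0 i) => p; move: (den i) => D D0.
by rewrite [D * p]mulrC mulrACA mulfV// mulr1 mulrC.
Qed.

Let cE : iota c%:C = (th%:R - 1)^-1.
Proof. by rewrite /c !fmorphV !rmorphB !rmorph_nat !rmorph1. Qed.

Let th1_neq0 : th%:R - 1 != 0 :> Kz.
Proof.
rewrite -[th](@prednK th) ?(ltnW th_gt1)// -natr1 addrK (thK iota)//.
by rewrite -ltnS (ltn_predK th_gt1).
Qed.

Let spectral_numE : h (spectral_poly eigen (fun i => aw i - bw i)) =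
  (\prod_i den i) * (th%:R * Gf v w).
Proof.
rewrite h_spectral; congr (_ * _).
under eq_bigr do rewrite !rmorphB mulrBl.
rewrite sumrB f1E f2E; move: (Gf v v) (Gf v w) => p q; ring.
Qed.

Let spectral_denE : h (spectral_poly eigen (fun i => aw i + c * bw i)) =
  (\prod_i den i) * (th%:R / (th%:R - 1) * (Gf v v + (th%:R - 2) * Gf v w)).
Proof.
rewrite h_spectral; congr (_ * _).
have gen (x y z : R) (D : Kz) : iota (x + y * z)%:C * D =
    iota x%:C * D + iota y%:C * (iota z%:C * D).
  by rewrite !rmorphD !rmorphM mulrDl mulrA.
under eq_bigr do rewrite gen.
rewrite big_split -mulr_sumr f1E f2E cE /=; move: (Gf v v) (Gf v w) => p q.
have t1 := th1_neq0; have e2 : (th%:R - 2 : Kz) = (th%:R - 1) - 1 by ring.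
have e3 : (th%:R : Kz) = (th%:R - 1) + 1 by ring.
rewrite e2 [X in _ = X / _ * _]e3; move: (th%:R - 1) t1 => t t1.
by field.
Qed.

(** Up to nonzero factors this is the denominator polynomial, whose value at 0 is 1 + c. *)
Let sigma_neq0 : Gf v v + (th%:R - 2) * Gf v w != 0.
Proof.
have : spectral_poly eigen (fun i => aw i + c * bw i) != 0.
  apply/eqP => /(congr1 (horner^~ 0)); rewrite spectral_poly0 horner0 => /eqP.
  have -> : \sum_i (aw i + c * bw i) = 1 + c.
    by rewrite big_split -mulr_sumr aw_sum bw_sum mulr1.
  rewrite fmorph_eq0 => /eqP.
  by move: c_gt0; lra.
apply: contraNneq => s0; rewrite -h_eq0 spectral_denE s0.
by rewrite !mulr0.
Qed.

Let resolvent_unit n (M : 'M[C]_n) : 1%:M - Z *: map_mx iota M \in unitmx.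
Proof.
pose M' : 'M[{poly C}]_n := 1%:M - 'X *: map_mx polyC M.
have -> : 1%:M - Z *: map_mx iota M = map_mx h M'.
  by apply/matrixP => i j; rewrite !mxE rmorphB rmorphM rmorph_nat.
rewrite unitmxE det_map_mx unitfE h_eq0; apply/eqP => d0.
have : (\det M').[0] = 1.
  rewrite -[LHS]/(horner_eval 0 (\det M')) -det_map_mx -[RHS](det1 C n); congr (\det _).
  apply/matrixP => i j; rewrite !mxE /= /horner_eval hornerD hornerN hornerM hornerX.
  by rewrite mul0r oppr0 addr0 -polyC_natr hornerC.
by rewrite d0 horner0 => /esym/eqP; rewrite oner_eq0.
Qed.

(** With G the Green function, f1 - f2 = th G(v,w) and f1 + c f2 = th/(th - 1) (G(v,v) + (th - 2)
    G(v,w)), the last bracket being the sum of a column of G over the absorbing vertices. *)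
Lemma resolvent_spectral : (#|bd|%:R - 1) * invmx (1%:M - h 'X *: mxfun (fun x y =>
    if x \in [pred x in bd | x != v] then 0
    else if e x y then (fdeg x)%:R^-1 else 0)) (enum_rank v) (enum_rank w) =
  h (spectral_poly eigen (fun i => aw i - bw i)) /
  h (spectral_poly eigen (fun i => aw i + c * bw i)).
Proof.
have D0 := prod_den_neq0.
have th0 : th%:R != 0 :> Kz by rewrite (thK iota)//; exact: ltnW.
rewrite spectral_numE spectral_denE.
rewrite (@absorbed_inverse _ _ Q Gf Z _ v w (Gf v w)
    (Gf v v + (th%:R - 2) * Gf v w)) //.
- rewrite -/th; move: sigma_neq0 th0 th1_neq0 D0.
  move: (\prod_i _) (Gf v v) (Gf v w) => D p q s0 t0 t1 D0.
  by field; rewrite t1 s0 t0 D0.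
- by rewrite !inE eqxx andbF.
- by rewrite !inE w_bd eq_sym vw.
- move=> b; rewrite !inE => /andP[bb bv].
  by rewrite Gf_bd// eq_sym (negbTE bv) mul0r addr0.
- move=> b; rewrite !inE => /andP[bb bv].
  have := Gf_colsum bb; rewrite (bigD1 v)//= (Gf_bd v_bd bb) eq_sym (negbTE bv).
  rewrite mul0r addr0 => E.
  have -> : \sum_(x in [pred x in bd | x != v]) Gf x b =
      \sum_(i in bd | i != v) Gf i b by apply: eq_bigl => x; rewrite !inE.
  by apply: (addrI (Gf v w)); rewrite E; ring.
- have -> : mxfun (fun x y => if x \in [pred x in bd | x != v] then 0 else Q x y) =
    map_mx iota (mxfun (fun x y => if x \in [pred x in bd | x != v] then 0
      else if e x y then (fdeg x)%:R^-1 else 0)).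
    apply/matrixP => i j; rewrite !mxE /Q; case: ifP => _; first by rewrite rmorph0.
    by case: ifP => _; rewrite ?rmorph0// fmorphV rmorph_nat.
  exact: resolvent_unit.
Qed.

End Resolvent.

Theorem finite_graph_julia (d : {fraction {poly C}}) :
  d = (#|bd|%:R - 1) * invmx (1%:M - tofrac 'X *: mxfun (fun x y =>
    if x \in [pred x in bd | x != v] then 0
    else if e x y then (fdeg x)%:R^-1 else 0)) (enum_rank v) (enum_rank w) ->
  real_interval (julia_set (ratfun_eval d)) \/ cantor_set (julia_set (ratfun_eval d)).
Proof.
move=> dE; apply: (@spectral_julia R _ eigen aw bw c) => //.
- by move=> i; rewrite eigen_lower eigen_le1.
- by rewrite aw_eigen bw_eigen.
rewrite dE; apply: (resolvent_spectral (h := @tofrac {poly C})) => p.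
exact: tofrac_eq0.
Qed.

End FiniteGraph.

(** * Lower spectral bound from a clique decomposition *)

Section CliqueDecomposition.
Context {R : realType} {T : finType}.
Variables (e : rel T) (Bs : {set {set T}}) (th : nat).
Local Notation C := R[i].
Hypothesis th_gt1 : (1 < th)%N.
Hypothesis e_clique : forall x y,
  reflect (x != y /\ exists B, [/\ B \in Bs, x \in B & y \in B]) (e x y).
Hypothesis clique_uniq : forall B B' x y, B \in Bs -> B' \in Bs -> x != y ->
  x \in B -> y \in B -> x \in B' -> y \in B' -> B = B'.
Hypothesis clique_card : forall B, B \in Bs -> (th <= #|B|)%N.

Let sum_cliques (g : T -> T -> C) : \sum_x \sum_(y | e x y) g x y =
  \sum_(B in Bs) (\sum_(x in B) \sum_(y in B) g x y - \sum_(x in B) g x x).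
Proof.
transitivity (\sum_(B in Bs) \sum_(x in B) \sum_(y in B | y != x) g x y); last first.
  apply: eq_bigr => B _; rewrite -sumrB; apply: eq_bigr => x xB.
  by rewrite [X in _ = X - _](bigD1 x)//= [RHS]addrC addKr.
rewrite [RHS](exchange_big_dep xpredT)//=; apply: eq_bigr => x _.
rewrite [RHS](exchange_big_dep xpredT)//= big_mkcond /=; apply: eq_bigr => y _.
have [/e_clique[xy [B0 [B0s xB0 yB0]]]|nexy] := boolP (e x y); last first.
  rewrite big_pred0// => B; apply/negbTE; apply: contraNN nexy.
  case/andP => /andP[Bs' xB] /andP[yB yx]; apply/e_clique; split; first by rewrite eq_sym.
  by exists B.
rewrite (bigD1 B0)/=; last by rewrite B0s xB0 yB0 eq_sym.
rewrite big_pred0 ?addr0// => B; apply/negbTE/negP.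
case/andP => /andP[/andP[Bs' xB] /andP[yB yx]] /eqP; apply.
exact: (clique_uniq Bs' B0s xy).
Qed.

(** On a clique [B] the adjacency form is |sum phi|^2 - sum |phi|^2 and the degree form is (|B| - 1)
    sum |phi|^2, so |B| >= th makes each clique contribute a nonnegative amount. *)
Lemma clique_lower (phi : T -> C) :
  0 <= \sum_x \sum_(y | e x y) phi x * (phi y)^* +
       ((th%:R - 1)^-1)%:C * \sum_x (fdeg e x)%:R * (phi x * (phi x)^*).
Proof.
have -> : \sum_x (fdeg e x)%:R * (phi x * (phi x)^*) =
    \sum_x \sum_(y | e x y) phi x * (phi x)^*.
  apply: eq_bigr => x _; rewrite /fdeg natr_sum mulr_suml; apply: eq_bigr => y _.
  by rewrite mul1r.
rewrite (sum_cliques (fun x y => phi x * (phi y)^*%R)).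
rewrite (sum_cliques (fun x y => phi x * (phi x)^*%R)).
rewrite mulr_sumr -big_split; apply: sumr_ge0 => B /clique_card thB /=.
have nn (z : C) : 0 <= (z * z^*)%R by rewrite mul_conjC_ge0.
have -> : \sum_(x in B) \sum_(y in B) phi x * (phi y)^* =
    (\sum_(x in B) phi x) * (\sum_(x in B) phi x)^*%R.
  by rewrite mulr_suml; apply: eq_bigr => x _; rewrite rmorph_sum mulr_sumr.
set n2 := \sum_(x in B) phi x * (phi x)^*.
have -> : \sum_(x in B) \sum_(y in B) phi x * (phi x)^* = #|B|%:R * n2.
  by rewrite mulr_sumr; apply: eq_bigr => x _; rewrite sumr_const mulr_natl.
set k := _%:C.
have -> : (\sum_(x in B) phi x) * (\sum_(x in B) phi x)^*%R - n2 +
    k * (#|B|%:R * n2 - n2) = (\sum_(x in B) phi x) * (\sum_(x in B) phi x)^*%R +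
    (k * (#|B|%:R - 1) - 1) * n2.
  by move: (_ * (_)^*%R) => z; ring.
apply: addr_ge0; first exact: nn.
apply: mulr_ge0; last by apply: sumr_ge0 => x _; exact: nn.
have -> : k * (#|B|%:R - 1) - 1 = ((th%:R - 1)^-1 * (#|B|%:R - 1) - 1)%:C.
  by rewrite rmorphB rmorphM rmorphB rmorph_nat !rmorph1.
have th1 : 0 < th%:R - 1 :> R by rewrite subr_gt0 ltr1n.
rewrite ler0c subr_ge0 mulrC ler_pdivlMr// mul1r lerD2r ler_nat.
exact: thB.
Qed.

End CliqueDecomposition.

(** * Cells of a self-similar graph *)

Section Cells.
Context {V : choiceType}.
Variables (adj : rel V) (F : set V).
Hypothesis adj_sym : symmetric adj.

Lemma connected_off_sym x y : connected_off adj F x y -> connected_off adj F y x.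
Proof.
case=> p []; elim: p x => [|z p IH] x /=.
  by move=> _ <- xF; exists [::].
case/andP=> xz zp pl /andP[xF zpF].
have [q [yq ql qF]] := IH z zp pl zpF.
exists (rcons q x); rewrite rcons_path yq ql adj_sym xz last_rcons; split=> //.
by rewrite -rcons_cons all_rcons xF.
Qed.

Lemma connected_off_trans x y z : connected_off adj F x y ->
  connected_off adj F y z -> connected_off adj F x z.
Proof.
case=> p [xp <- pF] [q [yq ql /= /andP[_ qF]]].
by exists (p ++ q); rewrite cat_path xp yq last_cat ql -cat_cons all_cat pF qF.
Qed.

Lemma cell_from C x : cells adj F C -> C x -> C = [set y | connected_off adj F x y].
Proof.
case=> x0 x0F -> /= x0x; apply/seteqP; split => y /= h.
  by apply: connected_off_trans h; exact: connected_off_sym.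
exact: connected_off_trans h.
Qed.

Lemma cell_notin C x : cells adj F C -> C x -> ~ F x.
Proof.
case=> x0 x0F -> /= [p [_ <- /allP h]].
by have := h _ (mem_last x0 p); rewrite notin_setE.
Qed.

Lemma cell_step C x y : cells adj F C -> C x -> adj x y -> ~ F y -> C y.
Proof.
move=> cC Cx xy yF; rewrite (cell_from cC Cx) /=; exists [:: y]; split=> //=.
  by rewrite xy.
apply/and3P; split=> //; rewrite notin_setE//.
exact: (cell_notin cC Cx).
Qed.

Lemma boundary_F C y : cells adj F C -> vboundary adj C y -> F y.
Proof.
move=> cC [Cy [x Cx xy]]; apply: contrapT => yF; apply: Cy.
exact: cell_step xy yF.
Qed.

Lemma cell_nbr C x y : cells adj F C -> C x -> adj x y -> vclosure adj C y.
Proof.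
move=> cC Cx xy; have [yF|yF] := pselect (F y); last by left; exact: cell_step xy yF.
by right; split; [move=> Cy; exact: (cell_notin cC Cy) | exists x].
Qed.

Lemma closure_notF C x : cells adj F C -> vclosure adj C x -> ~ F x -> C x.
Proof. by move=> cC [//|bx] xF; case: xF; exact: boundary_F bx. Qed.

Lemma closure_finite C : (forall x, finite_set [set y | adj x y]) ->
  finite_set C -> finite_set (vclosure adj C).
Proof.
move=> lf fC; rewrite /vclosure finite_setU; split=> //.
apply: (@sub_finite_set _ _ (\bigcup_(x in C) [set y | adj x y])).
  by move=> y [_ [x Cx xy]]; exists x.
by apply: bigcup_finite => // x _; exact: lf.
Qed.

End Cells.

(** * The cell as a finite graph *)

Section CellGraph.
Context {R : realType} {V : choiceType}.
Variables (adj : rel V) (F : set V) (C : set V).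
Hypothesis hX : infinite_graph adj.
Hypothesis hF : symmetrically_self_similar adj F.
Hypothesis hC : cells adj F C.
Variables (v w : cell_vertices adj C).
Hypothesis hv : vboundary adj C (val v).
Hypothesis hw : vboundary adj C (val w).
Hypothesis hvw : v != w.

Local Notation T := (cell_vertices adj C).

Let adj_sym : symmetric adj. Proof. by case: hX. Qed.
Let adj_irr : irreflexive adj. Proof. by case: hX. Qed.

Let cl_fin : finite_set (vclosure adj C).
Proof.
apply: closure_finite; first by case: hX.
by case: hF => _ fin _ _; exact: fin.
Qed.

Let in_T x : (x \in cell_vertices adj C) = (x \in vclosure adj C).
Proof. exact: in_fset_set. Qed.

Let clT (x : T) : vclosure adj C (val x).
Proof. by have := valP x; rewrite in_T inE. Qed.

Let toT x (cx : vclosure adj C x) : {t : T | val t = x}.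
Proof.
have xT : x \in cell_vertices adj C by rewrite in_T inE.
by exists [` xT]%fset.
Qed.

Let e : rel T := fun x y => adj (val x) (val y).
Let bd : {set T} := [set x : T | val x \in vboundary adj C]%SET.

Let in_bd x : (x \in bd) = (val x \in vboundary adj C).
Proof. by rewrite finset.inE. Qed.

Let bdP x : reflect (vboundary adj C (val x)) (x \in bd).
Proof. by rewrite in_bd; apply: (iffP idP); rewrite inE. Qed.

Let sum_T (P : pred V) : #|` [fset y in cell_vertices adj C | P y]%fset| =
  (\sum_(y : T | P (val y)) 1)%N.
Proof. by rewrite card_fset_sum1 -big_fset_condE big_seq_fsetE. Qed.

Let fdegE x : cell_degree adj C (val x) = fdeg e x.
Proof. exact: sum_T. Qed.

Let bd_card : #|` fset_set (vboundary adj C)| = #|bd|.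
Proof.
have -> : fset_set (vboundary adj C) =
    [fset y in cell_vertices adj C | y \in vboundary adj C]%fset.
  apply/fsetP => y; rewrite in_fset_set; last first.
    by apply: (sub_finite_set _ cl_fin) => z zb; right.
  rewrite !inE /=; apply/idP/andP => [yb|[_ //]]; split => //.
  by rewrite in_T inE; right; rewrite inE in yb.
by rewrite sum_T -sum1_card; apply: eq_bigl => x; rewrite in_bd.
Qed.

Let e_sym : symmetric e.
Proof. by move=> x y; exact: adj_sym. Qed.

Let bd_indep x y : x \in bd -> y \in bd -> ~~ e x y.
Proof.
move=> /bdP xb /bdP yb; case: hF => -[F1 _ _] _ _ _.
by apply: F1; [exact: boundary_F xb | exact: boundary_F yb].
Qed.

Let connect_path p : forall x y : T, C (val x) -> path adj (val x) p ->
  last (val x) p = val y -> all (fun z => z \notin F) (val x :: p) -> connect e x y.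
Proof.
elim: p => [|z p IH] x y Cx /=.
  by move=> _ /val_inj -> _.
case/andP=> xz zp pl /and3P[xF zF pF].
have Cz : C z by apply: (cell_step adj_sym hC Cx xz); move: zF; rewrite notin_setE.
have [t tz] := toT (or_introl Cz).
apply: (@connect_trans _ _ t); first by apply: connect1; rewrite /e tz.
by apply: IH; rewrite ?tz //= zF pF.
Qed.

Let connect_C (x y : T) : C (val x) -> C (val y) -> connect e x y.
Proof.
move=> Cx; rewrite [X in X (val y)](cell_from adj_sym hC Cx) => -[p [xp pl pF]].
exact: connect_path xp pl pF.
Qed.

Let connect_to_C (x : T) : exists2 t : T, C (val t) & connect e x t.
Proof.
have [Cx|[_ [y Cy yx]]] := clT x; first by exists x.
have [t tz] := toT (or_introl Cy).
by exists t; rewrite ?tz//; apply: connect1; rewrite /e tz adj_sym.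
Qed.

Let e_connected x y : connect e x y.
Proof.
have [t Ct xt] := connect_to_C x; have [s Cs ys] := connect_to_C y.
apply: (connect_trans xt); apply: (connect_trans (connect_C Ct Cs)).
by rewrite (sym_connect_sym e_sym).
Qed.

Let vw_bd : (v \in bd) * (w \in bd).
Proof. by split; apply/bdP. Qed.

Let fdeg_gt0 x : (0 < fdeg e x)%N.
Proof.
have [y xy] : exists y, e x y.
  have [z xz] : exists z, x != z.
    have [->|xv] := eqVneq x v; first by exists w.
    by exists v.
  have /connectP[[|t p] /=] := e_connected x z.
    by move=> _ zx; rewrite zx eqxx in xz.
  by case/andP => xt _ _; exists t.
by rewrite /fdeg (bigD1 y).
Qed.

Let bd_homog x1 x2 y1 y2 : x1 \in bd -> x2 \in bd -> x1 != x2 ->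
  y1 \in bd -> y2 \in bd -> y1 != y2 -> exists f : T -> T,
  [/\ injective f, forall x y, e (f x) (f y) = e x y, f x1 = y1 & f x2 = y2].
Proof.
move=> /bdP x1b /bdP x2b x12 /bdP y1b /bdP y2b y12.
case: hF => _ _ _ homog.
have nx : val x1 <> val x2 by move/val_inj/eqP; rewrite (negbTE x12).
have ny : val y1 <> val y2 by move/val_inj/eqP; rewrite (negbTE y12).
have [f [[[ff fi _] fe _] f1 f2]] := homog C hC _ _ _ _ x1b x2b nx y1b y2b ny.
pose g (x : T) : T := insubd x (f (val x)).
have gE x : val (g x) = f (val x).
  have xT : f (val x) \in cell_vertices adj C.
    by rewrite in_T; apply/mem_set; exact: ff (clT x).
  by rewrite val_insubd xT.
exists g; split.
- move=> x y /(congr1 val); rewrite !gE => /fi h; apply: val_inj.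
  by apply: h; rewrite inE; exact: clT.
- by move=> x y; rewrite /e !gE fe.
- by apply: val_inj; rewrite gE.
- by apply: val_inj; rewrite gE.
Qed.

Let bd_gt1 : (1 < #|bd|)%N.
Proof.
by apply/card_gt1P; exists v, w; rewrite !vw_bd.
Qed.

(* The isomorphism with the reduced graph turns the boundaries of cells into
   cliques covering each edge once; those meeting the cell in an edge lie in
   its closure, because an edge has an endpoint outside F. *)
Lemma cell_lower (phi : T -> R[i]) :
  0 <= \sum_x \sum_(y | e x y) phi x * (phi y)^* +
       ((#|bd|%:R - 1)^-1)%:C * \sum_x (fdeg e x)%:R * (phi x * (phi x)^*).
Proof.
case: hF => -[F1 F2 [f [[ff fi fs] fadj]]] _ S1 _.
have finj x y : f x = f y -> x = y by apply: fi; rewrite inE.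
pose BD (D : set V) : {set T} := [set u : T | f (val u) \in vboundary adj D]%SET.
have BDP D u : reflect (vboundary adj D (f (val u))) (u \in BD D).
  by rewrite finset.inE; apply: (iffP idP); rewrite inE.
pose Bs : {set {set T}} := [set B : {set T} | (1 < #|B|)%N &&
  `[< exists2 D, cells adj F D & B = BD D >] ]%SET.
have BsP (B : {set T}) : reflect ((1 < #|B|)%N /\ exists2 D, cells adj F D & B = BD D) (B \in Bs).
  rewrite finset.inE; apply: (iffP andP) => -[B1 B2]; split=> //.
    by move/asboolP: B2.
  exact/asboolP.
have edge D (x y : T) : cells adj F D -> x \in BD D -> y \in BD D -> x != y -> e x y.
  move=> cD /BDP xD /BDP yD xy; apply/fadj; split; last by exists D.
  by move/finj/val_inj/eqP; rewrite (negbTE xy).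
apply: (@clique_lower R T e Bs #|bd|) => //.
- move=> x y; apply: (iffP idP) => [exy|[xy [B [/BsP[_ [D cD ->]] xB yB]]]]; last first.
    exact: edge xB yB xy.
  have xy : x != y by apply: contraTneq exy => ->; rewrite /e adj_irr.
  split=> //; have /fadj[_ [D [cD xD yD]]] := exy.
  have xB : x \in BD D by apply/BDP.
  have yB : y \in BD D by apply/BDP.
  exists (BD D); split=> //; apply/BsP; split; last by exists D.
  by apply/card_gt1P; exists x, y.
- move=> B B' x y /BsP[_ [D cD ->]] /BsP[_ [D' cD' ->]] xy.
  move=> /BDP xD /BDP yD /BDP xD' /BDP yD'.
  have [->//|DD] := pselect (D = D').
  have := F2 D D' cD cD' DD (f (val x)) (f (val y)).
  have fxy : f (val x) <> f (val y).
    by move/finj/val_inj/eqP; rewrite (negbTE xy).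
  by move=> h; case: fxy; apply: h; split; right.
- move=> B /BsP[B1 [D cD BE]].
  (* Two vertices of the clique are adjacent, so one of them is outside [F] and thus in [C]. *)
  have [x xB Cx] : exists2 x : T, x \in BD D & C (val x).
    have /card_gt1P[x [y [xB yB xy]]] := B1.
    rewrite BE in xB yB; have exy := edge D x y cD xB yB xy.
    have [xF|xF] := pselect (F (val x)); last first.
      by exists x => //; exact: (closure_notF adj_sym hC (clT x) xF).
    exists y => //; apply: (closure_notF adj_sym hC (clT y)) => yF.
    by have := F1 _ _ xF yF; rewrite -/(e x y) exy.
  (* The isomorphism carries the boundary of [C] into that of [D]. The preimages under [f] of these
     vertices equal [x] or are adjacent to it, so they lie in the closure of [C], and the clique has
     at least as many vertices as the boundary. *)
  have [g [[gf gi _] _ gb]] := S1 C D hC cD.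
  have /choice[k kE] (z : V) : exists u, F z -> f u = z.
    have [zF|zF] := pselect (F z); last by exists z.
    by have [u _ <-] := fs _ zF; exists u.
  have gbd (b : T) : b \in bd -> vboundary adj D (g (val b)).
    by move=> /bdP bb; rewrite -gb; exists (val b).
  have fk (b : T) : b \in bd -> f (k (g (val b))) = g (val b).
    by move=> bb; apply: kE; exact: (boundary_F adj_sym cD (gbd b bb)).
  have kcl (b : T) : b \in bd -> vclosure adj C (k (g (val b))).
    move=> bb; have [kx|kx] := pselect (k (g (val b)) = val x).
      by rewrite kx; exact: clT.
    apply: (cell_nbr adj_sym hC Cx); apply/fadj; split.
      by move/finj => h; apply: kx.
    by exists D; split=> //; [exact/BDP | rewrite fk//; exact: gbd].
  pose h (b : T) : T := insubd b (k (g (val b))).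
  have hE b : b \in bd -> val (h b) = k (g (val b)).
    move=> bb; have xT : k (g (val b)) \in cell_vertices adj C.
      by rewrite in_T; apply/mem_set; exact: kcl.
    by rewrite val_insubd xT.
  have hi : {in bd &, injective h}.
    move=> b b' bb bb' /(congr1 val); rewrite !hE// => /(congr1 f); rewrite !fk//.
    by move=> gg; apply: val_inj; apply: gi => //; rewrite inE; exact: clT.
  rewrite -(card_in_imset hi); apply: subset_leq_card; apply/fintype.subsetP => u.
  case/imsetP => b bb ->; rewrite BE; apply/BDP.
  by rewrite hE// fk//; exact: gbd.
Qed.

Let cell_mxE (K : fieldType) : cell_mx K adj C (vboundary adj C `\ val v) =
  mxfun (fun x y : T => if x \in [pred x in bd | x != v] then 0
    else if e x y then (fdeg e x)%:R^-1 else 0).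
Proof.
apply/matrixP => i j; rewrite !mxE; move: (enum_val i) (enum_val j) => x y /=.
rewrite fdegE -/(e x y); have -> : (val x \notin vboundary adj C `\ val v) =
    ~~ (x \in [pred x in bd | x != v]).
  rewrite [in RHS]inE /= in_bd; congr (~~ _); apply/idP/andP.
    by rewrite inE => -[/= xb xv]; split; [rewrite inE | apply/eqP => xE; rewrite xE in xv].
  by rewrite !inE => -[/= xb xv]; split=> // /val_inj xE; rewrite xE eqxx in xv.
by case: (x \in _); case: (e x y).
Qed.

Lemma cell_julia : let J := julia_set (ratfun_eval (transition_function R[i] v w)) in
  real_interval J \/ cantor_set J.
Proof.
apply: (@finite_graph_julia R T e bd v w e_sym fdeg_gt0 bd_indep e_connected
  vw_bd.1 vw_bd.2 hvw bd_homog cell_lower).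
by rewrite /transition_function bd_card /cell_resolvent cell_mxE.
Qed.

End CellGraph.

Theorem theorem9p1 (R : realType) (V : choiceType) (adj : rel V) (F : set V)
    (hX : infinite_graph adj)
    (hF : symmetrically_self_similar adj F)
    (hB : bounded_geometry adj F)
    (C : set V) (hC : cells adj F C)
    (v w : cell_vertices adj C)
    (hv : vboundary adj C (val v)) (hw : vboundary adj C (val w))
    (hvw : v <> w) :
  let d := transition_function R[i] v w in
  let J := julia_set (ratfun_eval d) in
  real_interval J \/ cantor_set J.
Proof. by apply: (cell_julia hX hF hC hv hw); apply/eqP. Qed.
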